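(* Let $\Gamma\subset\mathbb{C}$ be a lattice with dual lattice $\Gamma^*$. The Hamiltonian stationary weakly conformal Lagrangian immersions $X$ from $\mathbb{C}/\Gamma$ into $\mathbb{R}^4$ are characterized by their Lagrangian angle $\beta$, in as much as $\beta_0=\frac1\pi\frac{\partial\beta}{\partial\bar z}$ is a constant belonging to $\Gamma^*$. For a chosen $\beta_0\in\Gamma^*$, the set of solutions is the orbit under $\mathcal{G}_2$ of the real vector space of maps generated by the $A_\gamma$, $B_\gamma$ (viewed as maps on $\mathbb{C}/\Gamma$), as $\gamma$ ranges over the (possibly empty) finite set $$\Gamma^*_{\beta_0}=\Big\{\gamma\in\tfrac{\beta_0}{2}+\Gamma^*:\ |\gamma|^2=\big|\tfrac{\beta_0}{2}\big|^2,\ \gamma^2\neq\big(\tfrac{\beta_0}{2}\big)^2\Big\},$$ together with the translations of $\mathbb{R}^4$ (constant maps). If $\Gamma^*_{\beta_0}$ is not empty, the dimension (number of real parameters) of this set of solutions is $2\,\mathrm{Card}(\Gamma^*_{\beta_0})+5$, or $2\,\mathrm{Card}(\Gamma^*_{\beta_0})-3$ if one identifies solutions in the same $\mathcal{G}$-orbit.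
   Context: $\mathbb{R}^4$ has its standard inner product and symplectic form $\omega=dx^1\wedge dx^2+dx^3\wedge dx^4$; $L_i(x^1,x^2,x^3,x^4)=(-x^2,x^1,-x^4,x^3)$ is the complex structure, extended complex-linearly to $\mathbb{C}^4$. $\mathcal{G}_2=\{e^{\theta L_i}:\theta\in\mathbb{R}\}$; $\mathcal{G}$ is the group of maps $x\mapsto Gx+T$ with $T\in\mathbb{R}^4$, $G\in SO(4)$ commuting with $L_i$; these groups act on maps by composition on the left. $\epsilon=\frac12(1,0,-i,0)^T$, $\bar\epsilon=\frac12(1,0,i,0)^T$. $\langle\cdot,\cdot\rangle$ is the dot product on $\mathbb{C}\simeq\mathbb{R}^2$, and $\Gamma^*=\{\gamma\in\mathbb{C}:\langle\gamma,\Gamma\rangle\subset\mathbb{Z}\}$. A Hamiltonian stationary weakly conformal Lagrangian immersion from $\mathbb{C}/\Gamma$ with Lagrangian angle $\beta$ is a $\Gamma$-periodic smooth map $X:\mathbb{C}\to\mathbb{R}^4$ together with a harmonic function $\beta:\mathbb{C}\to\mathbb{R}$ such that $e^{i\beta}$ is $\Gamma$-periodic and $dX=e^{\beta L_i/2}(u\,dz+\bar u\,d\bar z)$ for some $u=a\epsilon+bL_i\bar\epsilon$ ($a,b:\mathbb{C}\to\mathbb{C}$ smooth) satisfying $\frac{\partial u}{\partial\bar z}=\frac12\frac{\partial\beta}{\partial z}L_i\bar u$; zeros of $u$ are allowed. (Where $u\ne0$, $X$ is a conformal Lagrangian immersion whose Lagrangian angle, defined by $(dx^1+i\,dx^2)\wedge(dx^3+i\,dx^4)(e_1,e_3)=e^{i\beta}$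 for $e_1=X_x/|X_x|$, $e_3=X_y/|X_y|$, is $\beta$.) For $\gamma\in\Gamma^*_{\beta_0}$ set $$v_\gamma(z)=e^{2i\pi\langle\gamma,z\rangle}\epsilon+\frac{2i\bar\gamma}{\beta_0}e^{-2i\pi\langle\gamma,z\rangle}L_i\bar\epsilon,\qquad w_\gamma(z)=ie^{2i\pi\langle\gamma,z\rangle}\epsilon+\frac{2\bar\gamma}{\beta_0}e^{-2i\pi\langle\gamma,z\rangle}L_i\bar\epsilon,$$ $$A_\gamma(z)=\int_0^ze^{\pi\langle\beta_0,\xi\rangle L_i}\big(v_\gamma(\xi)d\xi+\overline{v_\gamma(\xi)}d\bar\xi\big),\qquad B_\gamma(z)=\int_0^ze^{\pi\langle\beta_0,\xi\rangle L_i}\big(w_\gamma(\xi)d\xi+\overline{w_\gamma(\xi)}d\bar\xi\big)$$ (these integrals are path-independent). *)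

(* Defs.v *)
From HB Require Import structures.
From mathcomp Require Import all_boot all_order all_algebra.
From mathcomp Require Import generic_quotient complex.
From mathcomp Require Import all_classical all_reals all_analysis.
Set Implicit Arguments.
Unset Strict Implicit.
Unset Printing Implicit Defensive.
Import Order.TTheory GRing.Theory Num.Theory.
Import numFieldNormedType.Exports.
Local Open Scope classical_set_scope.
Local Open Scope ring_scope.

Section Lattices.
Variable R : realType.
Local Notation C := R[i].

Definition is_lattice (Gamma : set C) : Prop :=
  exists w1 w2 : C,
    (forall s t : R, s%:C%C * w1 + t%:C%C * w2 = 0 -> s = 0 /\ t = 0) /\
    Gamma = [set z | exists m n : int, z = w1 *~ m + w2 *~ n].

Definition dotC (z w : C) : R :=
  complex.Re z * complex.Re w + complex.Im z * complex.Im w.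

Definition dual_lattice (Gamma : set C) : set C :=
  [set g | forall w, Gamma w -> exists n : int, dotC g w = n%:~R].

Definition lattice_periodic (Gamma : set C) (V : Type) (f : C -> V) : Prop :=
  forall w z, Gamma w -> f (z + w) = f z.

Definition cis (t : R) : C := (cos t +i* sin t)%C.

End Lattices.

Section Derivatives.
Variable R : realType.
Local Notation C := R[i].

(* Derivative in the direction h of a function of the plane C = R^2; h = 1 and
   h = i give the partial derivatives in x and y.  R[i] is not registered as a
   normed space over R, hence the restriction to a line. *)
Definition ddir (h : C) (f : C -> R) (z : C) : R :=
  derive1 (fun t : R => f (z + t%:C%C * h)) 0.

Definition ddirC (h : C) (f : C -> C) (z : C) : C :=
  (ddir h (fun w => complex.Re (f w)) z
   +i* ddir h (fun w => complex.Im (f w)) z)%C.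

Definition ddirV (h : C) (X : C -> 'cV[R]_4) (z : C) : 'cV[R]_4 :=
  \col_j ddir h (fun w => X w j 0) z.

Definition dz (f : C -> C) (z : C) : C :=
  2^-1 * (ddirC 1 f z - 'i%C * ddirC 'i%C f z).

Definition dzbar (f : C -> C) (z : C) : C :=
  2^-1 * (ddirC 1 f z + 'i%C * ddirC 'i%C f z).

Fixpoint class_C (n : nat) (f : C -> R) : Prop :=
  if n is m.+1 then
    [/\ forall z, derivable (fun t : R => f (z + t%:C%C * 1)) 0 1,
        forall z, derivable (fun t : R => f (z + t%:C%C * 'i%C)) 0 1,
        class_C m (ddir 1 f) & class_C m (ddir 'i%C f)]
  else continuous (fun p : R * R => f (p.1 +i* p.2)%C).

Definition smooth (f : C -> R) : Prop := forall n, class_C n f.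

Definition smoothC (f : C -> C) : Prop :=
  smooth (fun z => complex.Re (f z)) /\ smooth (fun z => complex.Im (f z)).

Definition smoothV (X : C -> 'cV[R]_4) : Prop :=
  forall j, smooth (fun z => X z j 0).

Definition harmonic_fun (f : C -> R) : Prop :=
  class_C 2 f /\
  forall z, ddir 1 (ddir 1 f) z + ddir 'i%C (ddir 'i%C f) z = 0.

End Derivatives.

Section Geometry.
Variable R : realType.
Local Notation C := R[i].

Definition Li (K : pzRingType) : 'M[K]_4 :=
  \matrix_(i, j) nth 0 (nth [::] [:: [:: 0; -1; 0;  0];
                                     [:: 1;  0; 0;  0];
                                     [:: 0;  0; 0; -1];
                                     [:: 0;  0; 1;  0]] i) j.

Definition expLi (t : R) : 'M[R]_4 :=
  limn (series (fun k : nat => k`!%:R^-1 *: (t *: Li R) ^+ k)).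

Definition toCmx (m n : nat) (A : 'M[R]_(m, n)) : 'M[C]_(m, n) :=
  map_mx (real_complex R) A.

Definition conjmx (m n : nat) (A : 'M[C]_(m, n)) : 'M[C]_(m, n) :=
  map_mx (@conjc R) A.

Definition eps : 'cV[C]_4 :=
  2^-1 *: \col_j nth 0 [:: 1; 0; - 'i%C; 0] j.

Definition frame (a b : C) : 'cV[C]_4 :=
  a *: eps + b *: (Li C *m conjmx eps).

(* The C^4-valued 1-form e^{t L_i} (u dz + \bar u d\bar z) evaluated on h;
   it is invariant under conjugation, i.e. takes values in R^4. *)
Definition lform (t : R) (u : 'cV[C]_4) (h : C) : 'cV[C]_4 :=
  toCmx (expLi t) *m (h *: u + h^*%C *: conjmx u).

(* Zeros of u are allowed: X is a Hamiltonian stationary weakly conformal Lagrangian immersion of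
   C / Gamma with Lagrangian angle beta. *)
Definition HSL (Gamma : set C) (X : C -> 'cV[R]_4) (beta : C -> R) : Prop :=
  [/\ smoothV X, lattice_periodic Gamma X,
      harmonic_fun beta, lattice_periodic Gamma (fun z => cis (beta z)) &
      exists a b : C -> C,
        let u := fun z => frame (a z) (b z) in
        [/\ smoothC a, smoothC b,
            forall z h, toCmx (ddirV h X z) = lform (beta z / 2) (u z) h &
            forall z, \col_j dzbar (fun w => u w j 0) z =
              (2^-1 * dz (fun w => (beta w)%:C%C) z) *:
                (Li C *m conjmx (u z))]].

Definition beta0_at (beta : C -> R) (z : C) : C :=
  ((pi : R)^-1)%:C%C * dzbar (fun w => (beta w)%:C%C) z.

Definition solutions (Gamma : set C) (beta0 : C) : set (C -> 'cV[R]_4) :=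
  [set X | exists beta, HSL Gamma X beta /\ forall z, beta0_at beta z = beta0].

(* For beta0 in the dual lattice this set is stable under g |-> -g and does not
   contain 0, hence has even cardinality. *)
Definition freqs (Gamma : set C) (beta0 : C) : set C :=
  [set g | [/\ dual_lattice Gamma (g - beta0 / 2),
               `|g| ^+ 2 = `|beta0 / 2| ^+ 2 & g ^+ 2 != (beta0 / 2) ^+ 2]].

Definition vgam (beta0 g z : C) : 'cV[C]_4 :=
  frame (cis (2 * pi * dotC g z))
        (2 * 'i%C * g^*%C / beta0 * cis (- (2 * pi * dotC g z))).

Definition wgam (beta0 g z : C) : 'cV[C]_4 :=
  frame ('i%C * cis (2 * pi * dotC g z))
        (2 * g^*%C / beta0 * cis (- (2 * pi * dotC g z))).

(* Integral over the segment t |-> t z, t in [0, 1], of the closed 1-form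
   e^{pi <beta0, xi> L_i} (u(xi) d xi + \bar{u(xi)} d \bar xi), whose values are
   real vectors (so that Re only changes the type). *)
Definition primitive (beta0 : C) (u : C -> 'cV[C]_4) (z : C) : 'cV[R]_4 :=
  \col_j \int[lebesgue_measure]_(t in `[(0 : R), 1])
    complex.Re (lform (pi * dotC beta0 (t%:C%C * z)) (u (t%:C%C * z)) z j 0).

Definition Agam (beta0 g : C) : C -> 'cV[R]_4 := primitive beta0 (vgam beta0 g).

Definition Bgam (beta0 g : C) : C -> 'cV[R]_4 := primitive beta0 (wgam beta0 g).

Definition linear_span (V : lmodType R) (S : set V) : set V :=
  [set v | exists (n : nat) (c : 'I_n -> R) (s : 'I_n -> V),
     (forall i, S (s i)) /\ v = \sum_(i < n) c i *: s i].

Definition generators (Gamma : set C) (beta0 : C) : set (C -> 'cV[R]_4) :=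
  [set Agam beta0 g | g in freqs Gamma beta0] `|`
  [set Bgam beta0 g | g in freqs Gamma beta0] `|`
  [set cst T | T in [set: 'cV[R]_4]].

Definition G2_orbit (S : set (C -> 'cV[R]_4)) : set (C -> 'cV[R]_4) :=
  [set X | exists t Y, S Y /\ X = fun z => expLi t *m Y z].

(* Linear parts of the elements of the group G. *)
Definition linG (A : 'M[R]_4) : Prop :=
  [/\ A^T *m A = 1%:M, \det A = 1 & A *m Li R = Li R *m A].

Definition sameG (X Y : C -> 'cV[R]_4) : Prop :=
  exists A T, linG A /\ Y = fun z => A *m X z + T.

Lemma linG1 : linG 1%:M.
Proof. by split; rewrite ?trmx1 ?mulmx1 ?mul1mx ?det1. Qed.

Lemma linGM A B : linG A -> linG B -> linG (A *m B).
Proof.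
move=> [A1 A2 A3] [B1 B2 B3]; split.
- by rewrite trmx_mul mulmxA -(mulmxA B^T) A1 mulmx1.
- by rewrite det_mulmx A2 B2 mulr1.
- by rewrite -mulmxA B3 !mulmxA A3.
Qed.

Lemma linGV A : linG A -> linG A^T.
Proof.
move=> [A1 A2 A3]; have A1' := mulmx1C A1; split.
- by rewrite trmxK.
- by rewrite det_tr.
- rewrite -[LHS]mulmx1 -A1' !mulmxA -[_ *m Li R *m A]mulmxA -A3.
  by rewrite mulmxA A1 mul1mx.
Qed.

Lemma sameG_refl X : sameG X X.
Proof.
exists 1%:M, 0; split; first exact: linG1.
by apply/funext => z; rewrite mul1mx addr0.
Qed.

Lemma sameG_sym X Y : sameG X Y -> sameG Y X.
Proof.
move=> [A [T [AG ->]]]; exists A^T, (- (A^T *m T)); split; first exact: linGV.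
by apply/funext => z; case: AG => A1 _ _; rewrite mulmxDr mulmxA A1 mul1mx addrK.
Qed.

Lemma sameG_trans X Y Z : sameG X Y -> sameG Y Z -> sameG X Z.
Proof.
move=> [A [T [AG ->]]] [B [U [BG ->]]].
exists (B *m A), (B *m T + U); split; first exact: linGM.
by apply/funext => z; rewrite mulmxDr mulmxA addrA.
Qed.

End Geometry.

Section Dimension.
Variable R : realType.
Local Notation C := R[i].

Definition homeo (T T' : topologicalType) (U : set T) (W : set T')
    (f : T -> T') (g : T' -> T) : Prop :=
  [/\ forall x, U x -> W (f x) /\ g (f x) = x,
      forall y, W y -> U (g y) /\ f (g y) = y,
      {within U, continuous f} & {within W, continuous g}].

Definition locally_euclidean_at (T : topologicalType) (k : nat) (x : T) : Prop :=
  exists (U : set T) (W : set 'rV[R]_k) f g,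
    [/\ open U, U x, open W & homeo U W f g].

(* "T depends on k real parameters": away from a closed set with empty interior
   T is a topological k-manifold.  The exceptional set is needed, as solution
   sets are singular at the constant maps.  For nonempty T, k is unique by
   invariance of domain. *)
Definition has_dimension (T : topologicalType) (k : nat) : Prop :=
  exists O : set T,
    [/\ open O, dense O & forall x, O x -> locally_euclidean_at k x].

(* A set of maps with the topology of uniform convergence.  Finite-dimensional
   families of bounded maps get the same topology from any of the usual function
   space topologies. *)
Definition maps_space (S : set (C -> 'cV[R]_4)) : topologicalType :=
  set_type (S : set {uniform C -> 'cV[R]_4}).

Definition same_orbit (S : set (C -> 'cV[R]_4)) : rel (maps_space S) :=
  fun X Y => `[< sameG (set_val X) (set_val Y) >].

Lemma same_orbit_refl S : reflexive (@same_orbit S).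
Proof. by move=> X; apply/asboolP; exact: sameG_refl. Qed.

Lemma same_orbit_sym S : symmetric (@same_orbit S).
Proof. by move=> X Y; apply/asboolP/asboolP; exact: sameG_sym. Qed.

Lemma same_orbit_trans S : transitive (@same_orbit S).
Proof.
by move=> Y X Z /asboolP XY /asboolP YZ; apply/asboolP; exact: sameG_trans YZ.
Qed.

Canonical same_orbit_equiv S :=
  EquivRel (@same_orbit S) (@same_orbit_refl S) (@same_orbit_sym S)
    (@same_orbit_trans S).

Definition orbit_space (S : set (C -> 'cV[R]_4)) : topologicalType :=
  quotient_topology {eq_quot (same_orbit_equiv S)}%qT.

End Dimension.

(* Main.v *)
Require Import Defs.
From mathcomp Require Import all_boot all_order all_algebra.
From mathcomp Require Import finmap complex generic_quotient.
From mathcomp Require Import all_classical all_reals all_analysis.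
From mathcomp Require Import zify ring lra.
Import Order.TTheory GRing.Theory Num.Theory.
Import numFieldNormedType.Exports.
Local Open Scope classical_set_scope.
Local Open Scope ring_scope.

Set Implicit Arguments.
Unset Strict Implicit.
Unset Printing Implicit Defensive.

(** The coordinates p = cp x and q = cq x identify (R^4, Li) with C^2, and in them the
    condition on dX reads, with D1 and Di the partial derivatives,
      D1 q = i e^{i beta} conj(Di p),    Di q = - i e^{i beta} conj(D1 p).

    The angle is affine (angle_affine). Along a lattice vector beta changes by a
    continuous function with values in 2 pi Z, hence by a constant; after subtraction of
    a linear function beta becomes periodic and harmonic, hence constant. Thus
    beta(z) = c + 2 pi <beta0, z> with beta0 in the dual lattice.

    The solutions are explicit (HSL_solX, solX_HSL). For such a beta the system couples
    only the Fourier coefficient of q at eta with that of p at beta0 - eta, by two linear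
    equations. Nonzero values require eta and beta0 - eta to be orthogonal, that is, equal
    to delta - g and delta + g with delta = beta0 / 2 and |g| = |delta|, or one of them to
    be 0 and the value to be a translation. Therefore X is the map
      solX:  p = T1 + sum_g P_g e_{delta+g},
             q = T2 - mu sum_g (delta+g)/(delta-g) conj(P_g) e_{delta-g},
    where g runs over the finite set of admissible frequencies, e_g(z) is
    e^{2 i pi <g, z>}, mu = e^{ic}, and the complex numbers P_g, T1, T2 are free. That
    Fourier coefficients determine a continuous function on the torus is proved by
    testing it against powers of a trigonometric polynomial that peaks at one point
    (fourier_unique).

    Up to constants, A_g and B_g are the maps solX with mu = 1, the single frequency g
    and an amplitude, respectively i times it (Agam_gen, Bgam_gen); so their span
    together with the constants consists of the solX with mu = 1. The phases e^{t Li} turn mu by 2 t, which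
    yields all solutions (G2_orbit_solX).

    Dimension of the solutions (has_dimension_solutions). The Fourier coefficients are
    continuous for uniform convergence and, conversely, solX depends continuously on its
    parameters, uniformly on the plane. With N admissible frequencies, the P_g, T1, T2 and
    tan(c / 2) are global coordinates on a dense open set, of dimension 2 (N + 2) + 1.

    Dimension of the space of orbits (has_dimension_orbits). The linear parts of the
    ambient symmetries act on (p, q) as the unitary group of C^2 (linG_unitary,
    unitary_linG), hence by one unitary matrix on all the vectors W_g of coefficients of
    (p, q) at delta + g. The Hermitian products <W_g, W_g0> are invariant, W_(-g0) is
    orthogonal to W_g0, and a unitary map takes W_g0 to (|W_g0|, 0); it normalises mu to 1,
    P_g0 to |W_g0|, P_(-g0) to 0 and P_g to <W_g, W_g0> / |W_g0|. So |W_g0| and the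
    N - 2 remaining products are coordinates, of dimension 2 (N - 2) + 1. *)

Local Notation Re := (@complex.Re _).
Local Notation Im := (@complex.Im _).

(** * Integrals of periodic functions over a period *)

Section PeriodIntegral.
Variable R : realType.
Local Notation mu := (@lebesgue_measure R).
Implicit Types f g F : R -> R.

Definition int01 f : R := \int[mu]_(t in `[(0 : R), 1]) f t.

Lemma continuous_integrable f (a b : R) :
  continuous f -> mu.-integrable `[a, b] (EFin \o f).
Proof.
move=> cf; apply: (@continuous_compact_integrable R f); first exact: segment_compact.
exact: continuous_subspaceT.
Qed.

Lemma is_derive_continuous f (df : R) (x : R) :
  is_derive x 1 f df -> {for x, continuous f}.
Proof.
by move=> [d _]; apply: differentiable_continuous; apply/derivable1_diffP.
Qed.

Lemma continuous_shift f (a : R) : continuous f -> continuous (fun y => f (y + a)).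
Proof.
move=> cf x; apply: (continuous_comp (f := fun y => y + a)); last exact: cf.
by apply: cvgD; [exact: cvg_id|exact: cvg_cst].
Qed.

Lemma derive0_eq F (a b : R) : a <= b ->
  (forall x : R, a <= x <= b -> is_derive x 1 F 0) -> F a = F b.
Proof.
move=> ab dF; have [x||c _] := @MVT_segment R F (fun=> 0) a b ab.
- by rewrite in_itv /= => /andP[/ltW ax /ltW xb]; apply: dF; rewrite ax.
- apply: continuous_in_subspaceT => x; rewrite inE /= in_itv /= => /dF.
  exact: is_derive_continuous.
- by rewrite mul0r => /eqP; rewrite subr_eq0 => /eqP.
Qed.

Lemma local_primitive f (N : R) : continuous f ->
  exists F, forall x : R, - N < x < N -> is_derive x 1 F (f x).
Proof.
move=> cf; exists (fun y => \int[mu]_(t in `[- N, y]) f t) => x /andP[Nx xN].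
have [] := @continuous_FTC1_closed R f (- N) x N xN (@continuous_integrable f (- N) N cf) Nx (cf x).
by move=> d <-; rewrite derive1E; exact: derivableP.
Qed.

Lemma int01_FTC f F : continuous f ->
  (forall x : R, 0 <= x <= 1 -> is_derive x 1 F (f x)) -> int01 f = F 1 - F 0.
Proof.
move=> cf dF; rewrite /int01 /Rintegral (@continuous_FTC2 R f F 0 1) //.
- exact: continuous_subspaceT.
- have c0 : {for 0, continuous F} by apply: is_derive_continuous (dF 0 _); rewrite lexx ler01.
  have c1 : {for 1, continuous F} by apply: is_derive_continuous (dF 1 _); rewrite lexx ler01.
  split; [|exact: cvg_at_right_filter c0|exact: cvg_at_left_filter c1].
  move=> x; rewrite in_itv /= => /andP[/ltW x0 /ltW x1].
  by case: (dF x _) => //; rewrite x0.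
- move=> x; rewrite in_itv /= => /andP[/ltW x0 /ltW x1].
  have [|_ <-] := dF x; first by rewrite x0.
  by rewrite derive1E.
Qed.

Lemma int01D f g : continuous f -> continuous g ->
  int01 (fun t => f t + g t) = int01 f + int01 g.
Proof. by move=> cf cg; rewrite /int01 RintegralD //; exact: continuous_integrable. Qed.

Lemma int01Z f (c : R) : continuous f -> int01 (fun t => c * f t) = c * int01 f.
Proof. by move=> cf; rewrite /int01 RintegralZl //; exact: continuous_integrable. Qed.

Lemma int01_cst (c : R) : int01 (fun=> c) = c.
Proof.
have dF (x : R) : 0 <= x <= 1 -> is_derive x 1 (fun x => c * x) c.
  have dc : is_derive x 1 (c \*: (@id R)) (c *: (1 : R)) by exact: is_deriveZ.
  by move=> _; apply: is_derive_eq dc _; exact: mulr1.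
rewrite (int01_FTC _ dF); last by move=> x; exact: cvg_cst.
by rewrite mulr1 mulr0 subr0.
Qed.

Lemma le_int01 f g : continuous f -> continuous g ->
  (forall t, f t <= g t) -> int01 f <= int01 g.
Proof.
by move=> cf cg fg; apply: le_Rintegral => //; exact: continuous_integrable.
Qed.

(** The integral over [a, a + 1] has derivative f (a + 1) - f a = 0 in a. *)
Lemma int01_shift f (a : R) : continuous f -> (forall t, f (t + 1) = f t) ->
  int01 (fun t => f (t + a)) = int01 f.
Proof.
move=> cf pf; have [F dF] := @local_primitive f (`|a| + 2) cf.
have dFc (c x : R) : - (`|a| + 2) < x + c < `|a| + 2 ->
    is_derive x 1 (fun y => F (y + c)) (f (x + c)).
  move=> xc; have dc : is_derive x 1 (fun y => y + c) (1 : R).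
    by apply: is_derive_eq; rewrite addr0.
  apply: is_derive_eq (is_derive1_comp (g := fun y => y + c) (dF _ xc) dc) _.
  by rewrite mulr1.
have bnd (x b : R) : `|b| <= `|a| -> 0 <= x <= 1 -> - (`|a| + 2) < x + b < `|a| + 2.
  move=> ba /andP[x0 x1]; have := ler_norm b; have := ler_norm (- b); rewrite normrN; lra.
have ca := @continuous_shift f a cf.
have dFa : forall y : R, 0 <= y <= 1 -> is_derive y 1 (fun z => F (z + a)) (f (y + a)).
  by move=> y /(bnd y a (lexx _)) /dFc.
have dF0 : forall y : R, 0 <= y <= 1 -> is_derive y 1 F (f y).
  by move=> y y01; apply: dF; rewrite -[y]addr0 bnd // normr0.
rewrite (int01_FTC ca dFa) (int01_FTC cf dF0).
(* x |-> F (x + 1) - F x is constant between 0 and a *)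
pose D y := F (y + 1) - F y.
have dD (x : R) : `|x| <= `|a| -> is_derive x 1 D 0.
  rewrite ler_norml => /andP[Nax xa].
  have d1 : is_derive x 1 (fun y => F (y + 1)) (f (x + 1)) by apply: dFc; lra.
  have d0 : is_derive x 1 F (f x) by apply: dF; lra.
  by apply: is_derive_eq (is_deriveB d1 d0) _; rewrite pf subrr.
have : D 0 = D a.
  have aa := ler_norm a; have Na := ler_norm (- a); rewrite normrN in Na.
  case: (leP 0 a) => a0; last apply/esym.
    by apply: derive0_eq => // y y0a; apply: dD; rewrite ler_norml; lra.
  by apply: derive0_eq => [|y ya0]; [exact: ltW|apply: dD; rewrite ler_norml; lra].
by rewrite /D !add0r [a + 1]addrC => ->.
Qed.

(** A primitive of f is nondecreasing with equal values at 0 and 1; the shift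
    moves any given point to the interior point 1/2. *)
Lemma int01_eq0 f : continuous f -> (forall t, f (t + 1) = f t) ->
  (forall t, 0 <= f t) -> int01 f = 0 -> forall t, f t = 0.
Proof.
move=> + + + + t0.
wlog -> : f t0 / t0 = 1 / 2 => [wl cf pf f0 If|cf pf f0 If].
  have cg := @continuous_shift f (t0 - 1 / 2) cf.
  have := wl (fun y => f (y + (t0 - 1 / 2))) (1 / 2) erefl cg.
  rewrite int01_shift // [1 / 2 + _]addrC subrK; apply => // t; by rewrite addrAC pf.
have [F dF] := @local_primitive f 2 cf.
have dF0 : forall y : R, 0 <= y <= 1 -> is_derive y 1 F (f y) by move=> y ?; apply: dF; lra.
have F10 : F 1 = F 0 by apply/eqP; rewrite -subr_eq0 -(int01_FTC cf dF0) If.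
have mono (x y : R) : 0 <= x -> x <= y -> y <= 1 -> F x <= F y.
  move=> x0 xy y1; have [z||c _] := @MVT_segment R F f x y xy.
  - by rewrite in_itv /= => z01; apply: dF0; lra.
  - apply: continuous_in_subspaceT => z; rewrite inE /= in_itv /= => zxy.
    by apply: is_derive_continuous (dF0 z _); lra.
  - by move=> e; rewrite -subr_ge0 e mulr_ge0 // subr_ge0.
have Fc (x : R) : 0 <= x <= 1 -> F x = F 0.
  by move=> x01; apply/eqP; rewrite eq_le -{1}F10 !mono //; lra.
have [_ <-] : is_derive (1 / 2 : R) 1 F (f (1 / 2)) by apply: dF0; lra.
suff [_ ->] : is_derive (1 / 2 : R) 1 F 0 by [].
have dc : is_derive (1 / 2 : R) 1 (fun=> F 0) 0 := is_derive_cst (F 0) _ _.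
apply: near_eq_is_derive dc.
have h : (1 / 2 : R) \in `]0, 1[ by rewrite in_itv /=; lra.
have := near_in_itvoo h; apply: filterS => x.
by rewrite in_itv /= => x01; rewrite Fc //; lra.
Qed.

End PeriodIntegral.

(** * The plane, its trigonometric functions and the mean of a doubly periodic function *)

Section Plane.
Variable R : realType.
Local Notation C := R[i].
Implicit Types (z w h g : C) (f : C -> R).

Lemma ReE z : z = (Re z +i* Im z)%C. Proof. by case: z. Qed.
Lemma ReD z w : Re (z + w) = Re z + Re w. Proof. by case: z; case: w. Qed.
Lemma ImD z w : Im (z + w) = Im z + Im w. Proof. by case: z; case: w. Qed.
Lemma ReN z : Re (- z) = - Re z. Proof. by case: z. Qed.
Lemma ImN z : Im (- z) = - Im z. Proof. by case: z. Qed.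
Lemma ReM z w : Re (z * w) = Re z * Re w - Im z * Im w.
Proof. by case: z; case: w. Qed.
Lemma ImM z w : Im (z * w) = Re z * Im w + Im z * Re w.
Proof. by case: z => a b; case: w. Qed.
Lemma ReJ z : Re z^*%C = Re z. Proof. by case: z. Qed.
Lemma ImJ z : Im z^*%C = - Im z. Proof. by case: z. Qed.

Definition ReImE := (ReD, ImD, ReN, ImN, ReM, ImM, ReJ, ImJ).

Lemma eqC z w : Re z = Re w -> Im z = Im w -> z = w.
Proof. by case: z => a b; case: w => c d /= -> ->. Qed.

Lemma dotCDr g z w : dotC g (z + w) = dotC g z + dotC g w.
Proof. by rewrite /dotC !ReImE; ring. Qed.
Lemma dotCDl g h z : dotC (g + h) z = dotC g z + dotC h z.
Proof. by rewrite /dotC !ReImE; ring. Qed.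
Lemma dotCNl g z : dotC (- g) z = - dotC g z.
Proof. by rewrite /dotC !ReImE; ring. Qed.
Lemma dotCZr g (t : R) z : dotC g (t%:C%C * z) = t * dotC g z.
Proof. by rewrite /dotC !ReImE /=; ring. Qed.
Lemma dotC0l z : dotC 0 z = 0.
Proof. by rewrite /dotC /= !mul0r addr0. Qed.

Definition cont2 f := continuous (fun p : R * R => f (p.1 +i* p.2)%C).

Lemma cont2_comp f (T : topologicalType) (u : T -> C) (x : T) : cont2 f ->
  {for x, continuous (fun y => Re (u y))} ->
  {for x, continuous (fun y => Im (u y))} ->
  {for x, continuous (fun y => f (u y))}.
Proof.
move=> cf cu cv.
rewrite /prop_for /continuous_at [X in _ --> f X]ReE.
under [X in X @ _]funext => y do rewrite [u y]ReE.
have cf' := cf (Re (u x), Im (u x)).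
exact: (@continuous2_cvg _ _ _ _ _ _ _ _ (fun a b => f (a +i* b)%C) _ _ cf' cu cv).
Qed.

Lemma cont2_cst (c : R) : cont2 (fun=> c).
Proof. by move=> x; exact: cvg_cst. Qed.
Lemma cont2_Re : cont2 Re. Proof. by move=> x; exact: cvg_fst. Qed.
Lemma cont2_Im : cont2 Im. Proof. by move=> x; exact: cvg_snd. Qed.
Lemma cont2D f f' : cont2 f -> cont2 f' -> cont2 (fun z => f z + f' z).
Proof. by move=> cf cf' x; apply: cvgD; [exact: cf|exact: cf']. Qed.
Lemma cont2M f f' : cont2 f -> cont2 f' -> cont2 (fun z => f z * f' z).
Proof. by move=> cf cf' x; apply: cvgM; [exact: cf|exact: cf']. Qed.
Lemma cont2N f : cont2 f -> cont2 (fun z => - f z).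
Proof. by move=> cf x; apply: cvgN; exact: cf. Qed.
Lemma cont2_fun (k : R -> R) f : continuous k -> cont2 f -> cont2 (fun z => k (f z)).
Proof. by move=> ck cf x; apply: continuous_comp; [exact: cf|exact: ck]. Qed.
Lemma cont2_dot g : cont2 (dotC g).
Proof.
rewrite /dotC; apply: cont2D; apply: cont2M; try exact: cont2_cst.
- exact: cont2_Re.
- exact: cont2_Im.
Qed.

(** The real characters of the plane, with a phase so that the family is stable
    under translations and under derivatives. *)
Definition wave g (c : R) z : R := cos (2 * pi * dotC g z + c).

Lemma cont2_wave g c : cont2 (wave g c).
Proof.
apply: cont2_fun; first exact: continuous_cos.
apply: cont2D; last exact: cont2_cst.
apply: cont2M; [exact: cont2_cst|exact: cont2_dot].
Qed.

Lemma waveM g h c d z :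
  wave g c z * wave h d z = 2^-1 * wave (g + h) (c + d) z + 2^-1 * wave (g - h) (c - d) z.
Proof.
rewrite /wave.
have -> : 2 * pi * dotC (g + h) z + (c + d) = (2 * pi * dotC g z + c) + (2 * pi * dotC h z + d).
  by rewrite dotCDl; ring.
have -> : 2 * pi * dotC (g - h) z + (c - d) = (2 * pi * dotC g z + c) - (2 * pi * dotC h z + d).
  by rewrite dotCDl dotCNl; ring.
by move: (_ + c) (_ + d) => a b; rewrite cosD cosB; field.
Qed.

End Plane.

Lemma cos_periodz (R : realType) (x : R) (n : int) : cos (x + 2 * pi * n%:~R) = cos x.
Proof.
have cosn (y : R) (m : nat) : cos (y + 2 * pi * m%:R) = cos y.
  rewrite -(periodicn (@cosD2pi R) m y); congr (cos (y + _)).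
  by rewrite -[pi *+ 2]mulr_natr -[RHS]mulr_natr; ring.
case: n => n; first by rewrite -pmulrn cosn.
by rewrite -(cosn (x + _) n.+1) NegzE mulrNz -pmulrn mulrN subrK.
Qed.

Lemma sin_periodz (R : realType) (x : R) (n : int) : sin (x + 2 * pi * n%:~R) = sin x.
Proof.
rewrite -[LHS]opprK -cosDpihalf -[RHS]opprK -cosDpihalf.
by rewrite addrAC cos_periodz.
Qed.

Section Torus.
Variable R : realType.
Local Notation C := R[i].
Variables w1 w2 : C.
(** Up to sign the area of a period parallelogram; nonzero for a basis of C over R. *)
Definition area := Re w1 * Im w2 - Im w1 * Re w2.
Hypothesis area0 : area != 0.
Implicit Types (z w h g : C) (f G : C -> R).

(** The continuous functions on the torus C / (Z w1 + Z w2). *)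
Definition CP f := [/\ cont2 f, forall z, f (z + w1) = f z & forall z, f (z + w2) = f z].

Definition latpt (s t : R) : C := s%:C%C * w1 + t%:C%C * w2.
Definition crd1 z := (Re z * Im w2 - Im z * Re w2) / area.
Definition crd2 z := (Re w1 * Im z - Im w1 * Re z) / area.

Lemma latptK z : latpt (crd1 z) (crd2 z) = z.
Proof.
have a0 := area0; apply: eqC; rewrite /latpt /crd1 /crd2 !ReImE /= !mul0r ?subr0 ?addr0;
  by move: a0; rewrite /area => a0; field.
Qed.

Lemma latptD s t s' t' : latpt (s + s') (t + t') = latpt s t + latpt s' t'.
Proof. by rewrite /latpt !rmorphD /=; ring. Qed.

Lemma periodic_latpt (V : Type) (f : C -> V) z (m n : int) :
  (forall z, f (z + w1) = f z) -> (forall z, f (z + w2) = f z) ->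
  f (z + latpt m%:~R n%:~R) = f z.
Proof.
move=> p1 p2.
have per w (k : int) : (forall z, f (z + w) = f z) -> forall z, f (z + w *~ k) = f z.
  move=> pw; have pn (j : nat) : forall y, f (y + w *+ j) = f y.
    elim: j => [|j IH] y; first by rewrite mulr0n addr0.
    by rewrite mulrS addrA IH pw.
  case: k => j y; first exact: pn.
  by rewrite NegzE mulrNz -[LHS](pn j.+1) subrK.
rewrite /latpt !rmorph_int !mulrzl addrA.
by rewrite (per w2 n p2) (per w1 m p1).
Qed.

Lemma CP_int f z (m n : int) : CP f -> f (z + latpt m%:~R n%:~R) = f z.
Proof. by move=> [_ p1 p2]; exact: periodic_latpt. Qed.

Lemma CP_reduce z : exists m n : int, exists s t : R,
  [/\ 0 <= s <= 1, 0 <= t <= 1 & z = latpt s t + latpt m%:~R n%:~R].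
Proof.
exists (Num.floor (crd1 z)), (Num.floor (crd2 z)), (crd1 z - (Num.floor (crd1 z))%:~R),
  (crd2 z - (Num.floor (crd2 z))%:~R); split; last by rewrite -latptD !subrK latptK.
- by have := real_floor_itv (num_real (crd1 z)); rewrite intrD; lra.
- by have := real_floor_itv (num_real (crd2 z)); rewrite intrD; lra.
Qed.

Lemma cont2_latpt f : cont2 f -> continuous (fun p : R * R => f (latpt p.1 p.2)).
Proof.
move=> cf p; apply: (@cont2_comp R f _ (fun p : R * R => latpt p.1 p.2) _ cf).
- have -> : (fun p : R * R => Re (latpt p.1 p.2)) = (fun p => p.1 * Re w1 + p.2 * Re w2).
    by apply/funext => q; rewrite /latpt !ReImE /= !mul0r !subr0.
  by apply: cvgD; apply: cvgM; try exact: cvg_cst; [exact: cvg_fst|exact: cvg_snd].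
- have -> : (fun p : R * R => Im (latpt p.1 p.2)) = (fun p => p.1 * Im w1 + p.2 * Im w2).
    by apply/funext => q; rewrite /latpt !ReImE /= !mul0r !addr0.
  by apply: cvgD; apply: cvgM; try exact: cvg_cst; [exact: cvg_fst|exact: cvg_snd].
Qed.

(** The period parallelogram is compact, and translates of it cover the plane. *)
Lemma CP_unif f : CP f -> forall e : R, 0 < e -> exists2 d : R, 0 < d &
  forall z h, `|Re h| < d -> `|Im h| < d -> `|f (z + h) - f z| < e.
Proof.
move=> cpf e e0; have [cf _ _] := cpf.
have cK : compact (`[(0 : R), 1] `*` `[(0 : R), 1]).
  by apply: compact_setX; exact: segment_compact.
have /compact_near_coveringP/(_ _ (nbhs ((0, 0) : R * R))
  (fun h p : R * R => `|f (latpt p.1 p.2 + (h.1 +i* h.2)%C) - f (latpt p.1 p.2)| < e)) := cK.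
case=> [p _|[A B] /= [/nbhs_ballP[d1 /= d10 dA] /nbhs_ballP[d2 /= d20 dB]] AB].
  pose u (q : (R * R) * (R * R)) := latpt q.1.1 q.1.2.
  pose v (q : (R * R) * (R * R)) := u q + (q.2.1 +i* q.2.2)%C.
  have c21 : continuous (fun q : (R * R) * (R * R) => q.2.1).
    by move=> q; exact: (cvg_comp _ _ cvg_snd cvg_fst).
  have c22 : continuous (fun q : (R * R) * (R * R) => q.2.2).
    by move=> q; exact: (cvg_comp _ _ cvg_snd cvg_snd).
  have cu k : cont2 k -> continuous (fun q => k (u q)).
    move=> ck q; apply: (continuous_comp (f := fst) (g := fun p : R * R => k (latpt p.1 p.2))).
      exact: cvg_fst.
    exact: cont2_latpt.
  have cv q : {for q, continuous (fun q => f (v q))}.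
    apply: (@cont2_comp R f _ v _ cf).
      have -> : (fun q => Re (v q)) = (fun q => Re (u q) + q.2.1).
        by apply/funext => y; rewrite /v ReD.
      by apply: cvgD; [exact: cu (@cont2_Re R) q|exact: c21].
    have -> : (fun q => Im (v q)) = (fun q => Im (u q) + q.2.2).
      by apply/funext => y; rewrite /v ImD.
    by apply: cvgD; [exact: cu (@cont2_Im R) q|exact: c22].
  pose q0 : (R * R) * (R * R) := (p, (0, 0)).
  have cvu : (fun q => f (v q) - f (u q)) @ q0 --> (0 : R).
    have <- : f (v q0) - f (u q0) = 0.
      by rewrite /v /= -[(0 +i* 0)%C]/(0 : C) addr0 subrr.
    by apply: cvgB; [exact: (cv q0)|exact: (cu f cf q0)].
  exact: (cvgr0_norm_lt _ cvu _ e0).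
exists (Num.min d1 d2) => [|z h]; first by rewrite lt_min d10.
rewrite !lt_min => /andP[h1 _] /andP[_ h2].
have [m [n [s [t [s01 t01 ->]]]]] := CP_reduce z.
rewrite addrAC !(CP_int _ _ _ cpf).
have := AB (Re h, Im h) _ (s, t) _; rewrite /= -ReE; apply.
  by split; [apply: dA|apply: dB]; rewrite /ball /= sub0r normrN.
by split; rewrite /= in_itv.
Qed.

Lemma CP_bounded f : CP f -> exists B : R, forall z, `|f z| <= B.
Proof.
move=> cpf; have [cf _ _] := cpf.
have cK : compact (`[(0 : R), 1] `*` `[(0 : R), 1]).
  by apply: compact_setX; exact: segment_compact.
have K0 : (`[(0 : R), 1] `*` `[(0 : R), 1]) !=set0.
  by exists (0, 0); split; rewrite /= in_itv /= lexx ler01.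
have cn : {within `[(0 : R), 1] `*` `[(0 : R), 1],
    continuous (fun p : R * R => `|f (latpt p.1 p.2)|)}.
  apply: continuous_subspaceT => p.
  apply: (continuous_comp (f := fun p : R * R => f (latpt p.1 p.2)) (g := fun x : R => `|x|)).
    exact: cont2_latpt.
  exact: norm_continuous.
have [p _ pM] := compact_EVT_max K0 cK cn.
exists `|f (latpt p.1 p.2)| => z.
have [m [n [s [t [s01 t01 ->]]]]] := CP_reduce z; rewrite CP_int //.
by apply: (pM (s, t)); rewrite inE; split; rewrite /= in_itv.
Qed.

Lemma CP_cst (c : R) : CP (fun=> c).
Proof. by split => //; exact: cont2_cst. Qed.
Lemma CPD f G : CP f -> CP G -> CP (fun z => f z + G z).
Proof.
move=> [cf f1 f2] [cG G1 G2]; split => [|z|z]; first exact: cont2D.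
  by rewrite f1 G1.
by rewrite f2 G2.
Qed.
Lemma CPM f G : CP f -> CP G -> CP (fun z => f z * G z).
Proof.
move=> [cf f1 f2] [cG G1 G2]; split => [|z|z]; first exact: cont2M.
  by rewrite f1 G1.
by rewrite f2 G2.
Qed.
Lemma CPZ f (c : R) : CP f -> CP (fun z => c * f z).
Proof. by move=> cf; apply: CPM => //; exact: CP_cst. Qed.
Lemma CPN f : CP f -> CP (fun z => - f z).
Proof. by move=> [cf f1 f2]; split => [|z|z]; [exact: cont2N|rewrite f1|rewrite f2]. Qed.
Lemma CPB f G : CP f -> CP G -> CP (fun z => f z - G z).
Proof. by move=> cf cG; apply: CPD => //; exact: CPN. Qed.
Lemma CP_shift f h : CP f -> CP (fun z => f (z + h)).
Proof.
move=> [cf f1 f2]; split => [|z|z].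
- move=> p; apply: (@cont2_comp R f _ (fun p : R * R => (p.1 +i* p.2)%C + h) _ cf).
    have -> : (fun p : R * R => Re ((p.1 +i* p.2)%C + h)) = (fun p => p.1 + Re h).
      by apply/funext => q; rewrite ReD.
    by apply: cvgD; [exact: cvg_fst|exact: cvg_cst].
  have -> : (fun p : R * R => Im ((p.1 +i* p.2)%C + h)) = (fun p => p.2 + Im h).
    by apply/funext => q; rewrite ImD.
  by apply: cvgD; [exact: cvg_snd|exact: cvg_cst].
- by rewrite addrAC f1.
- by rewrite addrAC f2.
Qed.

(** The Haar mean of the torus; iterating the integral over a period reduces its
    properties to those of int01. *)
Definition mean f : R := int01 (fun t => int01 (fun s => f (latpt s t))).

Lemma CP_row f (t : R) : CP f ->
  continuous (fun s => f (latpt s t)) /\ (forall s, f (latpt (s + 1) t) = f (latpt s t)).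
Proof.
move=> [cf f1 f2]; split => s; last first.
  by rewrite -(f1 (latpt s t)) /latpt rmorphD rmorph1 mulrDl mul1r addrAC.
apply: (@cont2_comp R f _ (fun s => latpt s t) _ cf).
- have -> : (fun s => Re (latpt s t)) = (fun s => s * Re w1 + t * Re w2).
    by apply/funext => q; rewrite /latpt !ReImE /= !mul0r !subr0.
  by apply: cvgD; last exact: cvg_cst; apply: cvgM; [exact: cvg_id|exact: cvg_cst].
- have -> : (fun s => Im (latpt s t)) = (fun s => s * Im w1 + t * Im w2).
    by apply/funext => q; rewrite /latpt !ReImE /= !mul0r !addr0.
  by apply: cvgD; last exact: cvg_cst; apply: cvgM; [exact: cvg_id|exact: cvg_cst].
Qed.

Lemma CP_col f : CP f -> continuous (fun t => int01 (fun s => f (latpt s t))) /\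
  (forall t, int01 (fun s => f (latpt s (t + 1))) = int01 (fun s => f (latpt s t))).
Proof.
move=> cpf; split => t; last first.
  congr int01; apply/funext => s; have [_ _ p2] := cpf.
  by rewrite -(p2 (latpt s t)) /latpt rmorphD rmorph1 mulrDl mul1r addrA.
have cvg_lin0 (c : R) : (fun t' => (t' - t) * c) @ t --> (0 : R).
  rewrite -[X in _ --> X](mul0r c) -[X in _ --> X * c](subrr t).
  by apply: cvgM; [apply: cvgB; [exact: cvg_id|exact: cvg_cst]|exact: cvg_cst].
apply/cvgrPdist_le => /= e e0; have [d d0 dP] := CP_unif cpf e0.
have : (fun t' => (t' - t) * Re w2) @ t --> (0 : R) by exact: cvg_lin0.
move/cvgr0_norm_lt => /(_ _ d0) near1.
have : (fun t' => (t' - t) * Im w2) @ t --> (0 : R) by exact: cvg_lin0.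
move/cvgr0_norm_lt => /(_ _ d0) near2.
near=> t'.
have lcE s : latpt s t' = latpt s t + (t' - t)%:C%C * w2.
  by rewrite /latpt -addrA -mulrDl -rmorphD /= [t + _]addrC subrK.
have bnd s : `|f (latpt s t') - f (latpt s t)| < e.
  rewrite lcE; apply: dP; rewrite !ReImE /= mul0r ?subr0 ?addr0; by near: t'.
have [c1 _] := CP_row t cpf; have [c2 _] := CP_row t' cpf.
rewrite ler_norml; apply/andP; split.
- rewrite lerBrDr addrC lerBlDr -[X in _ + X](int01_cst e) -int01D //; last by move=> ?; exact: cvg_cst.
  apply: le_int01 => // [s|s]; first by apply: cvgD; [exact: c1|exact: cvg_cst].
  by have := bnd s; rewrite ltr_norml; lra.
- rewrite lerBlDl -[X in _ + X](int01_cst e) -int01D //; last by move=> ?; exact: cvg_cst.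
  apply: le_int01 => // [s|s]; first by apply: cvgD; [exact: c2|exact: cvg_cst].
  by have := bnd s; rewrite ltr_norml; lra.
Unshelve. all: by end_near. Qed.

Lemma meanD f G : CP f -> CP G -> mean (fun z => f z + G z) = mean f + mean G.
Proof.
move=> cf cG; rewrite /mean -int01D; try exact: (CP_col _).1.
congr int01; apply/funext => t.
by rewrite int01D //; exact: (CP_row _ _).1.
Qed.

Lemma meanZ f (c : R) : CP f -> mean (fun z => c * f z) = c * mean f.
Proof.
move=> cf; rewrite /mean -int01Z; last exact: (CP_col _).1.
congr int01; apply/funext => t.
by rewrite int01Z //; exact: (CP_row _ _).1.
Qed.

Lemma meanN f : CP f -> mean (fun z => - f z) = - mean f.
Proof.
move=> cf; rewrite (_ : (fun z => - f z) = (fun z => -1 * f z)).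
  by rewrite meanZ // mulN1r.
by apply/funext => z; rewrite mulN1r.
Qed.

Lemma meanB f G : CP f -> CP G -> mean (fun z => f z - G z) = mean f - mean G.
Proof. by move=> cf cG; rewrite meanD ?meanN //; exact: CPN. Qed.

Lemma mean_cst (c : R) : mean (fun=> c) = c.
Proof. by rewrite /mean !int01_cst. Qed.

Lemma le_mean f G : CP f -> CP G -> (forall z, f z <= G z) -> mean f <= mean G.
Proof.
move=> cf cG fG; apply: le_int01 => [||t]; try exact: (CP_col _).1.
by apply: le_int01 => //; exact: (CP_row _ _).1.
Qed.

Lemma norm_mean_le f (B : R) : CP f -> (forall z, `|f z| <= B) -> `|mean f| <= B.
Proof.
move=> cf fB; rewrite ler_norml -[X in - X](mean_cst B) -meanN; last exact: CP_cst.
rewrite -[X in _ && (_ <= X)](mean_cst B); apply/andP; split.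
  apply: le_mean => //; first exact: CP_cst.
  by move=> z; have := fB z; rewrite ler_norml => /andP[].
apply: le_mean => //; first exact: CP_cst.
by move=> z; have := fB z; rewrite ler_norml => /andP[].
Qed.

Lemma mean_shift f h : CP f -> mean (fun z => f (z + h)) = mean f.
Proof.
move=> cf; have [cc pc] := CP_col cf.
rewrite /mean -[RHS](@int01_shift R _ (crd2 h) cc pc).
congr int01; apply/funext => t.
have [c p] := CP_row (t + crd2 h) cf.
rewrite -(@int01_shift R _ (crd1 h) c p).
by congr int01; apply/funext => s; rewrite -{1}[h]latptK -latptD.
Qed.

Lemma mean_eq0 f : CP f -> (forall z, 0 <= f z) -> mean f = 0 -> forall z, f z = 0.
Proof.
move=> cf f0 mf z; rewrite -[z]latptK.
have [cc pc] := CP_col cf.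
have fc t : 0 <= int01 (fun s => f (latpt s t)) by exact: Rintegral_ge0.
have c0 := int01_eq0 cc pc fc mf (crd2 z).
have [cr pr] := CP_row (crd2 z) cf.
by have := int01_eq0 cr pr _ c0 (crd1 z); apply.
Qed.

End Torus.

(** * Derivatives in a direction *)

Section DirectionalDerivatives.
Variable R : realType.
Local Notation C := R[i].
Implicit Types (z h g : C) (f : C -> R).

Definition is_ddir h f z (d : R) := is_derive (0 : R) 1 (fun t : R => f (z + t%:C%C * h)) d.

Lemma is_ddirE h f z d : is_ddir h f z d -> ddir h f z = d.
Proof. by move=> [_ <-]; rewrite /ddir derive1E. Qed.

Lemma derivable_is_ddir h f z :
  derivable (fun t : R => f (z + t%:C%C * h)) 0 1 -> is_ddir h f z (ddir h f z).
Proof. by move=> df; rewrite /ddir derive1E; exact: derivableP. Qed.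

Lemma is_ddir_eq h f z d d' : is_ddir h f z d -> d = d' -> is_ddir h f z d'.
Proof. by move=> ? <-. Qed.

Lemma is_ddir_line h f df z (t0 : R) : (forall z, is_ddir h f z (df z)) ->
  is_derive t0 1 (fun t : R => f (z + t%:C%C * h)) (df (z + t0%:C%C * h)).
Proof.
move=> dff.
have -> : (fun t : R => f (z + t%:C%C * h)) =
    (fun t : R => f (z + t0%:C%C * h + t%:C%C * h)) \o (fun t => t - t0).
  apply/funext => t /=; rewrite -addrA -mulrDl -rmorphD /=.
  by rewrite [t0 + _]addrC subrK.
have d1 : is_derive t0 1 (fun t : R => t - t0) (1 : R).
  by apply: is_derive_eq; rewrite subr0.
have d2 := dff (z + t0%:C%C * h).
rewrite /is_ddir -[X in is_derive X _ _ _](subrr t0) in d2.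
by have := @is_derive1_comp R _ (fun t => t - t0) t0 _ _ d2 d1; rewrite mulr1.
Qed.

Lemma is_ddir_cst h (c : R) z : is_ddir h (fun=> c) z 0.
Proof. exact: (is_derive_cst c). Qed.

Lemma is_ddirD h f f' z d d' : is_ddir h f z d -> is_ddir h f' z d' ->
  is_ddir h (fun z => f z + f' z) z (d + d').
Proof. exact: is_deriveD. Qed.

Lemma is_ddirN h f z d : is_ddir h f z d -> is_ddir h (fun z => - f z) z (- d).
Proof. exact: is_deriveN. Qed.

Lemma is_ddirB h f f' z d d' : is_ddir h f z d -> is_ddir h f' z d' ->
  is_ddir h (fun z => f z - f' z) z (d - d').
Proof. by move=> df df'; apply: is_ddirD => //; exact: is_ddirN. Qed.

Lemma is_ddirM h f f' z d d' : is_ddir h f z d -> is_ddir h f' z d' ->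
  is_ddir h (fun z => f z * f' z) z (d * f' z + f z * d').
Proof.
move=> df df'; apply: is_derive_eq (is_deriveM df df') _.
by rewrite mul0r addr0 addrC; congr (_ + _); exact: mulrC.
Qed.

Lemma is_ddirZ h f z d (c : R) : is_ddir h f z d -> is_ddir h (fun z => c * f z) z (c * d).
Proof.
by move=> df; apply: is_ddir_eq (is_ddirM (is_ddir_cst h c z) df) _; rewrite mul0r add0r.
Qed.

Lemma is_ddir_fun h (k : R -> R) f z d d' :
  is_derive (f z) 1 k d' -> is_ddir h f z d -> is_ddir h (fun z => k (f z)) z (d' * d).
Proof.
move=> dk df; have e : f (z + 0%:C%C * h) = f z by rewrite rmorph0 mul0r addr0.
rewrite -e in dk; exact: (@is_derive1_comp R k (fun t => f (z + t%:C%C * h)) 0 _ _ dk df).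
Qed.

Lemma is_ddir_dot h g z : is_ddir h (dotC g) z (dotC g h).
Proof.
rewrite /is_ddir; have -> : (fun t : R => dotC g (z + t%:C%C * h)) = (fun t => dotC g z + t * dotC g h).
  by apply/funext => t; rewrite dotCDr dotCZr.
have d1 : is_derive (0 : R) 1 (fun t : R => t * dotC g h) (dotC g h).
  have -> : (fun t : R => t * dotC g h) = dotC g h \*: (@id R).
    by apply/funext => t; rewrite /= mulrC.
  by apply: is_derive_eq (is_deriveZ _ (is_derive_id _ _)) _; exact: mulr1.
by apply: is_derive_eq (is_deriveD (is_derive_cst _ _ _) d1) _; rewrite add0r.
Qed.

Lemma is_ddir_wave h g c z :
  is_ddir h (wave g c) z (2 * pi * dotC g h * wave g (c + pi / 2) z).
Proof.
have d1 : is_ddir h (fun z => 2 * pi * dotC g z + c) z (2 * pi * dotC g h).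
  rewrite -[X in is_ddir _ _ _ X]addr0; apply: is_ddirD (is_ddir_cst _ _ _).
  by apply: is_ddirZ; exact: is_ddir_dot.
apply: is_ddir_eq (is_ddir_fun (is_derive_cos _) d1) _.
by rewrite /wave addrA cosDpihalf mulrC.
Qed.

End DirectionalDerivatives.

(** * Uniqueness of Fourier coefficients on a torus *)

Section Fourier.
Variable R : realType.
Local Notation C := R[i].
Variables w1 w2 : C.
Hypothesis area0 : area w1 w2 != 0.
Implicit Types (z h g : C) (f G : C -> R).
Local Notation CP := (CP w1 w2).
Local Notation mean := (mean w1 w2).
Local Notation lc := (latpt w1 w2).
Local Notation lc1 := (crd1 w1 w2).
Local Notation lc2 := (crd2 w1 w2).

(** Translations preserve the mean, and difference quotients converge uniformly. *)
Lemma mean_ddir h f df : CP f -> CP df -> (forall z, is_ddir h f z (df z)) -> mean df = 0.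
Proof.
move=> cf cdf dff; apply/eqP; rewrite -normr_le0; apply/ler_addgt0Pl => e e0; rewrite addr0.
have [d d0 dP] := CP_unif area0 cdf e0.
pose t : R := d / (1 + `|Re h| + `|Im h|).
have D0 : 0 < 1 + `|Re h| + `|Im h| by have := normr_ge0 (Re h); have := normr_ge0 (Im h); lra.
have t0 : 0 < t by exact: divr_gt0.
have small (c x : R) : 0 <= c <= t -> `|x| <= `|Re h| + `|Im h| -> `|c * x| < d.
  move=> /andP[c0 ct] xh; rewrite normrM (ger0_norm c0).
  apply: (@le_lt_trans _ _ (t * `|x|)); first exact: ler_wpM2r.
  by rewrite /t mulrAC ltr_pdivrMr // ltr_pM2l //; lra.
have bnd z : `|f (z + t%:C%C * h) - f z - t * df z| <= t * e.
  have [||c] := @MVT_segment R (fun s : R => f (z + s%:C%C * h)) (fun s => df (z + s%:C%C * h)) 0 t (ltW t0).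
  - by move=> s _; exact: is_ddir_line.
  - by apply: continuous_subspaceT => s; exact: is_derive_continuous (is_ddir_line _ _ dff).
  rewrite in_itv /= mul0r addr0 subr0 => c0t ->.
  rewrite mulrC -mulrBr normrM (gtr0_norm t0) ler_pM2l //; apply: ltW; apply: dP.
    by rewrite ReM /= mul0r subr0; apply: small => //; have := normr_ge0 (Im h); lra.
  by rewrite ImM /= mul0r addr0; apply: small => //; have := normr_ge0 (Re h); lra.
have cs := CP_shift (t%:C%C * h) cf.
have := norm_mean_le area0 (CPB (CPB cs cf) (CPZ t cdf)) bnd.
rewrite meanB //; [|exact: CPB|exact: CPZ].
rewrite meanB // mean_shift // subrr sub0r normrN meanZ // normrM (gtr0_norm t0).
by rewrite ler_pM2l.
Qed.

(** The dual lattice of the lattice spanned by w1 and w2. *)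
Definition dual12 g := (exists m : int, dotC g w1 = m%:~R) /\ (exists n : int, dotC g w2 = n%:~R).

Lemma dual12D g h : dual12 g -> dual12 h -> dual12 (g + h).
Proof.
move=> [[m mE] [n nE]] [[m' mE'] [n' nE']].
by split; [exists (m + m')|exists (n + n')]; rewrite dotCDl rmorphD /= ?mE ?nE ?mE' ?nE'.
Qed.
Lemma dual12N g : dual12 g -> dual12 (- g).
Proof.
by move=> [[m mE] [n nE]]; split; [exists (- m)|exists (- n)]; rewrite dotCNl rmorphN /= ?mE ?nE.
Qed.
Lemma dual120 : dual12 0.
Proof. by split; exists 0; rewrite dotC0l. Qed.

Lemma CP_wave g c : dual12 g -> CP (wave g c).
Proof.
move=> [[m mE] [n nE]]; split => [|z|z]; first exact: cont2_wave.
  by rewrite /wave dotCDr mulrDr mE addrAC cos_periodz.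
by rewrite /wave dotCDr mulrDr nE addrAC cos_periodz.
Qed.

Lemma dotC_gt0 g : g != 0 -> 0 < dotC g g.
Proof.
case: g => a b; rewrite /dotC /= => ab.
rewrite lt_neqAle addr_ge0 ?sqr_ge0 // andbT eq_sym.
apply: contra ab; rewrite paddr_eq0 ?sqr_ge0 // !mulf_eq0 !orbb.
by move=> /andP[/eqP -> /eqP ->].
Qed.

(** For g != 0 the wave is up to a factor a derivative in the direction g. *)
Lemma mean_wave g c : dual12 g -> g != 0 -> mean (wave g c) = 0.
Proof.
move=> dg g0; have := @mean_ddir g _ _ (CP_wave (c - pi / 2) dg)
  (CPZ (2 * pi * dotC g g) (CP_wave c dg)).
rewrite meanZ //; last exact: CP_wave.
have h : forall z, is_ddir g (wave g (c - pi / 2)) z (2 * pi * dotC g g * wave g c z).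
  by move=> z; apply: is_ddir_eq (is_ddir_wave _ _ _ _) _; rewrite subrK.
move=> /(_ h) /eqP; rewrite mulf_eq0 => /orP[|/eqP //].
by rewrite !mulf_eq0 pnatr_eq0 /= (gt_eqF (pi_gt0 R)) (gt_eqF (dotC_gt0 g0)).
Qed.

(** Testing against all phases c covers the sine as well as the cosine coefficients. *)
Definition zero_coefs G := forall g c, dual12 g -> mean (fun z => G z * wave g c z) = 0.

Definition bump g c z : R := 2^-1 + 2^-1 * wave g c z.

Lemma CP_bump g c : dual12 g -> CP (bump g c).
Proof.
by move=> dg; apply: CPD; [exact: CP_cst|apply: CPZ; exact: CP_wave].
Qed.

(** A product of waves is a combination of waves of dual frequencies. *)
Lemma zero_coefs_bump G g c : CP G -> dual12 g -> zero_coefs G ->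
  zero_coefs (fun z => G z * bump g c z).
Proof.
move=> cG dg G0 h d dh.
have -> : (fun z => G z * bump g c z * wave h d z) = (fun z => 2^-1 * (G z * wave h d z) +
    (4^-1 * (G z * wave (g + h) (c + d) z) + 4^-1 * (G z * wave (g - h) (c - d) z))).
  apply/funext => z; rewrite /bump -mulrA mulrDl -[2^-1 * _ * _]mulrA waveM.
  by field.
have cw g' c' : dual12 g' -> CP (fun z => G z * wave g' c' z).
  by move=> dg'; apply: CPM => //; exact: CP_wave.
have d1 := dual12D dg dh; have d2 := dual12D dg (dual12N dh).
rewrite meanD //; [|by apply: CPZ; exact: cw|by apply: CPD; apply: CPZ; exact: cw].
rewrite meanD //; try by apply: CPZ; exact: cw.
rewrite !meanZ //; try exact: cw.
by rewrite !G0 // !mulr0 !addr0.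
Qed.

(** The basis of the dual lattice that is dual to w1, w2: lc1 and lc2 are the
    inner products with its members. *)
Definition dual1 : C := ((Im w2 / area w1 w2) +i* (- Re w2 / area w1 w2))%C.
Definition dual2 : C := ((- Im w1 / area w1 w2) +i* (Re w1 / area w1 w2))%C.

Lemma lc1E z : lc1 z = dotC dual1 z.
Proof. by rewrite /crd1 /dotC /=; ring. Qed.
Lemma lc2E z : lc2 z = dotC dual2 z.
Proof. by rewrite /crd2 /dotC /=; ring. Qed.

Lemma dual12_1 : dual12 dual1.
Proof.
have a0 := area0; split; [exists 1|exists 0]; rewrite /dotC /=;
  by move: a0; rewrite /area => a0; field.
Qed.

Lemma dual12_2 : dual12 dual2.
Proof.
have a0 := area0; split; [exists 0|exists 1]; rewrite /dotC /=;
  by move: a0; rewrite /area => a0; field.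
Qed.

(** A trigonometric polynomial with values in [0, 1], equal to 1 exactly on the
    translate by z0 of the lattice. *)
Definition peak z0 z : R :=
  bump dual1 (- (2 * pi * dotC dual1 z0)) z * bump dual2 (- (2 * pi * dotC dual2 z0)) z.

Lemma peakE z0 s t :
  peak z0 (z0 + lc s t) = (2^-1 + 2^-1 * cos (2 * pi * s)) * (2^-1 + 2^-1 * cos (2 * pi * t)).
Proof.
have E1 : dotC dual1 (lc s t) = s.
  by rewrite -lc1E /crd1 /latpt !ReImE /=; have a0 := area0; move: a0;
    rewrite /area => a0; field.
have E2 : dotC dual2 (lc s t) = t.
  by rewrite -lc2E /crd2 /latpt !ReImE /=; have a0 := area0; move: a0;
    rewrite /area => a0; field.
rewrite /peak /bump /wave (dotCDr dual1) (dotCDr dual2) E1 E2.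
by congr ((_ + _ * cos _) * (_ + _ * cos _)); ring.
Qed.

Lemma half_cos_itv (x : R) : 0 <= 2^-1 + 2^-1 * cos x <= 1.
Proof. by have := cos_geN1 x; have := cos_le1 x; lra. Qed.

Lemma turn_itv (x : R) : 0 <= x <= 2^-1 -> 2 * pi * x \in `[0, pi].
Proof.
move=> /andP[x0 x2]; have pi0 := pi_gt0 R.
rewrite in_itv /= !mulr_ge0 ?(ltW pi0) //= -[leRHS](_ : 2 * pi * 2^-1 = pi); last by field.
by rewrite ler_pM2l // mulr_gt0.
Qed.

Lemma half_cos_near (eta s : R) : 0 < eta <= 2^-1 ->
  (1 + cos (2 * pi * eta)) / 2 < 2^-1 + 2^-1 * cos (2 * pi * s) ->
  exists n : int, `|s - n%:~R| < eta.
Proof.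
move=> /andP[eta0 eta2] cs; exists (Num.floor (s + 2^-1)).
set s' := s - _.
have pi0 := pi_gt0 R.
have s'2 : - 2^-1 <= s' <= 2^-1.
  by have := real_floor_itv (num_real (s + 2^-1)); rewrite intrD /s'; lra.
have ccs : cos (2 * pi * eta) < cos (2 * pi * `|s'|).
  have -> : cos (2 * pi * `|s'|) = cos (2 * pi * s).
    rewrite -[RHS](cos_periodz _ (- Num.floor (s + 2^-1))) rmorphN /=.
    have -> : 2 * pi * s + 2 * pi * - (Num.floor (s + 2^-1))%:~R = 2 * pi * s' by rewrite /s'; ring.
    have -> : 2 * pi * `|s'| = `|2 * pi * s'| by rewrite normrM (gtr0_norm (_ : 0 < 2 * pi)) // mulr_gt0.
    exact: cos_norm.
  by lra.
have s'1 : 0 <= `|s'| <= 2^-1 by rewrite normr_ge0 ler_norml.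
have e1 : 0 <= eta <= 2^-1 by rewrite ltW.
by move: ccs; rewrite ltr_cos ?turn_itv // ltr_pM2l // mulr_gt0.
Qed.

(** The powers of the peak at z0 concentrate there, while all the means
    mean (G * peak ^ N) vanish; so G cannot be positive at z0. *)
Lemma zero_coefs_le0 G z0 : CP G -> zero_coefs G -> G z0 <= 0.
Proof.
move=> cG G0; rewrite leNgt; apply/negP => Gz0.
pose c := G z0 / 2; have c0 : 0 < c by rewrite divr_gt0.
have [d d0 dP] := CP_unif area0 cG c0.
pose W := 1 + `|Re w1| + `|Re w2| + `|Im w1| + `|Im w2|.
have [a1 a2 a3 a4] : [/\ 0 <= `|Re w1|, 0 <= `|Re w2|, 0 <= `|Im w1| & 0 <= `|Im w2|] by [].
have W1 : 1 <= W by rewrite /W; lra.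
have W0 : 0 < W by lra.
pose eta := Num.min 4^-1 (d / W).
have eta0 : 0 < eta by rewrite lt_min invr_gt0 ltr0n divr_gt0.
have eta4 : eta <= 4^-1 by rewrite ge_min lexx.
have etad : eta * W <= d by rewrite -ler_pdivlMr // ge_min lexx orbT.
pose r := (1 + cos (2 * pi * eta)) / 2.
have pi0 := pi_gt0 R.
have r1 : r < 1.
  suff : cos (2 * pi * eta) < 1 by rewrite /r; lra.
  have h0 : 0 <= (0 : R) <= 2^-1 by rewrite lexx invr_ge0 ler0n.
  have he : 0 <= eta <= 2^-1 by rewrite ltW //=; lra.
  have := ltr_cos (turn_itv h0) (turn_itv he).
  by rewrite mulr0 cos0 => ->; rewrite mulr_gt0 ?mulr_gt0.
have r2 : 2^-1 <= r.
  suff : 0 <= cos (2 * pi * eta) by rewrite /r; lra.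
  apply: cos_ge0_pihalf; apply/andP; split; last by nra.
  by apply: (@le_trans _ _ 0); [rewrite oppr_le0 divr_ge0 // ltW|rewrite !mulr_ge0 // ltW].
pose r' := (r + 1) / 2.
have peak01 z : 0 <= peak z0 z <= 1.
  have -> : z = z0 + lc (lc1 (z - z0)) (lc2 (z - z0)) by rewrite latptK // addrC subrK.
  rewrite peakE; have := half_cos_itv (2 * pi * lc1 (z - z0)).
  have := half_cos_itv (2 * pi * lc2 (z - z0)).
  by move: (_ + _) (_ + _) => x y /andP[x0 x1] /andP[y0 y1]; rewrite mulr_ge0 //= mulr_ile1.
have near z : r < peak z0 z -> c < G z.
  have -> : z = z0 + lc (lc1 (z - z0)) (lc2 (z - z0)) by rewrite latptK // addrC subrK.
  move: (lc1 _) (lc2 _) => s t; rewrite peakE => rp.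
  have hs := half_cos_itv (2 * pi * s); have ht := half_cos_itv (2 * pi * t).
  have eta2 : 0 < eta <= 2^-1 by rewrite eta0 /=; lra.
  have [m ms] : exists m : int, `|s - m%:~R| < eta by apply: half_cos_near => //; rewrite -/r; nra.
  have [n nt] : exists n : int, `|t - n%:~R| < eta by apply: half_cos_near => //; rewrite -/r; nra.
  have -> : lc s t = lc (s - m%:~R) (t - n%:~R) + lc m%:~R n%:~R by rewrite -latptD !subrK.
  rewrite addrA CP_int //.
  have small (x y : R) : `|x| + `|y| < W -> `|(s - m%:~R) * x + (t - n%:~R) * y| < d.
    move=> xy; apply: le_lt_trans (ler_normD _ _) _; rewrite !normrM.
    apply: lt_le_trans etad; apply: (@le_lt_trans _ _ (eta * `|x| + eta * `|y|)).
      by apply: lerD; apply: ler_wpM2r => //; apply: ltW.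
    by rewrite -mulrDr ltr_pM2l.
  have := dP z0 (lc (s - m%:~R) (t - n%:~R)); rewrite /latpt !ReImE /= !mul0r !subr0 !addr0.
  have sR := small (Re w1) (Re w2); have sI := small (Im w1) (Im w2).
  rewrite sR ?sI; [|by rewrite /W; lra..] => /(_ isT isT).
  by rewrite ltr_norml /c => /andP[h _]; lra.
have [B GB] := CP_bounded area0 cG.
have cpk : CP (peak z0).
  by apply: CPM; apply: CP_bump; [exact: dual12_1|exact: dual12_2].
(* G times a power of the peak still has vanishing coefficients *)
have zN N : CP (fun z => G z * peak z0 z ^+ N) /\ zero_coefs (fun z => G z * peak z0 z ^+ N).
  elim: N => [|N [cN IH]].
    by rewrite (_ : (fun z => _) = G) //; apply/funext => z; rewrite expr0 mulr1.
  have -> : (fun z => G z * peak z0 z ^+ N.+1) = (fun z => G z * peak z0 z ^+ N *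
      bump dual1 (- (2 * pi * dotC dual1 z0)) z * bump dual2 (- (2 * pi * dotC dual2 z0)) z).
    by apply/funext => z; rewrite exprSr /peak !mulrA.
  have cb1 := CP_bump (- (2 * pi * dotC dual1 z0)) dual12_1.
  have cb2 := CP_bump (- (2 * pi * dotC dual2 z0)) dual12_2.
  split; first by apply: CPM => //; exact: CPM.
  apply: zero_coefs_bump; [exact: CPM|exact: dual12_2|].
  by apply: zero_coefs_bump => //; exact: dual12_1.
have mN N : mean (fun z => G z * peak z0 z ^+ N) = 0.
  have [cN /(_ 0 0 dual120)] := zN N.
  by under [X in mean X]funext => z do rewrite /wave dotC0l mulr0 addr0 cos0 mulr1.
(* where peak > r one has G > c; phi is supported in the smaller set where peak > r' *)
pose phi z := Num.max 0 (peak z0 z - r').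
have cphi : CP phi.
  have -> : phi = (fun z => 2^-1 * ((peak z0 z - r') + `|peak z0 z - r'|)).
    apply/funext => z; rewrite /phi; have [h|h] := leP 0 (peak z0 z - r').
      by rewrite ger0_norm //; field.
    by rewrite ltr0_norm // subrr mulr0.
  have cB : CP (fun z => peak z0 z - r') by apply: CPB => //; exact: CP_cst.
  apply: CPZ; apply: CPD => //; have [b1 b2 b3] := cB.
  split => [|z|z]; [|by rewrite b2|by rewrite b3].
  by apply: (@cont2_fun R Num.norm) => //; exact: norm_continuous.
have phi0 z : 0 <= phi z by rewrite /phi le_max lexx.
have mphi : 0 < mean phi.
  rewrite lt_neqAle; apply/andP; split; last first.
    by rewrite -[X in X <= _](mean_cst w1 w2 0); apply: le_mean => //; exact: CP_cst.
  apply/eqP => /esym /(mean_eq0 area0 cphi phi0) /(_ z0).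
  rewrite /phi -[X in peak _ X](addr0 z0) -[X in peak _ (_ + X)](_ : lc 0 0 = 0); last first.
    by rewrite /latpt rmorph0 !mul0r addr0.
  rewrite peakE !mulr0 cos0 => /eqP; rewrite eq_maxl // ; rewrite /r'; lra.
have r'0 : 0 < r' by rewrite /r'; lra.
(* the gain c r'^N on the support of phi beats the loss |B| r^N away from z0 *)
have ineq N z : c * r' ^+ N * phi z - `|B| * r ^+ N <= G z * peak z0 z ^+ N.
  have /andP[p0 p1] := peak01 z.
  have rN0 : 0 <= `|B| * r ^+ N by rewrite mulr_ge0 // exprn_ge0 //; lra.
  have [pr'|pr'] := leP r' (peak z0 z).
    have Gc : c < G z by apply: near; rewrite /r' in pr' *; lra.
    have phi1 : phi z <= 1 by rewrite /phi ge_max ler01 /=; lra.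
    rewrite lerBlDr; apply: ler_wpDr => //.
    apply: (@le_trans _ _ (c * r' ^+ N)).
      by rewrite ler_piMr // mulr_ge0 ?exprn_ge0 // ltW.
    by apply: ler_pM; rewrite ?exprn_ge0 ?(ltW c0) ?(ltW Gc) ?(ltW r'0) // lerXn2r // nnegrE ltW.
  have -> : phi z = 0 by rewrite /phi; apply/max_idPl; lra.
  rewrite mulr0 sub0r; have [pr|pr] := ltP r (peak z0 z).
    apply: (@le_trans _ _ 0); first by rewrite oppr_le0.
    by rewrite mulr_ge0 ?exprn_ge0 // ltW // (lt_trans c0) // near.
  rewrite lerNl -mulNr; apply: (@le_trans _ _ (`|B| * peak z0 z ^+ N)).
    apply: ler_wpM2r; first exact: exprn_ge0.
    have := GB z; rewrite ler_norml => /andP[h _]; have := ler_norm B; lra.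
  by apply: ler_wpM2l => //; rewrite lerXn2r // nnegrE; lra.
have main N : c * mean phi * r' ^+ N <= `|B| * r ^+ N.
  have cl : CP (fun z => c * r' ^+ N * phi z) by exact: CPZ.
  have := @le_mean _ _ _ area0 _ _ (CPB cl (CP_cst _ _ (`|B| * r ^+ N))) (zN N).1 (ineq N).
  by rewrite mN meanB //; [rewrite meanZ // mean_cst; lra|exact: CP_cst].
pose x := r / r'.
have x1 : `|x| < 1.
  have r0 : 0 <= r by lra.
  rewrite ger0_norm; last by rewrite divr_ge0 // ltW.
  by rewrite ltr_pdivrMr // mul1r /r'; lra.
have e0 : 0 < c * mean phi / (`|B| + 1) by rewrite !divr_gt0 ?mulr_gt0 // ltr_wpDl.
have /cvgr0_norm_lt /(_ _ e0) [N _ /(_ N (leqnn N)) /=] := cvg_expr x1.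
rewrite normrX ger0_norm; last by rewrite divr_ge0 //; lra.
rewrite ltr_pdivlMr; last by rewrite ltr_wpDl.
rewrite /x expr_div_n mulrAC ltr_pdivrMr ?exprn_gt0 // => lt1.
have := main N; apply/negP; rewrite -ltNge; apply: le_lt_trans lt1.
by rewrite mulrC ler_wpM2l ?exprn_ge0 ?lerDl //; lra.
Qed.

(** The bound above holds at every point, for G and for - G. *)
Theorem fourier_unique G : CP G -> zero_coefs G -> forall z, G z = 0.
Proof.
move=> cG G0 z; apply/eqP; rewrite eq_le zero_coefs_le0 //=.
rewrite -oppr_le0; apply: (@zero_coefs_le0 (fun z => - G z)); first exact: CPN.
move=> g c dg; under [X in mean X]funext => y do rewrite mulNr.
by rewrite meanN ?G0 ?oppr0 //; apply: CPM => //; exact: CP_wave.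
Qed.

End Fourier.

(** * Fourier coefficients of complex functions *)

Section ComplexDerivatives.
Variable R : realType.
Local Notation C := R[i].
Implicit Types (z w h g : C) (f : C -> C).

Lemma cisD (s t : R) : cis (s + t) = cis s * cis t.
Proof. by apply: eqC; rewrite !ReImE /cis /= ?cosD ?sinD; ring. Qed.
Lemma cis0 : cis (0 : R) = 1.
Proof. by rewrite /cis cos0 sin0. Qed.
Lemma cisN (t : R) : cis (- t) = (cis t)^*%C.
Proof. by rewrite /cis cosN sinN. Qed.
Lemma cisK (t : R) : cis (- t) * cis t = 1.
Proof. by rewrite -cisD addNr cis0. Qed.
Lemma cisKV (t : R) : cis t * cis (- t) = 1.
Proof. by rewrite -cisD subrr cis0. Qed.
Lemma cis_neq0 (t : R) : cis t != 0.
Proof. by apply/eqP => c0; have /eqP := cisK t; rewrite c0 mulr0 eq_sym oner_eq0. Qed.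

Lemma conjCM z w : (z * w)^*%C = z^*%C * w^*%C.
Proof. exact: rmorphM. Qed.
Lemma conjCD z w : (z + w)^*%C = z^*%C + w^*%C.
Proof. exact: rmorphD. Qed.

Definition expw g z : C := cis (2 * pi * dotC g z).

Lemma expwD g h z : expw (g + h) z = expw g z * expw h z.
Proof. by rewrite /expw dotCDl mulrDr cisD. Qed.
Lemma expw0 z : expw 0 z = 1.
Proof. by rewrite /expw dotC0l mulr0 cis0. Qed.
Lemma expwN g z : expw (- g) z = (expw g z)^*%C.
Proof. by rewrite /expw dotCNl mulrN cisN. Qed.

Lemma ReexpwE g z : Re (expw g z) = wave g 0 z.
Proof. by rewrite /wave addr0. Qed.
Lemma ImexpwE g z : Im (expw g z) = wave g (- (pi / 2)) z.
Proof. by rewrite /wave cosBpihalf. Qed.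

Definition is_ddirC h f z (d : C) :=
  is_ddir h (fun z => Re (f z)) z (Re d) /\ is_ddir h (fun z => Im (f z)) z (Im d).

Lemma is_ddirCE h f z d : is_ddirC h f z d -> ddirC h f z = d.
Proof. by move=> [/is_ddirE dR /is_ddirE dI]; rewrite /ddirC dR dI -ReE. Qed.

Lemma is_ddirC_eq h f z d d' : is_ddirC h f z d -> d = d' -> is_ddirC h f z d'.
Proof. by move=> ? <-. Qed.

Lemma is_ddirC_cst h (c : C) z : is_ddirC h (fun=> c) z 0.
Proof. by split; exact: is_ddir_cst. Qed.

Lemma is_ddirCD h f f' z d d' : is_ddirC h f z d -> is_ddirC h f' z d' ->
  is_ddirC h (fun z => f z + f' z) z (d + d').
Proof.
move=> [r i] [r' i']; rewrite /is_ddirC ReD ImD.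
rewrite (_ : (fun z => Re (f z + f' z)) = (fun z => Re (f z) + Re (f' z))); last first.
  by apply/funext => y; rewrite ReD.
rewrite (_ : (fun z => Im (f z + f' z)) = (fun z => Im (f z) + Im (f' z))); last first.
  by apply/funext => y; rewrite ImD.
by split; exact: is_ddirD.
Qed.

Lemma is_ddirCM h f f' z d d' : is_ddirC h f z d -> is_ddirC h f' z d' ->
  is_ddirC h (fun z => f z * f' z) z (d * f' z + f z * d').
Proof.
move=> [r i] [r' i']; rewrite /is_ddirC.
rewrite (_ : (fun z => Re (f z * f' z)) =
    (fun z => Re (f z) * Re (f' z) - Im (f z) * Im (f' z))); last first.
  by apply/funext => y; rewrite ReM.
rewrite (_ : (fun z => Im (f z * f' z)) =
    (fun z => Re (f z) * Im (f' z) + Im (f z) * Re (f' z))); last first.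
  by apply/funext => y; rewrite ImM.
split.
  by apply: is_ddir_eq (is_ddirB (is_ddirM r r') (is_ddirM i i')) _; rewrite !ReImE; ring.
by apply: is_ddir_eq (is_ddirD (is_ddirM r i') (is_ddirM i r')) _; rewrite !ReImE; ring.
Qed.

Lemma is_ddirCZ h f z d (c : C) : is_ddirC h f z d -> is_ddirC h (fun z => c * f z) z (c * d).
Proof.
move=> df; apply: is_ddirC_eq (is_ddirCM (is_ddirC_cst h c z) df) _.
by rewrite mul0r add0r.
Qed.

Lemma is_ddirC_sum (I : Type) (s : seq I) h (F : I -> C -> C) z (dF : I -> C) :
  (forall i, is_ddirC h (F i) z (dF i)) ->
  is_ddirC h (fun z => \sum_(i <- s) F i z) z (\sum_(i <- s) dF i).
Proof.
move=> FdF; elim: s => [|i s IH].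
  rewrite big_nil (_ : (fun z => _) = fun=> 0); first exact: is_ddirC_cst.
  by apply/funext => y; rewrite big_nil.
rewrite big_cons (_ : (fun z => _) = fun z => F i z + \sum_(j <- s) F j z).
  exact: is_ddirCD.
by apply/funext => y; rewrite big_cons.
Qed.

Lemma is_ddirC_expw h g z :
  is_ddirC h (expw g) z ((2 * pi * dotC g h)%:C%C * 'i%C * expw g z).
Proof.
have d1 : is_ddir h (fun z => 2 * pi * dotC g z) z (2 * pi * dotC g h).
  by apply: is_ddirZ; exact: is_ddir_dot.
split.
  by apply: is_ddir_eq (is_ddir_fun (is_derive_cos _) d1) _; rewrite !ReImE /=; ring.
by apply: is_ddir_eq (is_ddir_fun (is_derive_sin _) d1) _; rewrite !ReImE /=; ring.
Qed.

End ComplexDerivatives.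

Section ComplexFourier.
Variable R : realType.
Local Notation C := R[i].
Variables w1 w2 : C.
Hypothesis area0 : area w1 w2 != 0.
Implicit Types (z h g : C) (f : C -> C).
Local Notation CP := (CP w1 w2).
Local Notation mean := (mean w1 w2).
Local Notation dual12 := (dual12 w1 w2).

Definition CPC f := CP (fun z => Re (f z)) /\ CP (fun z => Im (f z)).
Definition meanC f : C := (mean (fun z => Re (f z)) +i* mean (fun z => Im (f z)))%C.

Lemma CPC_cst (c : C) : CPC (fun=> c).
Proof. by split; exact: CP_cst. Qed.

Lemma CPCD f f' : CPC f -> CPC f' -> CPC (fun z => f z + f' z).
Proof.
move=> [r i] [r' i']; split.
  by under [X in CP X]funext => z do rewrite ReD; exact: CPD.
by under [X in CP X]funext => z do rewrite ImD; exact: CPD.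
Qed.

Lemma CPCM f f' : CPC f -> CPC f' -> CPC (fun z => f z * f' z).
Proof.
move=> [r i] [r' i']; split.
  by under [X in CP X]funext => z do rewrite ReM; apply: CPB; exact: CPM.
by under [X in CP X]funext => z do rewrite ImM; apply: CPD; exact: CPM.
Qed.

Lemma CPCJ f : CPC f -> CPC (fun z => (f z)^*%C).
Proof.
move=> [r i]; split; first by under [X in CP X]funext => z do rewrite ReJ.
by under [X in CP X]funext => z do rewrite ImJ; exact: CPN.
Qed.

Lemma CPCZ f (c : C) : CPC f -> CPC (fun z => c * f z).
Proof. by move=> cf; apply: CPCM => //; exact: CPC_cst. Qed.

Lemma CPC_expw g : dual12 g -> CPC (expw g).
Proof.
move=> dg; split; first by under [X in CP X]funext => z do rewrite ReexpwE; exact: CP_wave.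
by under [X in CP X]funext => z do rewrite ImexpwE; exact: CP_wave.
Qed.

Lemma CPC_sum (I : eqType) (s : seq I) (F : I -> C -> C) :
  {in s, forall i, CPC (F i)} -> CPC (fun z => \sum_(i <- s) F i z).
Proof.
elim: s => [|i s IH] cF.
  by rewrite (_ : (fun z => _) = fun=> 0); [exact: CPC_cst|apply/funext => y; rewrite big_nil].
rewrite (_ : (fun z => _) = fun z => F i z + \sum_(j <- s) F j z).
  apply: CPCD; first by apply: cF; rewrite mem_head.
  by apply: IH => j js; apply: cF; rewrite inE js orbT.
by apply/funext => y; rewrite big_cons.
Qed.

Lemma meanCD f f' : CPC f -> CPC f' -> meanC (fun z => f z + f' z) = meanC f + meanC f'.
Proof.
move=> [r i] [r' i']; apply: eqC.
  rewrite ReD [RHS]/= -(meanD area0 r r'); congr mean.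
  by apply/funext => z; rewrite ReD.
rewrite ImD [RHS]/= -(meanD area0 i i'); congr mean.
by apply/funext => z; rewrite ImD.
Qed.

Lemma meanCZ f (c : C) : CPC f -> meanC (fun z => c * f z) = c * meanC f.
Proof.
move=> [r i]; apply: eqC.
  rewrite ReM [RHS]/= -(meanZ area0 (Re c) r) -(meanZ area0 (Im c) i).
  rewrite -(meanB area0 (CPZ (Re c) r) (CPZ (Im c) i)).
  by congr mean; apply/funext => z; rewrite ReM.
rewrite ImM [RHS]/= -(meanZ area0 (Re c) i) -(meanZ area0 (Im c) r).
rewrite -(meanD area0 (CPZ (Re c) i) (CPZ (Im c) r)).
by congr mean; apply/funext => z; rewrite ImM.
Qed.

Lemma meanCJ f : CPC f -> meanC (fun z => (f z)^*%C) = (meanC f)^*%C.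
Proof.
move=> [r i]; apply: eqC.
  by rewrite ReJ /=; congr mean; apply/funext => z; rewrite ReJ.
rewrite ImJ [RHS]/= -(meanN area0 i); congr mean.
by apply/funext => z; rewrite ImJ.
Qed.

Lemma meanC_cst (c : C) : meanC (fun=> c) = c.
Proof. by rewrite /meanC !mean_cst -ReE. Qed.

Lemma meanC_expw g : dual12 g -> meanC (expw g) = (g == 0)%:R.
Proof.
move=> dg; case: eqVneq => [->|g0].
  under [X in meanC X]funext => z do rewrite expw0.
  exact: meanC_cst.
rewrite /meanC; under [X in mean X]funext => z do rewrite ReexpwE.
under [X in (_ +i* mean X)%C]funext => z do rewrite ImexpwE.
by rewrite !mean_wave.
Qed.

Lemma meanC_ddir h f df : CPC f -> CPC df -> (forall z, is_ddirC h f z (df z)) ->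
  meanC df = 0.
Proof.
move=> [r i] [dr di] fdf; rewrite /meanC (@mean_ddir _ _ _ area0 h _ _ r dr) => [|z].
  by rewrite (@mean_ddir _ _ _ area0 h _ _ i di) => [//|z]; have [] := fdf z.
by have [] := fdf z.
Qed.

Definition coef f g : C := meanC (fun z => f z * expw (- g) z).

Lemma CPC_coef f g : CPC f -> dual12 g -> CPC (fun z => f z * expw (- g) z).
Proof. by move=> cf dg; apply: CPCM => //; apply: CPC_expw; exact: dual12N. Qed.

Lemma coefD f f' g : CPC f -> CPC f' -> dual12 g ->
  coef (fun z => f z + f' z) g = coef f g + coef f' g.
Proof.
move=> cf cf' dg; rewrite /coef -meanCD; try exact: CPC_coef.
by congr meanC; apply/funext => z; rewrite mulrDl.
Qed.

Lemma coefZ f (c : C) g : CPC f -> dual12 g -> coef (fun z => c * f z) g = c * coef f g.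
Proof.
move=> cf dg; rewrite /coef -meanCZ; last exact: CPC_coef.
by congr meanC; apply/funext => z; rewrite mulrA.
Qed.

Lemma coef_expw g g' : dual12 g -> dual12 g' -> coef (expw g) g' = (g == g')%:R.
Proof.
move=> dg dg'; rewrite /coef; under [X in meanC X]funext => z do rewrite -expwD.
by rewrite meanC_expw ?subr_eq0 //; apply: dual12D => //; exact: dual12N.
Qed.

Lemma coef_cst (c : C) g : dual12 g -> coef (fun=> c) g = c * (g == 0)%:R.
Proof.
move=> dg; have -> : (fun=> c) = (fun z => c * expw 0 z).
  by apply/funext => z; rewrite expw0 mulr1.
rewrite coefZ //; last by apply: CPC_expw; exact: dual120.
by rewrite coef_expw // ?[0 == _]eq_sym //; exact: dual120.
Qed.

Lemma coef_sum (I : eqType) (s : seq I) (F : I -> C -> C) g :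
  {in s, forall i, CPC (F i)} -> dual12 g ->
  coef (fun z => \sum_(i <- s) F i z) g = \sum_(i <- s) coef (F i) g.
Proof.
move=> + dg; elim: s => [|i s IH] cF.
  rewrite (_ : (fun z => _) = fun=> 0); last by apply/funext => y; rewrite big_nil.
  by rewrite big_nil coef_cst // mul0r.
rewrite (_ : (fun z => _) = fun z => F i z + \sum_(j <- s) F j z); last first.
  by apply/funext => y; rewrite big_cons.
have ci : CPC (F i) by apply: cF; rewrite mem_head.
have cs : {in s, forall j, CPC (F j)} by move=> j js; apply: cF; rewrite inE js orbT.
by rewrite (coefD ci (CPC_sum cs) dg) IH // big_cons.
Qed.

(** Multiplying the conjugate by a character reflects the frequencies. *)
Lemma coef_expwJ f b g : CPC f -> dual12 b -> dual12 g ->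
  coef (fun z => expw b z * (f z)^*%C) g = (coef f (b - g))^*%C.
Proof.
move=> cf db dg; rewrite /coef -meanCJ; last first.
  by apply: CPC_coef => //; apply: dual12D => //; exact: dual12N.
congr meanC; apply/funext => z.
by rewrite conjCM (expwN (b - g)) conjcK expwD; ring.
Qed.

Lemma coef_ddir h f df g : CPC f -> CPC df -> (forall z, is_ddirC h f z (df z)) ->
  dual12 g -> coef df g = (2 * pi * dotC g h)%:C%C * 'i%C * coef f g.
Proof.
move=> cf cdf fdf dg; have dNg := dual12N dg.
have cN := CPC_expw dNg.
pose c : C := (2 * pi * dotC (- g) h)%:C%C * 'i%C.
have dM z : is_ddirC h (fun z => f z * expw (- g) z) z
    (df z * expw (- g) z + c * (f z * expw (- g) z)).
  apply: is_ddirC_eq (is_ddirCM (fdf z) (is_ddirC_expw h (- g) z)) _.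
  by rewrite /c; ring.
have cM := CPC_coef cf dg; have cdM := CPC_coef cdf dg.
have := meanC_ddir cM (CPCD cdM (CPCZ c cM)) dM.
rewrite meanCD //; last exact: CPCZ.
rewrite meanCZ // -/(coef f g) -/(coef df g) => /eqP.
rewrite addr_eq0 => /eqP ->; rewrite /c dotCNl mulrN rmorphN /=; ring.
Qed.

Lemma fourier_uniqueC f : CPC f -> (forall g, dual12 g -> coef f g = 0) -> forall z, f z = 0.
Proof.
move=> [r i] f0 z.
have key (g : C) : dual12 g ->
   [/\ mean (fun z => Re (f z) * wave g 0 z) = 0,
       mean (fun z => Re (f z) * wave g (- (pi / 2)) z) = 0,
       mean (fun z => Im (f z) * wave g 0 z) = 0 &
       mean (fun z => Im (f z) * wave g (- (pi / 2)) z) = 0].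
  move=> dg; have dNg := dual12N dg.
  have cr d : CP (fun z => Re (f z) * wave g d z) by apply: CPM => //; exact: CP_wave.
  have ci d : CP (fun z => Im (f z) * wave g d z) by apply: CPM => //; exact: CP_wave.
  set A1 := mean _; set A2 := mean _; set A3 := mean _; set A4 := mean _.
  have E1 : coef f (- g) = ((A1 - A4) +i* (A2 + A3))%C.
    rewrite /A1 /A2 /A3 /A4 -(meanB area0 (cr 0) (ci (- (pi / 2)))).
    rewrite -(meanD area0 (cr (- (pi / 2))) (ci 0)).
    rewrite /coef /meanC opprK; congr (mean _ +i* mean _)%C.
      by apply/funext => y; rewrite ReM ReexpwE ImexpwE.
    by apply/funext => y; rewrite ImM ReexpwE ImexpwE.
  have E2 : coef f g = ((A1 + A4) +i* (A3 - A2))%C.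
    rewrite /A1 /A2 /A3 /A4 -(meanD area0 (cr 0) (ci (- (pi / 2)))).
    rewrite -(meanB area0 (ci 0) (cr (- (pi / 2)))).
    rewrite /coef /meanC; congr (mean _ +i* mean _)%C.
      by apply/funext => y; rewrite ReM expwN ReJ ImJ ReexpwE ImexpwE; ring.
    by apply/funext => y; rewrite ImM expwN ReJ ImJ ReexpwE ImexpwE; ring.
  have [] := congr1 Re E1; rewrite f0 //= => e1.
  have [] := congr1 Im E1; rewrite f0 //= => e2.
  have [] := congr1 Re E2; rewrite f0 //= => e3.
  have [] := congr1 Im E2; rewrite f0 //= => e4.
  move: e1 e2 e3 e4; clear; move: A1 A2 A3 A4 => a1 a2 a3 a4 e1 e2 e3 e4.
  by split; lra.
have real (G : C -> R) : CP G -> (forall g, dual12 g -> mean (fun z => G z * wave g 0 z) = 0 /\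
    mean (fun z => G z * wave g (- (pi / 2)) z) = 0) -> forall y, G y = 0.
  move=> cG G0; apply: (fourier_unique area0 cG) => g c dg.
  have [g1 g2] := G0 g dg.
  have -> : (fun z => G z * wave g c z) = (fun z => cos c * (G z * wave g 0 z) -
      sin c * (G z * wave g (- (pi / 2)) z)).
    by apply/funext => y; rewrite /wave addr0 cosBpihalf cosD; ring.
  have cw d : CP (fun z => G z * wave g d z) by apply: CPM => //; exact: CP_wave.
  by rewrite meanB ?meanZ ?g1 ?g2 ?mulr0 ?subrr //; exact: CPZ.
apply: eqC => /=.
  by apply: (real _ r) => g /key[].
by apply: (real _ i) => g /key[].
Qed.

End ComplexFourier.

(** * The complex structure of R^4 *)

Section ComplexStructure.
Variable R : realType.
Local Notation C := R[i].
Implicit Types (x y : 'cV[R]_4) (a b p q h : C) (t : R).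

Lemma forall_ord4 (P : 'I_4 -> Prop) : P 0 -> P 1 -> P 2 -> P 3 -> forall j, P j.
Proof.
move=> P0 P1 P2 P3; case=> [[|[|[|[|//]]]] i].
- by rewrite (_ : Ordinal i = 0) //; exact: val_inj.
- by rewrite (_ : Ordinal i = 1) //; exact: val_inj.
- by rewrite (_ : Ordinal i = 2) //; exact: val_inj.
- by rewrite (_ : Ordinal i = 3) //; exact: val_inj.
Qed.

Lemma sum4 (V : nmodType) (F : 'I_4 -> V) : \sum_(i < 4) F i = F 0 + F 1 + F 2 + F 3.
Proof.
have e1 : lift ord0 ord0 = 1 :> 'I_4 by apply: val_inj.
have e2 : lift ord0 (lift ord0 ord0) = 2 :> 'I_4 by apply: val_inj.
have e3 : lift ord0 (lift ord0 (lift ord0 ord0)) = 3 :> 'I_4 by apply: val_inj.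
have e0 : ord0 = 0 :> 'I_4 by apply: val_inj.
by rewrite !big_ord_recl big_ord0 e1 e2 e3 e0 addr0 !addrA.
Qed.

Lemma col4P (K : Type) (x y : 'cV[K]_4) : x 0 0 = y 0 0 -> x 1 0 = y 1 0 ->
  x 2 0 = y 2 0 -> x 3 0 = y 3 0 -> x = y.
Proof.
move=> e0 e1 e2 e3; apply/colP; exact: forall_ord4.
Qed.

Lemma Li_mulE (K : pzRingType) (x : 'cV[K]_4) :
  [/\ (Li K *m x) 0 0 = - x 1 0, (Li K *m x) 1 0 = x 0 0,
      (Li K *m x) 2 0 = - x 3 0 & (Li K *m x) 3 0 = x 2 0].
Proof.
have E (i : 'I_4) : (Li K *m x) i 0 = Li K i 0 * x 0 0 + Li K i 1 * x 1 0 +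
    Li K i 2 * x 2 0 + Li K i 3 * x 3 0 by rewrite mxE sum4.
by split; rewrite E !mxE /= ?mul0r ?mul1r ?mulN1r ?add0r ?addr0.
Qed.

Lemma Li_sqr (K : pzRingType) : Li K *m Li K = - 1%:M.
Proof.
apply/matrixP => i j; rewrite !mxE !big_ord_recl big_ord0 !mxE.
by case: i => [[|[|[|[|//]]]] ?]; case: j => [[|[|[|[|//]]]] ?] /=;
  rewrite ?(mul0r, mulr0, mul1r, mulr1, mulN1r, mulrN1, add0r, addr0, oppr0, opprK).
Qed.

Lemma expLi_term t (k : nat) :
  k`!%:R^-1 *: (t *: Li R) ^+ k = cos_coeff t k *: 1%:M + sin_coeff t k *: Li R.
Proof.
have Leven m : Li R ^+ m.*2 = (-1) ^+ m *: 1%:M.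
  rewrite -muln2 mulnC exprM expr2 -[_ * _]/(Li R *m Li R) Li_sqr.
  rewrite -[- 1%:M]scaleN1r exprZn; congr (_ *: _).
  by rewrite -[1%:M]/(1 : 'M[R]_4) expr1n.
rewrite exprZn scalerA cos_coeffE sin_coeffE.
have kE := odd_double_half k; case: (boolP (odd k)) kE => ok kE /=.
  have k2 : k.-1./2 = k./2 by rewrite -[in LHS]kE add1n /= doubleK.
  have -> : Li R ^+ k = (-1) ^+ k./2 *: Li R.
    by rewrite -[in LHS]kE add1n exprS Leven -scalerAr mulr1.
  by rewrite k2 !mul0r scale0r add0r mul1r scalerA; congr (_ *: _); ring.
have -> : Li R ^+ k = (-1) ^+ k./2 *: 1%:M by rewrite -[in LHS]kE add0n Leven.
by rewrite !mul0r scale0r addr0 mul1r scalerA; congr (_ *: _); ring.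
Qed.

Lemma expLiE t : expLi t = cos t *: 1%:M + sin t *: Li R.
Proof.
rewrite /expLi; apply: cvg_lim; first exact: norm_hausdorff.
have -> : series (fun k : nat => k`!%:R^-1 *: (t *: Li R) ^+ k) =
    (fun n => series (cos_coeff t) n *: 1%:M + series (sin_coeff t) n *: Li R).
  apply/funext => n; rewrite /series /= !scaler_suml -big_split /=.
  by apply: eq_bigr => k _; exact: expLi_term.
apply: cvgD; apply: cvgZl.
  by rewrite cos.unlock; exact: is_cvg_series_cos_coeff.
by rewrite sin.unlock; exact: is_cvg_series_sin_coeff.
Qed.

(** R^4 with the complex structure Li is C^2; the coordinates cp and cq diagonalise
    the frame eps, Li conj(eps) of the form lform. *)
Definition cp x : C := ((x 0 0 - x 3 0) +i* (x 1 0 + x 2 0))%C.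
Definition cq x : C := ((x 0 0 + x 3 0) +i* (x 1 0 - x 2 0))%C.
Definition ofpq p q : 'cV[R]_4 := \col_j nth 0
  [:: (Re p + Re q) / 2; (Im p + Im q) / 2; (Im p - Im q) / 2; (Re q - Re p) / 2] j.

Lemma cp_ofpq p q : cp (ofpq p q) = p.
Proof. by apply: eqC; rewrite /cp !mxE /=; field. Qed.
Lemma cq_ofpq p q : cq (ofpq p q) = q.
Proof. by apply: eqC; rewrite /cq !mxE /=; field. Qed.

Lemma eq_cpq x y : cp x = cp y -> cq x = cq y -> x = y.
Proof. by move=> [e1 e2] [e3 e4]; apply: col4P; lra. Qed.

Lemma ofpqK x : ofpq (cp x) (cq x) = x.
Proof. by apply: eq_cpq; rewrite ?cp_ofpq ?cq_ofpq. Qed.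

Lemma cpD x y : cp (x + y) = cp x + cp y.
Proof. by apply: eqC; rewrite /cp !ReImE !mxE /=; ring. Qed.
Lemma cqD x y : cq (x + y) = cq x + cq y.
Proof. by apply: eqC; rewrite /cq !ReImE !mxE /=; ring. Qed.
Lemma cpZ (c : R) x : cp (c *: x) = c%:C%C * cp x.
Proof. by apply: eqC; rewrite /cp !ReImE !mxE /=; ring. Qed.
Lemma cqZ (c : R) x : cq (c *: x) = c%:C%C * cq x.
Proof. by apply: eqC; rewrite /cq !ReImE !mxE /=; ring. Qed.

Lemma cp_Li x : cp (Li R *m x) = 'i%C * cp x.
Proof. by have [e0 e1 e2 e3] := Li_mulE x; rewrite /cp e0 e1 e2 e3; apply: eqC; rewrite !ReImE /=; ring. Qed.
Lemma cq_Li x : cq (Li R *m x) = 'i%C * cq x.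
Proof. by have [e0 e1 e2 e3] := Li_mulE x; rewrite /cq e0 e1 e2 e3; apply: eqC; rewrite !ReImE /=; ring. Qed.

Lemma expLi_mulE t x : expLi t *m x = cos t *: x + sin t *: (Li R *m x).
Proof. by rewrite expLiE mulmxDl -!scalemxAl mul1mx. Qed.

Lemma cp_expLi t x : cp (expLi t *m x) = cis t * cp x.
Proof. by rewrite expLi_mulE cpD !cpZ cp_Li; apply: eqC; rewrite !ReImE /=; ring. Qed.
Lemma cq_expLi t x : cq (expLi t *m x) = cis t * cq x.
Proof. by rewrite expLi_mulE cqD !cqZ cq_Li; apply: eqC; rewrite !ReImE /=; ring. Qed.

Lemma toCmx_inj : injective (@toCmx R 4 1).
Proof. by move=> x y /matrixP e; apply/matrixP => i j; have := e i j; rewrite !mxE => -[]. Qed.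

Lemma frameE a b : [/\ frame a b 0 0 = a / 2, frame a b 1 0 = b / 2,
  frame a b 2 0 = - 'i%C * a / 2 & frame a b 3 0 = 'i%C * b / 2].
Proof.
have [f0 f1 f2 f3] := Li_mulE (Defs.conjmx (eps R)).
by rewrite /frame; split; rewrite mxE [X in X + _]mxE [X in _ + X]mxE ?f0 ?f1 ?f2 ?f3 !mxE /=;
  apply: eqC; rewrite !ReImE /=; ring.
Qed.

(** In the coordinates cp, cq, the form e^{t Li} (u dz + conj(u) d conj(z)) is
    e^{it} (a dz + i conj(b) d conj(z), conj(a) d conj(z) + i b dz). *)
Lemma lformE t a b h : lform t (frame a b) h =
  toCmx (ofpq (cis t * (a * h + 'i%C * (b * h)^*%C)) (cis t * ((a * h)^*%C + 'i%C * (b * h)))).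
Proof.
set y := ofpq _ _.
have -> : y = expLi t *m ofpq (a * h + 'i%C * (b * h)^*%C) ((a * h)^*%C + 'i%C * (b * h)).
  by apply: eq_cpq; rewrite ?cp_expLi ?cq_expLi ?cp_ofpq ?cq_ofpq.
rewrite /lform /toCmx map_mxM; congr (_ *m _).
have := frameE a b; move: (frame a b) => u [u0 u1 u2 u3].
have two : (2^-1 : C) = (2^-1 : R)%:C%C by rewrite rmorphV ?rmorph_nat // unitfE.
by apply: col4P; rewrite !mxE ?u0 ?u1 ?u2 ?u3 /= two; apply: eqC;
  rewrite !ReImE /=; field.
Qed.

End ComplexStructure.

(** * The Lagrangian angle is affine *)

Section Angle.
Variable R : realType.
Local Notation C := R[i].
Implicit Types (z w h g : C) (f : C -> R).

(** By the mean value theorem on the two sides of a rectangle, along which the partial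
    derivatives are bounded. *)
Lemma class_C1_cont f : class_C 1 f -> cont2 f.
Proof.
move=> [dx dy cx cy] p; apply/cvgrPdist_lt => e e0.
have Dx z : is_ddir 1 f z (ddir 1 f z) by exact: derivable_is_ddir.
have Dy z : is_ddir 'i%C f z (ddir 'i%C f z) by exact: derivable_is_ddir.
pose q (s t : R) := (s +i* t)%C : C.
pose M := `|ddir 1 f (q p.1 p.2)| + `|ddir 'i%C f (q p.1 p.2)| + 1.
have M0 : 0 < M by rewrite ltr_wpDl // addr_ge0.
have near0 (k : C -> R) : cont2 k -> `|k (q p.1 p.2)| < M ->
    exists2 d : R, 0 < d & forall s t, `|p.1 - s| < d -> `|p.2 - t| < d -> `|k (q s t)| < M.
  move=> ck kM; have [[A B] /= [/nbhs_ballP[d1 /= d10 dA] /nbhs_ballP[d2 /= d20 dB]] AB] :=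
    cvgr_norm_lt _ (ck p) _ kM.
  exists (Num.min d1 d2) => [|s t]; first by rewrite lt_min d10.
  rewrite !lt_min => /andP[h1 _] /andP[_ h2].
  by apply: (AB (s, t)); split; [exact: dA|exact: dB].
have [|d1 d10 d1P] := near0 _ cx; first by rewrite /M; have := normr_ge0 (ddir 'i%C f (q p.1 p.2)); lra.
have [|d2 d20 d2P] := near0 _ cy; first by rewrite /M; have := normr_ge0 (ddir 1 f (q p.1 p.2)); lra.
pose d := Num.min (Num.min d1 d2) (e / (2 * M)).
have d0 : 0 < d by rewrite !lt_min d10 d20 divr_gt0 // mulr_gt0.
have db : [/\ d <= d1, d <= d2 & d * (2 * M) <= e].
  rewrite -ler_pdivlMr ?mulr_gt0 //.
  by split; rewrite !ge_min lexx ?orbT.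
have [dd1 dd2 dM] := db.
have mvt h z (t : R) : `|t| < d -> (forall z, is_ddir h f z (ddir h f z)) ->
    (forall s : R, `|s| < d -> `|ddir h f (z + s%:C%C * h)| < M) ->
    `|f (z + t%:C%C * h) - f z| <= `|t| * M.
  move=> td Dh hM.
  have main (a b : R) : a <= b -> (forall c, a <= c <= b -> `|c| < d) ->
      `|f (z + b%:C%C * h) - f (z + a%:C%C * h)| <= (b - a) * M.
    move=> ab abd.
    have [||c] := @MVT_segment R (fun s : R => f (z + s%:C%C * h)) (fun s => ddir h f (z + s%:C%C * h)) a b ab.
    - by move=> s _; exact: is_ddir_line.
    - by apply: continuous_subspaceT => s; exact: is_derive_continuous (is_ddir_line _ _ Dh).
    rewrite in_itv /= => cab ->; rewrite normrM mulrC ger0_norm ?subr_ge0 //.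
    by apply: ler_wpM2l; [rewrite subr_ge0|rewrite ltW // hM // abd].
  move: td; rewrite ltr_norml => /andP[td1 td2].
  have [t0|t0] := leP 0 t.
    have := main 0 t t0; rewrite mul0r addr0 subr0 (ger0_norm t0); apply => c c0t.
    by rewrite ltr_norml; lra.
  have := main t 0 (ltW t0); rewrite mul0r addr0 sub0r (ltr0_norm t0) distrC; apply => c c0t.
  by rewrite ltr_norml; lra.
have near1 : \forall r \near p, `|r.1 - p.1| < d /\ `|r.2 - p.2| < d.
  exists (ball p.1 d, ball p.2 d); first by split; exact: nbhsx_ballx.
  by move=> r [r1 r2]; rewrite (distrC r.1) (distrC r.2).
apply: filterS near1 => r [r1 r2].
have e1 : q r.1 r.2 = q p.1 r.2 + (r.1 - p.1)%:C%C * 1.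
  by apply: eqC; rewrite !ReImE /=; ring.
have e2 : q p.1 r.2 = q p.1 p.2 + (r.2 - p.2)%:C%C * 'i%C.
  by apply: eqC; rewrite !ReImE /=; ring.
have b1 : `|f (q r.1 r.2) - f (q p.1 r.2)| <= `|r.1 - p.1| * M.
  rewrite e1; apply: mvt => // s sd.
  rewrite (_ : _ + _ = q (p.1 + s) r.2); last by apply: eqC; rewrite !ReImE /=; ring.
  apply: d1P; first by rewrite opprD addrA subrr sub0r normrN (lt_le_trans sd).
  by rewrite distrC (lt_le_trans r2).
have b2 : `|f (q p.1 r.2) - f (q p.1 p.2)| <= `|r.2 - p.2| * M.
  rewrite e2; apply: mvt => // s sd.
  rewrite (_ : _ + _ = q p.1 (p.2 + s)); last by apply: eqC; rewrite !ReImE /=; ring.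
  apply: d2P; first by rewrite subrr normr0.
  by rewrite opprD addrA subrr sub0r normrN (lt_le_trans sd).
rewrite distrC -/(q r.1 r.2) -/(q p.1 p.2) -(subrKA (f (q p.1 r.2))).
apply: le_lt_trans (ler_normD _ _) _; apply: lt_le_trans dM.
apply: le_lt_trans (lerD b1 b2) _; rewrite -mulrDl mulrA mulr_natr ltr_pM2r //.
by rewrite mulr2n ltrD.
Qed.

Lemma class_C_cont f n : class_C n f -> cont2 f.
Proof.
elim: n f => [//|n IH] f [dx dy cx cy]; apply: class_C1_cont.
by split => //; exact: IH.
Qed.

Lemma class_CD n f f' : class_C n f -> class_C n f' -> class_C n (fun z => f z + f' z).
Proof.
elim: n f f' => [|n IH] f f' /=; first exact: cont2D.
move=> [dx dy cx cy] [dx' dy' cx' cy'].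
have D h z : derivable (fun t : R => f (z + t%:C%C * h)) 0 1 ->
    derivable (fun t : R => f' (z + t%:C%C * h)) 0 1 ->
    is_ddir h (fun z => f z + f' z) z (ddir h f z + ddir h f' z).
  by move=> /derivable_is_ddir d /derivable_is_ddir d'; exact: is_ddirD.
split.
- by move=> z; have [] := D 1 z (dx z) (dx' z).
- by move=> z; have [] := D 'i%C z (dy z) (dy' z).
- rewrite (_ : ddir 1 _ = fun z => ddir 1 f z + ddir 1 f' z); first exact: IH.
  by apply/funext => z; apply: is_ddirE; exact: D.
- rewrite (_ : ddir 'i%C _ = fun z => ddir 'i%C f z + ddir 'i%C f' z); first exact: IH.
  by apply/funext => z; apply: is_ddirE; exact: D.
Qed.

Lemma class_CZ n (a : R) f : class_C n f -> class_C n (fun z => a * f z).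
Proof.
elim: n f => [|n IH] f /=; first by apply: cont2M; exact: cont2_cst.
move=> [dx dy cx cy].
have D h z : derivable (fun t : R => f (z + t%:C%C * h)) 0 1 ->
    is_ddir h (fun z => a * f z) z (a * ddir h f z).
  by move=> /derivable_is_ddir d; exact: is_ddirZ.
split.
- by move=> z; have [] := D 1 z (dx z).
- by move=> z; have [] := D 'i%C z (dy z).
- rewrite (_ : ddir 1 _ = fun z => a * ddir 1 f z); first exact: IH.
  by apply/funext => z; apply: is_ddirE; exact: D.
- rewrite (_ : ddir 'i%C _ = fun z => a * ddir 'i%C f z); first exact: IH.
  by apply/funext => z; apply: is_ddirE; exact: D.
Qed.

Lemma class_C_cst n (c : R) : class_C n (fun=> c).
Proof.
elim: n c => [|n IH] c /=; first exact: cont2_cst.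
have D h z := is_ddir_cst h c z.
have E h : ddir h (fun=> c) = fun=> 0 by apply/funext => z; apply: is_ddirE; exact: D.
by split; [move=> z; have [] := D 1 z|move=> z; have [] := D 'i%C z|rewrite E; exact: IH|rewrite E; exact: IH].
Qed.

Lemma class_C_dot n (c : R) g : class_C n (fun z => c * dotC g z).
Proof.
case: n => [|n]; first by apply: cont2M; [exact: cont2_cst|exact: cont2_dot].
have D h z : is_ddir h (fun z => c * dotC g z) z (c * dotC g h).
  by apply: is_ddirZ; exact: is_ddir_dot.
have E h : ddir h (fun z => c * dotC g z) = fun=> c * dotC g h.
  by apply/funext => z; apply: is_ddirE; exact: D.
by split; [move=> z; have [] := D 1 z|move=> z; have [] := D 'i%C z|rewrite E; exact: class_C_cst|rewrite E; exact: class_C_cst].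
Qed.

Lemma class_C_wave n (a : R) g c : class_C n (fun z => a * wave g c z).
Proof.
elim: n a g c => [|n IH] a g c; first by apply: cont2M; [exact: cont2_cst|exact: cont2_wave].
have D h z : is_ddir h (fun z => a * wave g c z) z
    (a * (2 * pi * dotC g h) * wave g (c + pi / 2) z).
  by rewrite -mulrA; apply: is_ddirZ; exact: is_ddir_wave.
have E h : ddir h (fun z => a * wave g c z) =
    (fun z => a * (2 * pi * dotC g h) * wave g (c + pi / 2) z).
  by apply/funext => z; apply: is_ddirE; exact: D.
by split; [move=> z; have [] := D 1 z|move=> z; have [] := D 'i%C z|rewrite E; exact: IH|rewrite E; exact: IH].
Qed.

Lemma dotC0r g : dotC g 0 = 0.
Proof. by rewrite /dotC /= !mulr0 addr0. Qed.

Lemma harmonic_sub_dot f (c : R) g : harmonic_fun f -> harmonic_fun (fun z => f z + c * dotC g z).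
Proof.
move=> [Cf harm]; split; first exact: (@class_CD 2 _ _ Cf (class_C_dot 2 c g)).
have [dx dy [dxx _ _ _] [_ dyy _ _]] := Cf => z.
have D h y : derivable (fun t : R => f (y + t%:C%C * h)) 0 1 ->
    ddir h (fun z => f z + c * dotC g z) y = ddir h f y + c * dotC g h.
  move=> /derivable_is_ddir d; apply: is_ddirE; apply: is_ddirD => //.
  by apply: is_ddirZ; exact: is_ddir_dot.
have D2 h k y : derivable (fun t : R => ddir k f (y + t%:C%C * h)) 0 1 ->
    ddir h (fun z => ddir k f z + c * dotC g k) y = ddir h (ddir k f) y.
  move=> /derivable_is_ddir d; rewrite -[RHS]addr0; apply: is_ddirE; apply: is_ddirD => //.
  exact: is_ddir_cst.
rewrite (_ : ddir 1 (fun z => f z + c * dotC g z) = fun z => ddir 1 f z + c * dotC g 1); last first.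
  by apply/funext => y; exact: D.
rewrite (_ : ddir 'i%C (fun z => f z + c * dotC g z) =
    fun z => ddir 'i%C f z + c * dotC g 'i%C); last by apply/funext => y; exact: D.
by rewrite !D2.
Qed.

Lemma is_ddir_shift h f z w d : is_ddir h f (z + w) d -> is_ddir h (fun z => f (z + w)) z d.
Proof.
rewrite /is_ddir; suff -> : (fun t : R => f (z + t%:C%C * h + w)) =
  (fun t : R => f (z + w + t%:C%C * h)) by [].
by apply/funext => t; rewrite addrAC.
Qed.

Lemma ddir_shift h f w z : ddir h (fun z => f (z + w)) z = ddir h f (z + w).
Proof.
rewrite /ddir; suff -> : (fun t : R => f (z + t%:C%C * h + w)) =
  (fun t : R => f (z + w + t%:C%C * h)) by [].
by apply/funext => t; rewrite addrAC.
Qed.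

Lemma ddir0_cst f : (forall z, is_ddir 1 f z 0) -> (forall z, is_ddir 'i%C f z 0) ->
  forall z, f z = f 0.
Proof.
move=> d1 di z; have line h y (t : R) : (forall z, is_ddir h f z 0) -> f (y + t%:C%C * h) = f y.
  move=> dh; rewrite -[X in _ = f X](_ : y + 0%:C%C * h = y); last by rewrite rmorph0 mul0r addr0.
  apply: (is_derive_0_is_cst (f := fun t : R => f (y + t%:C%C * h))) => s.
  exact: (is_ddir_line (df := fun=> 0)).
have -> : z = 0 + (Re z)%:C%C * 1 + (Im z)%:C%C * 'i%C.
  by apply: eqC; rewrite !ReImE /=; ring.
by rewrite line // line.
Qed.

Lemma cos_eq1 (x : R) : cos x = 1 -> exists n : int, x = 2 * pi * n%:~R.
Proof.
move=> cx; have pi0 := pi_gt0 R; exists (Num.floor (x / (2 * pi))).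
have /andP[f1 f2] := real_floor_itv (num_real (x / (2 * pi))).
move: f1 f2; rewrite intrD; set n := Num.floor _ => f1 f2.
have pp : 0 < 2 * pi :> R by rewrite mulr_gt0.
rewrite ler_pdivlMr // in f1; rewrite ltr_pdivrMr // in f2.
pose y := x - 2 * pi * n%:~R.
have y0 : 0 <= y by rewrite /y; lra.
have y2 : y < 2 * pi by rewrite /y; lra.
have cy : cos y = 1.
  by rewrite -cx -(cos_periodz x (- n)) rmorphN /= mulrN.
suff : y = 0 by rewrite /y; lra.
apply/eqP; rewrite eq_le y0 andbT leNgt; apply/negP => yp.
have s0 : 0 < sin (y / 2) by apply: sin_gt0_pi; lra.
have y2E : y / 2 *+ 2 = y by rewrite -mulr_natr divfK // pnatr_eq0.
have := cos_mulr2n (y / 2); rewrite y2E cy cos2sin2.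
by move=> h; have : sin (y / 2) ^+ 2 = 0; [lra|apply/eqP; rewrite gt_eqF // exprn_gt0].
Qed.

Variables w1 w2 : C.
Hypothesis area0 : area w1 w2 != 0.
Local Notation CP := (CP w1 w2).
Local Notation mean := (mean w1 w2).
Local Notation dual12 := (dual12 w1 w2).

Lemma mean_parts h f df g c : CP f -> CP df -> (forall z, is_ddir h f z (df z)) -> dual12 g ->
  mean (fun z => df z * wave g c z) =
  - (2 * pi * dotC g h) * mean (fun z => f z * wave g (c + pi / 2) z).
Proof.
move=> cf cdf fdf dg.
have cw d : CP (wave g d) by exact: CP_wave.
pose k := 2 * pi * dotC g h.
have := mean_ddir area0 (CPM cf (cw c))
  (CPD (CPM cdf (cw c)) (CPM cf (CPZ k (cw (c + pi / 2)))))
  (fun z => is_ddirM (fdf z) (is_ddir_wave h g c z)).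
rewrite (meanD area0 (CPM cdf (cw c)) (CPM cf (CPZ k (cw (c + pi / 2))))) => /eqP.
rewrite addr_eq0 => /eqP ->; rewrite mulNr -(meanZ area0 _ (CPM cf (cw _))); congr (- mean _).
by apply/funext => z; rewrite /k; ring.
Qed.

Lemma CP_ddir h f : CP f -> cont2 (ddir h f) -> CP (ddir h f).
Proof.
move=> [cf f1 f2] cd; split => // z.
  by rewrite -ddir_shift (_ : (fun z => f (z + w1)) = f) //; apply/funext.
by rewrite -ddir_shift (_ : (fun z => f (z + w2)) = f) //; apply/funext.
Qed.

(** The Laplacian multiplies the coefficient at g by a nonzero factor, unless g = 0. *)
Lemma harmonic_periodic_cst f : CP f -> harmonic_fun f -> forall z, f z = mean f.
Proof.
move=> cf [[dx dy Cx Cy] harm] z; have [dxx _ cxx _] := Cx; have [_ dyy _ cyy] := Cy.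
have c1 : CP (ddir 1 f) := CP_ddir cf (class_C1_cont Cx).
have ci : CP (ddir 'i%C f) := CP_ddir cf (class_C1_cont Cy).
have c11 : CP (ddir 1 (ddir 1 f)) := CP_ddir c1 cxx.
have cii : CP (ddir 'i%C (ddir 'i%C f)) := CP_ddir ci cyy.
have d1 y : is_ddir 1 f y (ddir 1 f y) by exact: derivable_is_ddir.
have di y : is_ddir 'i%C f y (ddir 'i%C f y) by exact: derivable_is_ddir.
have d11 y : is_ddir 1 (ddir 1 f) y (ddir 1 (ddir 1 f) y) by exact: derivable_is_ddir.
have dii y : is_ddir 'i%C (ddir 'i%C f) y (ddir 'i%C (ddir 'i%C f) y) by exact: derivable_is_ddir.
apply/eqP; rewrite -subr_eq0; apply/eqP.
have cm : CP (fun=> mean f) by exact: CP_cst.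
apply: (fourier_unique area0 (CPB cf cm)) => g c dg.
have cw d : CP (wave g d) by exact: CP_wave.
have -> : (fun z => (f z - mean f) * wave g c z) =
    (fun z => f z * wave g c z - mean f * wave g c z).
  by apply/funext => y; rewrite mulrBl.
rewrite (meanB area0 (CPM cf (cw c)) (CPZ (mean f) (cw c))) (meanZ area0 _ (cw c)).
have [g0|g0] := eqVneq g 0.
  have wE : wave g c = fun=> cos c.
    by apply/funext => y; rewrite /wave g0 dotC0l mulr0 add0r.
  rewrite wE mean_cst; under [X in mean X]funext => y do rewrite mulrC.
  by rewrite (meanZ area0 _ cf); ring.
rewrite (mean_wave area0 c dg g0) mulr0 subr0.
have e1 := mean_parts c c1 c11 d11 dg; rewrite (mean_parts _ cf c1 d1 dg) in e1.
have e2 := mean_parts c ci cii dii dg; rewrite (mean_parts _ cf ci di dg) in e2.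
have sum0 : mean (fun z => ddir 1 (ddir 1 f) z * wave g c z) +
       mean (fun z => ddir 'i%C (ddir 'i%C f) z * wave g c z) = 0.
  rewrite -(meanD area0 (CPM c11 (cw c)) (CPM cii (cw c))) -[RHS](mean_cst w1 w2 0).
  by congr mean; apply/funext => y; rewrite -mulrDl harm mul0r.
have := etrans (esym sum0) (congr2 (fun a b : R => a + b) e1 e2).
have -> : (fun y => f y * wave g (c + pi / 2 + pi / 2) y) = (fun y => -1 * (f y * wave g c y)).
  apply/funext => y; rewrite /wave -addrA -splitr addrA cosDpi; ring.
rewrite (meanZ area0 _ (CPM cf (cw c))); move: g0; clear; move: (mean _) => m g0.
have d1E : dotC g 1 = Re g by rewrite /dotC /=; ring.
have diE : dotC g 'i%C = Im g by rewrite /dotC /=; ring.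
rewrite d1E diE => /esym h.
have : (2 * pi) ^+ 2 * dotC g g * m = 0 by rewrite /dotC; move: h; lra.
have k0 : 0 < (2 * pi) ^+ 2 * dotC g g.
  by rewrite mulr_gt0 ?dotC_gt0 // exprn_gt0 // mulr_gt0 // pi_gt0.
by move/eqP; rewrite mulf_eq0 (gt_eqF k0) => /eqP.
Qed.

(** The increments of beta along the lattice are constant, because their sine
    vanishes identically; subtracting the linear function with these increments
    leaves a periodic harmonic function. *)
Theorem angle_affine (beta : C -> R) : harmonic_fun beta ->
  (forall z, cis (beta (z + w1)) = cis (beta z)) ->
  (forall z, cis (beta (z + w2)) = cis (beta z)) ->
  exists2 b : C, dual12 b & forall z, beta z = beta 0 + 2 * pi * dotC b z.
Proof.
move=> hb p1 p2; have [Cb harm] := hb; have cb := class_C_cont Cb.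
have [dx dy Cx Cy] := Cb; have [dxx _ cxx _] := Cx; have [_ dyy _ cyy] := Cy.
have db h z : h = 1 \/ h = 'i%C -> is_ddir h beta z (ddir h beta z).
  by case=> ->; exact: derivable_is_ddir.
have inc w : (forall z, cis (beta (z + w)) = cis (beta z)) ->
    exists n : int, forall z, beta (z + w) = beta z + 2 * pi * n%:~R.
  move=> pw; have cd z : cis (beta (z + w) - beta z) = 1 by rewrite cisD pw cisKV.
  have cd1 z : cos (beta (z + w) - beta z) = 1 by case: (cd z).
  have sd0 z : sin (beta (z + w) - beta z) = 0 by case: (cd z).
  have dd h z : h = 1 \/ h = 'i%C -> is_ddir h (fun z => beta (z + w) - beta z) z 0.
    move=> h1; have d1 := is_ddirB (is_ddir_shift (db h (z + w) h1)) (db h z h1).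
    apply: is_ddir_eq (d1) _.
    have := is_ddirE (is_ddir_fun (is_derive_sin _) d1); rewrite cd1 mul1r => <-.
    under [X in ddir _ X]funext => y do rewrite sd0.
    exact: is_ddirE (is_ddir_cst _ _ _).
  have [n nE] := cos_eq1 (cd1 0); exists n => z.
  rewrite -nE -(@ddir0_cst (fun z => beta (z + w) - beta z) _ _ z).
  - by rewrite /= [RHS]addrC subrK.
  - by move=> y; apply: dd; left.
  - by move=> y; apply: dd; right.
have [n1 inc1] := inc w1 p1; have [n2 inc2] := inc w2 p2.
pose b : C := n1%:~R * dual1 w1 w2 + n2%:~R * dual2 w1 w2.
have dotZ (n : int) g z : dotC (n%:~R * g) z = n%:~R * dotC g z.
  by rewrite -(rmorph_int (real_complex R)) /dotC !ReImE /=; ring.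
have a0 := area0.
have b1 : dotC b w1 = n1%:~R.
  by rewrite /b dotCDl !dotZ /dotC /=; move: a0; rewrite /area => a0; field.
have b2 : dotC b w2 = n2%:~R.
  by rewrite /b dotCDl !dotZ /dotC /=; move: a0; rewrite /area => a0; field.
exists b; first by split; [exists n1|exists n2].
pose l z := beta z + (- (2 * pi)) * dotC b z.
have cl : CP l.
  split.
  - apply: cont2D => //; apply: cont2M; [exact: cont2_cst|exact: cont2_dot].
  - by move=> z; rewrite /l dotCDr inc1 b1; ring.
  - by move=> z; rewrite /l dotCDr inc2 b2; ring.
have hl : harmonic_fun l by exact: harmonic_sub_dot.
by move=> z; have := harmonic_periodic_cst cl hl z;
  rewrite -(harmonic_periodic_cst cl hl 0) /l dotC0r; lra.
Qed.

End Angle.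

(** * Trigonometric sums *)

Section TrigonometricSums.
Variable R : realType.
Local Notation C := R[i].
Implicit Types (z h g T : C) (s : seq C) (k c : C -> C) (p q : C -> C).

Lemma sumJ (I : Type) (s : seq I) (F : I -> C) :
  (\sum_(i <- s) F i)^*%C = \sum_(i <- s) (F i)^*%C.
Proof. exact: rmorph_sum. Qed.

Lemma smoothD (f f' : C -> R) : smooth f -> smooth f' -> smooth (fun z => f z + f' z).
Proof. by move=> sf sf' n; exact: class_CD (sf n) (sf' n). Qed.

Lemma smoothC_cst (c : C) : smoothC (fun=> c).
Proof. by split => n; exact: class_C_cst. Qed.

Lemma smoothCD p q : smoothC p -> smoothC q -> smoothC (fun z => p z + q z).
Proof.
move=> [pr pi] [qr qi]; split.
  rewrite (_ : (fun z => _) = fun z => Re (p z) + Re (q z)); first exact: smoothD.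
  by apply/funext => z; rewrite ReD.
rewrite (_ : (fun z => _) = fun z => Im (p z) + Im (q z)); first exact: smoothD.
by apply/funext => z; rewrite ImD.
Qed.

Lemma smoothC_expw (c : C) g : smoothC (fun z => c * expw g z).
Proof.
split => n.
  rewrite (_ : (fun z => _) = fun z => Re c * wave g 0 z + (- Im c) * wave g (- (pi / 2)) z).
    exact: class_CD (class_C_wave n _ _ _) (class_C_wave n _ _ _).
  by apply/funext => z; rewrite ReM ReexpwE ImexpwE; ring.
rewrite (_ : (fun z => _) = fun z => Re c * wave g (- (pi / 2)) z + Im c * wave g 0 z).
  exact: class_CD (class_C_wave n _ _ _) (class_C_wave n _ _ _).
by apply/funext => z; rewrite ImM ReexpwE ImexpwE.
Qed.

Definition trig s k c T z : C := T + \sum_(g <- s) c g * expw (k g) z.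

Lemma smoothC_trig s k c T : smoothC (trig s k c T).
Proof.
apply: smoothCD; first exact: smoothC_cst.
elim: s => [|g s IH].
  rewrite (_ : (fun z => _) = fun=> 0); first exact: smoothC_cst.
  by apply/funext => z; rewrite big_nil.
rewrite (_ : (fun z => _) = fun z => c g * expw (k g) z + \sum_(i <- s) c i * expw (k i) z).
  by apply: smoothCD => //; exact: smoothC_expw.
by apply/funext => z; rewrite big_cons.
Qed.

Lemma is_ddirC_trig h s k c T z : is_ddirC h (trig s k c T) z
  (trig s k (fun g => c g * ((2 * pi * dotC (k g) h)%:C%C * 'i%C)) 0 z).
Proof.
apply: is_ddirC_eq (is_ddirCD (is_ddirC_cst h T z) (is_ddirC_sum s (fun g =>
  is_ddirCZ (c g) (is_ddirC_expw h (k g) z)))) _.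
by rewrite /trig; congr (_ + _); apply: eq_bigr => g _; rewrite !mulrA.
Qed.

Variables w1 w2 : C.
Hypothesis area0 : area w1 w2 != 0.

Lemma CPC_trig s k c T : {in s, forall g, dual12 w1 w2 (k g)} -> CPC w1 w2 (trig s k c T).
Proof.
move=> dk; apply: CPCD; first exact: CPC_cst.
by apply: CPC_sum => g gs; apply: CPCZ; apply: CPC_expw; exact: dk.
Qed.

Lemma coef_trig s k c T g : {in s, forall g, dual12 w1 w2 (k g)} -> dual12 w1 w2 g ->
  coef w1 w2 (trig s k c T) g = T * (g == 0)%:R + \sum_(j <- s) c j * (k j == g)%:R.
Proof.
move=> dk dg.
have cs : {in s, forall j, CPC w1 w2 (fun z => c j * expw (k j) z)}.
  by move=> j js; apply: CPCZ; apply: CPC_expw; exact: dk.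
rewrite (coefD area0 (CPC_cst w1 w2 T) (CPC_sum cs) dg) (coef_cst area0 T dg).
rewrite (coef_sum area0 cs dg); congr (_ + _).
rewrite big_seq [RHS]big_seq; apply: eq_bigr => j js.
have dj := dk j js.
by rewrite (coefZ area0 (c j) (CPC_expw dj) dg) (coef_expw area0 dj dg).
Qed.

End TrigonometricSums.

Section PairCoordinates.
Variable R : realType.
Local Notation C := R[i].
Implicit Types (z h : C) (X : C -> 'cV[R]_4) (p q : C -> C).

Lemma ofpqE (x y : C) : [/\ ofpq x y 0 0 = 2^-1 * Re x + 2^-1 * Re y,
  ofpq x y 1 0 = 2^-1 * Im x + 2^-1 * Im y, ofpq x y 2 0 = 2^-1 * Im x + - 2^-1 * Im y &
  ofpq x y 3 0 = - 2^-1 * Re x + 2^-1 * Re y].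
Proof. by split; rewrite mxE /=; field. Qed.

Lemma is_ddir_ofpq h p q z dp dq : is_ddirC h p z dp -> is_ddirC h q z dq ->
  forall j, is_ddir h (fun z => ofpq (p z) (q z) j 0) z (ofpq dp dq j 0).
Proof.
move=> [pr pi] [qr qi].
have lin (f f' : C -> R) d d' (a b : R) : is_ddir h f z d -> is_ddir h f' z d' ->
    is_ddir h (fun z => a * f z + b * f' z) z (a * d + b * d').
  by move=> df df'; apply: is_ddirD; exact: is_ddirZ.
have E := ofpqE.
apply: forall_ord4.
- have [-> _ _ _] := E dp dq; rewrite (_ : (fun z => _) = fun z => 2^-1 * Re (p z) + 2^-1 * Re (q z)).
    exact: lin.
  by apply/funext => y; have [-> _ _ _] := E (p y) (q y).
- have [_ -> _ _] := E dp dq; rewrite (_ : (fun z => _) = fun z => 2^-1 * Im (p z) + 2^-1 * Im (q z)).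
    exact: lin.
  by apply/funext => y; have [_ -> _ _] := E (p y) (q y).
- have [_ _ -> _] := E dp dq; rewrite (_ : (fun z => _) = fun z => 2^-1 * Im (p z) + - 2^-1 * Im (q z)).
    exact: lin.
  by apply/funext => y; have [_ _ -> _] := E (p y) (q y).
- have [_ _ _ ->] := E dp dq; rewrite (_ : (fun z => _) = fun z => - 2^-1 * Re (p z) + 2^-1 * Re (q z)).
    exact: lin.
  by apply/funext => y; have [_ _ _ ->] := E (p y) (q y).
Qed.

Lemma smoothV_ofpq p q : smoothC p -> smoothC q -> smoothV (fun z => ofpq (p z) (q z)).
Proof.
move=> [pr pi] [qr qi].
have lin (f f' : C -> R) (a b : R) : smooth f -> smooth f' ->
    smooth (fun z => a * f z + b * f' z).
  by move=> sf sf'; apply: smoothD => n; exact: class_CZ.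
apply: forall_ord4.
- rewrite (_ : (fun z => _) = fun z => 2^-1 * Re (p z) + 2^-1 * Re (q z)); first exact: lin.
  by apply/funext => y; have [-> _ _ _] := ofpqE (p y) (q y).
- rewrite (_ : (fun z => _) = fun z => 2^-1 * Im (p z) + 2^-1 * Im (q z)); first exact: lin.
  by apply/funext => y; have [_ -> _ _] := ofpqE (p y) (q y).
- rewrite (_ : (fun z => _) = fun z => 2^-1 * Im (p z) + - 2^-1 * Im (q z)); first exact: lin.
  by apply/funext => y; have [_ _ -> _] := ofpqE (p y) (q y).
- rewrite (_ : (fun z => _) = fun z => - 2^-1 * Re (p z) + 2^-1 * Re (q z)); first exact: lin.
  by apply/funext => y; have [_ _ _ ->] := ofpqE (p y) (q y).
Qed.

Lemma is_ddirC_cp h X z (dX : 'cV[R]_4) :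
  (forall j, is_ddir h (fun z => X z j 0) z (dX j 0)) ->
  is_ddirC h (fun z => cp (X z)) z (cp dX) /\ is_ddirC h (fun z => cq (X z)) z (cq dX).
Proof.
move=> d; split; split.
- exact: is_ddirB.
- exact: is_ddirD.
- exact: is_ddirD.
- exact: is_ddirB.
Qed.

End PairCoordinates.

(** * The Hamiltonian stationary immersions as trigonometric sums *)

Section Solutions.
Variable R : realType.
Local Notation C := R[i].
Local Notation piC := ((pi : R)%:C%C).
Implicit Types (z w h g : C) (s : seq C) (P : C -> C).

Lemma dotC_conj g h : (2 * pi * dotC g h)%:C%C = piC * (g^*%C * h + g * h^*%C).
Proof. by apply: eqC; rewrite /dotC !ReImE /=; ring. Qed.

Lemma sqri : 'i%C * 'i%C = -1 :> C.
Proof. by rewrite -expr2 sqr_i. Qed.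

Lemma conjCi : ('i%C : C)^*%C = - 'i%C.
Proof. by apply: eqC => /=; rewrite ?oppr0. Qed.

Lemma conjCR (t : R) : (t%:C%C : C)^*%C = t%:C%C.
Proof. exact: conjc_real. Qed.

Lemma cisJ (t : R) : (cis t)^*%C = cis (- t).
Proof. by rewrite cisN. Qed.

Lemma expwJ g z : (expw g z)^*%C = expw (- g) z.
Proof. by rewrite expwN. Qed.

Variables w1 w2 : C.
Hypothesis area0 : area w1 w2 != 0.
Variable beta0 : C.
Hypothesis dual_beta0 : dual12 w1 w2 beta0.
Local Notation delta := (beta0 / 2).
Local Notation dual12 := (dual12 w1 w2).

(** The admissible frequencies: those of freqs, with the condition g^2 != delta^2 split
    into its two factors (see freqsE). *)
Definition good g := [/\ dual12 (delta + g), dual12 (delta - g), delta + g != 0,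
  delta - g != 0 & g * g^*%C = delta * delta^*%C].

Lemma goodN g : good g -> good (- g).
Proof.
move=> [d1 d2 n1 n2 e]; split; rewrite ?opprK //.
by rewrite rmorphN /= mulrNN.
Qed.

(** On the circle |g| = |delta| the vectors delta + g and delta - g are orthogonal. *)
Lemma good_orth g : good g ->
  (delta + g) * (delta - g)^*%C = - ((delta + g)^*%C * (delta - g)).
Proof.
move=> [_ _ _ _ e]; apply/eqP; rewrite -subr_eq0 opprK.
have -> : (delta + g) * (delta - g)^*%C + (delta + g)^*%C * (delta - g) =
    2 * (delta * delta^*%C - g * g^*%C).
  by rewrite !rmorphB !rmorphD /=; ring.
by rewrite e subrr mulr0.
Qed.

Definition solP s P (T : C) : C -> C := trig s (fun g => delta + g) P T.
Definition solQ s (mu : C) P (T : C) : C -> C :=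
  trig s (fun g => delta - g) (fun g => - mu * ((delta + g) / (delta - g)) * (P g)^*%C) T.
Definition solX s mu P T1 T2 z := ofpq (solP s P T1 z) (solQ s mu P T2 z).

(** The components a, b of the frame u of solX, for mu = e^{2 i th}. *)
Definition solA s (th : R) P : C -> C :=
  trig s id (fun g => cis (- th) * ('i%C * piC) * (delta + g)^*%C * P g) 0.
Definition solB s (th : R) P : C -> C :=
  trig s -%R (fun g => cis th * piC * (delta + g)^*%C * (P g)^*%C) 0.

Lemma expw_delta z (th : R) : cis (pi * dotC beta0 z + th) = expw delta z * cis th.
Proof.
rewrite cisD /expw; congr (cis _ * _); rewrite -(dotCZr _ pi) -(dotCZr delta (2 * pi)).
have -> : beta0 = delta + delta by field.
by rewrite [in RHS](_ : (delta + delta) / 2 = delta); [rewrite dotCDl !dotCZr; ring|field].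
Qed.

Lemma cis_double (th : R) : cis (2 * th) = cis th * cis th.
Proof. by rewrite -cisD; congr cis; ring. Qed.

Lemma is_ddirC_solP h s th P T z : {in s, forall g, good g} ->
  is_ddirC h (solP s P T) z (cis (pi * dotC beta0 z + th) *
    (solA s th P z * h + 'i%C * (solB s th P z * h)^*%C)).
Proof.
move=> sg; apply: is_ddirC_eq (is_ddirC_trig h s _ P T z) _.
rewrite /solA /solB /trig !add0r conjCM sumJ !mulr_suml !mulr_sumr -big_split mulr_sumr /=.
apply: eq_bigr => g _; rewrite expw_delta dotC_conj !conjCM expwJ opprK cisJ !conjcK conjCR.
rewrite expwD -[LHS]mul1r -(cisKV th); ring.
Qed.

Lemma is_ddirC_solQ h s th P T z : {in s, forall g, good g} ->
  is_ddirC h (solQ s (cis (2 * th)) P T) z (cis (pi * dotC beta0 z + th) *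
    ((solA s th P z * h)^*%C + 'i%C * (solB s th P z * h))).
Proof.
move=> sg; apply: is_ddirC_eq (is_ddirC_trig h s _ _ T z) _.
rewrite /solA /solB /trig !add0r conjCM sumJ !mulr_suml !mulr_sumr -big_split mulr_sumr /=.
rewrite big_seq [RHS]big_seq; apply: eq_bigr => g /sg gg.
rewrite expw_delta dotC_conj !conjCM expwJ !cisJ !conjcK conjCR opprK conjCi cis_double.
have [_ _ _ n2 _] := gg.
have r1 : (delta + g) / (delta - g) * (delta - g)^*%C = - (delta + g)^*%C.
  by rewrite mulrAC good_orth // mulNr mulfK.
have r2 : (delta + g) / (delta - g) * (delta - g) = delta + g by rewrite divfK.
rewrite expwD; set r := (delta + g) / (delta - g) in r1 r2 *.
transitivity (- (cis th * cis th) * (P g)^*%C * piC * 'i%C * (expw delta z * expw (- g) z) *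
   ((r * (delta - g)^*%C) * h + (r * (delta - g)) * h^*%C)); first by ring.
by rewrite r1 r2; ring.
Qed.

(** The differential of solX has the form required of an immersion with
    Lagrangian angle 2 (pi <beta0, z> + th). *)
Lemma is_ddir_solX h s th P T1 T2 z j : {in s, forall g, good g} ->
  is_ddir h (fun z => solX s (cis (2 * th)) P T1 T2 z j 0) z
    (Re (lform (pi * dotC beta0 z + th) (frame (solA s th P z) (solB s th P z)) h j 0)).
Proof.
move=> sg; rewrite lformE mxE /=.
exact: is_ddir_ofpq (is_ddirC_solP h th P T1 z sg) (is_ddirC_solQ h th P T2 z sg) j.
Qed.

Lemma ddirV_solX h s th P T1 T2 z : {in s, forall g, good g} ->
  toCmx (ddirV h (solX s (cis (2 * th)) P T1 T2) z) =
  lform (pi * dotC beta0 z + th) (frame (solA s th P z) (solB s th P z)) h.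
Proof.
move=> sg; rewrite lformE; congr toCmx; apply/colP => j; rewrite [LHS]mxE.
rewrite (is_ddirE (is_ddir_solX h th P T1 T2 z j sg)).
by rewrite lformE mxE.
Qed.

Definition lat : set C := [set z | exists m n : int, z = w1 *~ m + w2 *~ n].

Lemma dotCMz g w (m : int) : dotC g (w *~ m) = dotC g w * m%:~R.
Proof. by rewrite -mulrzl -(rmorph_int (real_complex R)) dotCZr mulrC. Qed.

Lemma dual_latticeE g : dual_lattice lat g <-> dual12 g.
Proof.
split => [dg|[[m mE] [n nE]] w [m' [n' ->]]].
  split; apply: dg; [exists 1, 0|exists 0, 1]; by rewrite mulr1z mulr0z ?addr0 ?add0r.
by exists (m * m' + n * n'); rewrite dotCDr !dotCMz mE nE rmorphD !rmorphM.
Qed.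

Lemma lattice_periodicE (V : Type) (f : C -> V) : lattice_periodic lat f <->
  (forall z, f (z + w1) = f z) /\ (forall z, f (z + w2) = f z).
Proof.
split => [pf|[p1 p2] w z [m [n ->]]].
  split => z; apply: pf; [exists 1, 0|exists 0, 1]; by rewrite mulr1z mulr0z ?addr0 ?add0r.
rewrite -[RHS](periodic_latpt z m n p1 p2); congr (f (z + _)).
by rewrite /latpt !rmorph_int !mulrzl.
Qed.

Lemma freqsE g : freqs lat beta0 g <-> good g.
Proof.
have e1 : delta + g = (g - delta) + beta0 by field.
have e2 : delta - g = - (g - delta) by rewrite opprB.
split => [[/dual_latticeE dg ng sg]|[d1 d2 n1 n2 e]].
  have [n1 n2] : delta + g != 0 /\ delta - g != 0.
    apply/andP; rewrite -negb_or -mulf_eq0; apply: contra sg => /eqP h.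
    by rewrite -subr_eq0 -oppr_eq0 opprB subr_sqr mulrC h.
  split => //; first by rewrite e1; exact: dual12D.
    by rewrite e2; exact: dual12N.
  by rewrite -!sqr_normc.
split.
- by apply/dual_latticeE; rewrite -[g - delta]opprK -e2 -[- (delta - g)]/(- (delta - g)); exact: dual12N.
- by rewrite !sqr_normc.
- apply/eqP => h; have /eqP : (delta + g) * (delta - g) = 0.
    by rewrite mulrC -subr_sqr h subrr.
  by rewrite mulf_eq0 (negbTE n1) (negbTE n2).
Qed.

End Solutions.

Section Classification.
Variable R : realType.
Local Notation C := R[i].
Local Notation piC := ((pi : R)%:C%C).
Implicit Types (z w h g : C) (s : seq C) (X : C -> 'cV[R]_4).

Variables w1 w2 : C.
Hypothesis area0 : area w1 w2 != 0.
Local Notation dual12 := (dual12 w1 w2).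
Local Notation lat := (lat w1 w2).
Local Notation coef := (coef w1 w2).
Local Notation CP := (CP w1 w2).
Local Notation CPC := (CPC w1 w2).

Lemma HSL_angle X beta : HSL lat X beta ->
  exists2 b : C, dual12 b & forall z, beta z = beta 0 + 2 * pi * dotC b z.
Proof.
move=> [_ _ hb /lattice_periodicE[p1 p2] _]; exact: angle_affine hb p1 p2.
Qed.

Lemma ddir_affine (beta : C -> R) (b : C) (c : R) h z :
  (forall z, beta z = c + 2 * pi * dotC b z) -> is_ddir h beta z (2 * pi * dotC b h).
Proof.
move=> betaE; rewrite (_ : beta = fun z => c + 2 * pi * dotC b z); last exact/funext.
rewrite -[X in is_ddir _ _ _ X]add0r; apply: is_ddirD; first exact: is_ddir_cst.
by apply: is_ddirZ; exact: is_ddir_dot.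
Qed.

Lemma is_ddirC_real h (f : C -> R) z d : is_ddir h f z d ->
  is_ddirC h (fun z => (f z)%:C%C) z d%:C%C.
Proof. by move=> df; split => //; exact: is_ddir_cst. Qed.

Lemma dz_affine (beta : C -> R) (b : C) (c : R) z :
  (forall z, beta z = c + 2 * pi * dotC b z) -> dz (fun w => (beta w)%:C%C) z = piC * b^*%C.
Proof.
move=> /ddir_affine db; rewrite /dz !(is_ddirCE (is_ddirC_real (db _ _))) !dotC_conj.
rewrite conjc1 conjCi.
transitivity (2^-1 * piC * ((b^*%C + b) - ('i%C * 'i%C) * (b^*%C - b))); first by ring.
by rewrite sqri; field.
Qed.

Lemma beta0_affine (beta : C -> R) (b : C) (c : R) z :
  (forall z, beta z = c + 2 * pi * dotC b z) -> beta0_at beta z = b.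
Proof.
by move=> /ddir_affine db; rewrite /beta0_at /dzbar !(is_ddirCE (is_ddirC_real (db _ _)));
  rewrite !dotC_conj conjc1 conjCi; have pi0 : piC != 0 by [rewrite fmorph_eq0 gt_eqF // pi_gt0];
  rewrite fmorphV;
  transitivity (2^-1 * (piC / piC) * ((b^*%C + b) + ('i%C * 'i%C) * (b^*%C - b))); [ring|];
  rewrite sqri mulfV //; field.
Qed.

Section Coefficients.
Variables (X : C -> 'cV[R]_4) (beta : C -> R) (beta0 : C) (c : R).
Hypothesis hsl : HSL lat X beta.
Hypothesis dual_beta0 : dual12 beta0.
Hypothesis betaE : forall z, beta z = c + 2 * pi * dotC beta0 z.
Local Notation delta := (beta0 / 2).

Let p z := cp (X z).
Let q z := cq (X z).
Let dp h z := cp (ddirV h X z).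
Let dq h z := cq (ddirV h X z).

Let X_CP j : CP (fun z => X z j 0).
Proof.
have [sX /lattice_periodicE[p1 p2] _ _ _] := hsl.
by split => [|z|z]; [exact: (sX j 0%N)|rewrite p1|rewrite p2].
Qed.

Let dX_CP h j : h = 1 \/ h = 'i%C -> CP (fun z => ddirV h X z j 0).
Proof.
have [sX _ _ _ _] := hsl; have [_ _ cx cy] := sX j 1%N.
rewrite (_ : (fun z => _) = ddir h (fun z => X z j 0)); last by apply/funext => z; rewrite mxE.
by case=> ->; exact: (CP_ddir (X_CP j)).
Qed.

Let dX_ddir h z j : h = 1 \/ h = 'i%C -> is_ddir h (fun z => X z j 0) z (ddirV h X z j 0).
Proof.
have [sX _ _ _ _] := hsl; have [dx dy _ _] := sX j 1%N.
by rewrite mxE; case=> ->; exact: derivable_is_ddir.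
Qed.

Let cp_CPC (Y : C -> 'cV[R]_4) : (forall j, CP (fun z => Y z j 0)) -> CPC (fun z => cp (Y z)).
Proof. by move=> cY; split; [exact: CPB|exact: CPD]. Qed.
Let cq_CPC (Y : C -> 'cV[R]_4) : (forall j, CP (fun z => Y z j 0)) -> CPC (fun z => cq (Y z)).
Proof. by move=> cY; split; [exact: CPD|exact: CPB]. Qed.

Lemma p_CPC : CPC p. Proof. exact: cp_CPC. Qed.
Lemma q_CPC : CPC q. Proof. exact: cq_CPC. Qed.
Let dp_CPC h : h = 1 \/ h = 'i%C -> CPC (dp h).
Proof. by move=> h1; apply: cp_CPC => j; exact: dX_CP. Qed.
Let dq_CPC h : h = 1 \/ h = 'i%C -> CPC (dq h).
Proof. by move=> h1; apply: cq_CPC => j; exact: dX_CP. Qed.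

(** The form of dX leaves a and b free, but lets the derivatives of p = cp X determine
    those of q = cq X: a h + i conj(b h) and conj(a h) + i b h, at h = 1 and h = i, are
    exchanged up to a phase by conjugation. *)
Let cauchy_riemann z :
  dq 1 z = cis c * 'i%C * (expw beta0 z * (dp 'i%C z)^*%C) /\
  dq 'i%C z = - (cis c * 'i%C) * (expw beta0 z * (dp 1 z)^*%C).
Proof.
have [_ _ _ _ [a [b [_ _ dX _]]]] := hsl.
have dXE h : ddirV h X z = ofpq
    (cis (beta z / 2) * (a z * h + 'i%C * (b z * h)^*%C))
    (cis (beta z / 2) * ((a z * h)^*%C + 'i%C * (b z * h))).
  by apply: toCmx_inj; rewrite dX lformE.
have e : cis c * expw beta0 z = cis (beta z / 2) * cis (beta z / 2).
  by rewrite /expw -!cisD; congr cis; rewrite betaE; field.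
have uv : cis (beta z / 2) * (cis (beta z / 2))^*%C = 1 by rewrite cisJ cisKV.
have i2 := sqri R.
have dpE h : dp h z = cis (beta z / 2) * (a z * h + 'i%C * (b z * h)^*%C).
  by rewrite /dp dXE cp_ofpq.
have dqE h : dq h z = cis (beta z / 2) * ((a z * h)^*%C + 'i%C * (b z * h)).
  by rewrite /dq dXE cq_ofpq.
rewrite !dpE !dqE !conjCM !conjCD !conjCM !conjcK conjc1 conjCi.
move: e uv; move: (cis (beta z / 2)) (cis c) => u m e uv; split.
- transitivity ((- ('i%C * 'i%C)) * u * (u * u^*%C) * ((a z)^*%C + 'i%C * b z)).
    by rewrite i2 uv; ring.
  transitivity ('i%C * (m * expw beta0 z) * (u^*%C * ((a z)^*%C * - 'i%C - 'i%C * (b z * 'i%C)))); last by ring.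
  by rewrite e; ring.
- transitivity (u * (u * u^*%C) * ((a z)^*%C * - 'i%C + 'i%C * (b z * 'i%C))).
    by rewrite uv; ring.
  transitivity (- ('i%C * (m * expw beta0 z)) * (u^*%C * ((a z)^*%C * 1 + - 'i%C * (b z * 1)))).
    by rewrite e; ring.
  by ring.
Qed.

(** Fourier coefficients turn this first-order system into linear equations that
    couple the frequencies eta and beta0 - eta. *)
Lemma coef_system eta : dual12 eta ->
  (Re eta)%:C%C * coef (fun z => cq (X z)) eta = - (cis c * 'i%C) *
    ((Im (beta0 - eta))%:C%C * (coef (fun z => cp (X z)) (beta0 - eta))^*%C) /\
  (Im eta)%:C%C * coef (fun z => cq (X z)) eta = cis c * 'i%C *
    ((Re (beta0 - eta))%:C%C * (coef (fun z => cp (X z)) (beta0 - eta))^*%C).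
Proof.
move=> de; have de' : dual12 (beta0 - eta) by apply: dual12D => //; exact: dual12N.
have D h : h = 1 \/ h = 'i%C ->
    coef (dq h) eta = (2 * pi * dotC eta h)%:C%C * 'i%C * coef q eta /\
    coef (dp h) (beta0 - eta) = (2 * pi * dotC (beta0 - eta) h)%:C%C * 'i%C * coef p (beta0 - eta).
  move=> h1; have dd z := @is_ddirC_cp R h X z _ (fun j => dX_ddir z j h1); split.
    exact: (coef_ddir area0 q_CPC (dq_CPC h1) (fun z => (dd z).2) de).
  exact: (coef_ddir area0 p_CPC (dp_CPC h1) (fun z => (dd z).1) de').
have [q1 p1] := D 1 (or_introl erefl); have [qi pi'] := D 'i%C (or_intror erefl).
have J h (m : C) : h = 1 \/ h = 'i%C ->
    coef (fun z => m * (expw beta0 z * (dp h z)^*%C)) eta = m * (coef (dp h) (beta0 - eta))^*%C.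
  move=> h1; have cE : CPC (fun z => expw beta0 z * (dp h z)^*%C).
    by apply: CPCM; [exact: CPC_expw|apply: CPCJ; exact: dp_CPC].
  by rewrite (coefZ area0 m cE de) (coef_expwJ area0 (dp_CPC h1) dual_beta0 de).
have E1 : coef (dq 1) eta = cis c * 'i%C * (coef (dp 'i%C) (beta0 - eta))^*%C.
  rewrite -(J _ _ (or_intror erefl)); congr (coef _ eta).
  by apply/funext => z; have [] := cauchy_riemann z.
have Ei : coef (dq 'i%C) eta = - (cis c * 'i%C) * (coef (dp 1) (beta0 - eta))^*%C.
  rewrite -(J _ _ (or_introl erefl)); congr (coef _ eta).
  by apply/funext => z; have [] := cauchy_riemann z.
have dot1 g : dotC g 1 = Re g by rewrite /dotC /=; ring.
have doti g : dotC g 'i%C = Im g by rewrite /dotC /=; ring.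
have tp (t : R) : (2 * pi * t)%:C%C = (2 * pi)%:C%C * t%:C%C by rewrite -rmorphM.
have k0 : (2 * pi)%:C%C * 'i%C != 0 :> C.
  rewrite mulf_eq0 negb_or fmorph_eq0 gt_eqF ?mulr_gt0 ?pi_gt0 //=.
  by apply/eqP => /(congr1 Im) /= /eqP; rewrite oner_eq0.
split; apply: (mulfI k0).
- move: E1; rewrite q1 pi' dot1 doti !conjCM conjCR conjCi !tp => E1.
  by transitivity ((2 * pi)%:C%C * (Re eta)%:C%C * 'i%C * coef q eta); [ring|rewrite E1; ring].
- move: Ei; rewrite qi p1 dot1 doti !conjCM conjCR conjCi !tp => Ei.
  by transitivity ((2 * pi)%:C%C * (Im eta)%:C%C * 'i%C * coef q eta); [ring|rewrite Ei; ring].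
Qed.

Variable s : seq C.
Hypothesis sU : uniq s.
Hypothesis sE : forall g, (g \in s) <-> freqs lat beta0 g.
Local Notation mu := (cis c).
Local Notation cfp := (coef (fun z => cp (X z))).
Local Notation cfq := (coef (fun z => cq (X z))).

Lemma coef_q eta : dual12 eta ->
  eta * cfq eta = - mu * (beta0 - eta) * (cfp (beta0 - eta))^*%C.
Proof.
move=> de; have [e1 e2] := coef_system de.
have -> : eta * cfq eta = (Re eta)%:C%C * cfq eta + 'i%C * ((Im eta)%:C%C * cfq eta).
  by rewrite {1}(complexE eta); ring.
rewrite e1 e2; move: (cfp _)^*%C => v; rewrite [in RHS](complexE (beta0 - eta)).
transitivity (- mu * (('i%C * (Im (beta0 - eta))%:C%C) -
  ('i%C * 'i%C) * (Re (beta0 - eta))%:C%C) * v); first by ring.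
by rewrite sqri; ring.
Qed.

(** The two equations of coef_system at beta0 - eta admit a nonzero coefficient only
    if eta and beta0 - eta are orthogonal, that is, by Thales, if eta - delta lies on
    the circle of radius |delta|. *)
Lemma coef_p_eq0 eta : dual12 eta -> eta != 0 -> eta - delta \notin s -> cfp eta = 0.
Proof.
move=> de e0 es; apply/eqP; apply: contraNT es => pe0; apply/sE/freqsE => //.
have dual' : dual12 (beta0 - eta) by apply: dual12D => //; exact: dual12N.
have e2 : delta + (eta - delta) = eta by rewrite addrC subrK.
have e3 : delta - (eta - delta) = beta0 - eta by field.
have ce0 : (cfp eta)^*%C != 0 by rewrite conjc_eq0.
have e'0 : beta0 - eta != 0.
  apply/eqP => e'0; have := coef_q dual'; rewrite subKr e'0 mul0r => /esym/eqP.
  rewrite !mulf_eq0 oppr_eq0 (negbTE (cis_neq0 _)) (negbTE ce0) orbF /=.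
  by rewrite (negbTE e0).
rewrite /good e2 e3; split => //.
have [q1 q2] := coef_system dual'; rewrite !subKr in q1 q2.
have dot0 : (Re eta * Re (beta0 - eta) + Im eta * Im (beta0 - eta))%:C%C = 0 :> C.
  have mi0 : cis c * 'i%C != 0.
    by rewrite mulf_neq0 ?cis_neq0 //; apply/eqP => /(congr1 Im) /= /eqP; rewrite oner_eq0.
  apply: (mulIf ce0); apply: (mulfI mi0); rewrite mul0r mulr0.
  move: (cfp eta)^*%C q1 q2 => v q1 q2; rewrite rmorphD !rmorphM /=.
  transitivity ((Re (beta0 - eta))%:C%C * (cis c * 'i%C * ((Re eta)%:C%C * v)) -
      (Im (beta0 - eta))%:C%C * (- (cis c * 'i%C) * ((Im eta)%:C%C * v))); first by ring.
  by rewrite -q1 -q2; ring.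
have {}dot0 := congr1 Re dot0; rewrite /= in dot0.
have bE : beta0 = delta + delta by field.
move: dot0; rewrite [in X in X -> _]bE; move: delta => d.
by rewrite !ReImE => dot0; apply: eqC; rewrite !ReImE; [lra|ring].
Qed.

(** Both sides have the same Fourier coefficients: those of cp (X z) vanish off the
    admissible frequencies, and coef_q gives those of cq (X z) in terms of them. *)
Theorem HSL_solX : X = solX beta0 s mu (fun g => cfp (delta + g)) (cfp 0) (cfq 0).
Proof.
have sg : {in s, forall g, good w1 w2 beta0 g}.
  by move=> g /sE; rewrite freqsE.
have dP : {in s, forall g, dual12 (delta + g)} by move=> g /sg[].
have dQ : {in s, forall g, dual12 (delta - g)} by move=> g /sg[].
have pick (F : C -> C) (k : C -> C) g0 eta : (forall g, (k g == eta) = (g == g0)) ->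
    \sum_(g <- s) F g * (k g == eta)%:R = if g0 \in s then F g0 else 0.
  move=> kE; under eq_bigr => g _ do rewrite kE.
  case: ifP => gs.
    rewrite (bigD1_seq g0) //= eqxx mulr1 big1 ?addr0 // => g /negbTE ->.
    by rewrite mulr0.
  rewrite big_seq big1 // => g gsin; case: eqVneq => [e|_]; last by rewrite mulr0.
  by rewrite -e gsin in gs.
have Pz z : cp (X z) - solP beta0 s (fun g => cfp (delta + g)) (cfp 0) z = 0.
  have cP := CPC_trig (fun g => cfp (delta + g)) (cfp 0) dP.
  have cPN := CPCZ (-1) cP.
  rewrite -mulN1r; apply: (fourier_uniqueC area0 (CPCD p_CPC cPN)) => eta de.
  rewrite (coefD area0 p_CPC cPN de) (coefZ area0 (-1) cP de).
  rewrite (coef_trig area0 _ _ dP de) (@pick _ _ (eta - delta)); last first.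
    by move=> g; rewrite addrC eq_sym -subr_eq eq_sym.
  have [e0|e0] := eqVneq eta 0.
    rewrite e0 mulr1 sub0r; case: ifP => [/sg[_ _]|_]; first by rewrite subrr eqxx.
    by rewrite addr0 mulN1r subrr.
  rewrite mulr0 add0r; case: ifP => es; first by rewrite (addrC delta) subrK mulN1r subrr.
  by rewrite mulr0 addr0 coef_p_eq0 // es.
have Qz z : cq (X z) - solQ beta0 s mu (fun g => cfp (delta + g)) (cfq 0) z = 0.
  have cQ := CPC_trig (fun g => - mu * ((delta + g) / (delta - g)) * (cfp (delta + g))^*%C) (cfq 0) dQ.
  have cQN := CPCZ (-1) cQ.
  rewrite -mulN1r; apply: (fourier_uniqueC area0 (CPCD q_CPC cQN)) => eta de.
  rewrite (coefD area0 q_CPC cQN de) (coefZ area0 (-1) cQ de).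
  rewrite (coef_trig area0 _ _ dQ de) (@pick _ _ (delta - eta)); last first.
    by move=> g; rewrite subr_eq addrC -subr_eq eq_sym.
  have de' : dual12 (beta0 - eta) by apply: dual12D => //; exact: dual12N.
  have e1 : delta + (delta - eta) = beta0 - eta by field.
  have e2 : delta - (delta - eta) = eta by rewrite subKr.
  have [e0|e0] := eqVneq eta 0.
    rewrite e0 mulr1 subr0; case: ifP => [/sg[_ _ _]|_]; first by rewrite subrr eqxx.
    by rewrite addr0 mulN1r subrr.
  have qE : cfq eta = - mu * ((beta0 - eta) / eta) * (cfp (beta0 - eta))^*%C.
    apply: (mulfI e0); rewrite coef_q //; move: (cfp _)^*%C => v; field.
    exact: e0.
  rewrite mulr0 add0r; case: ifP => es; first by rewrite e1 e2 qE mulN1r subrr.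
  rewrite mulr0 addr0 qE; have [e'0|e'0] := eqVneq (beta0 - eta) 0.
    by rewrite e'0 mul0r mulr0 mul0r.
  rewrite (coef_p_eq0 de' e'0) ?conjc0 ?mulr0 // (_ : _ - delta = delta - eta) ?es //.
  by field.
apply/funext => z; apply: eq_cpq; rewrite /solX ?cp_ofpq ?cq_ofpq.
  by apply/eqP; rewrite -subr_eq0; apply/eqP; exact: Pz.
by apply/eqP; rewrite -subr_eq0; apply/eqP; exact: Qz.
Qed.

End Coefficients.
End Classification.

Section Converse.
Variable R : realType.
Local Notation C := R[i].
Local Notation piC := ((pi : R)%:C%C).
Implicit Types (z w h g : C) (s : seq C) (P : C -> C).

Variables w1 w2 : C.
Hypothesis area0 : area w1 w2 != 0.
Local Notation dual12 := (dual12 w1 w2).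
Local Notation lat := (lat w1 w2).
Local Notation CPC := (CPC w1 w2).
Variable beta0 : C.
Hypothesis dual_beta0 : dual12 beta0.
Local Notation delta := (beta0 / 2).
Local Notation good := (good w1 w2 beta0).

Lemma halfJ z : (z / 2)^*%C = z^*%C / 2.
Proof. by rewrite conjCM conjc_inv conjc_nat. Qed.

Lemma conjCN z : (- z)^*%C = - z^*%C.
Proof. exact: rmorphN. Qed.

Lemma CPC_periodic (f : C -> C) : CPC f ->
  (forall z, f (z + w1) = f z) /\ (forall z, f (z + w2) = f z).
Proof. by move=> [[_ r1 r2] [_ i1 i2]]; split => z; apply: eqC. Qed.

Lemma solX_periodic s mu P T1 T2 : {in s, forall g, good g} ->
  lattice_periodic lat (solX beta0 s mu P T1 T2).
Proof.
move=> sg; apply/lattice_periodicE.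
have dP : {in s, forall g, dual12 (delta + g)} by move=> g /sg[].
have dQ : {in s, forall g, dual12 (delta - g)} by move=> g /sg[].
have [p1 p2] := CPC_periodic (CPC_trig P T1 dP).
have [q1 q2] := CPC_periodic
  (CPC_trig (fun g => - mu * ((delta + g) / (delta - g)) * (P g)^*%C) T2 dQ).
by split => z; rewrite /solX /solP /solQ ?p1 ?q1 ?p2 ?q2.
Qed.

Lemma smoothV_solX s mu P T1 T2 : smoothV (solX beta0 s mu P T1 T2).
Proof. by apply: smoothV_ofpq; exact: smoothC_trig. Qed.

Lemma cis_periodz (x : R) (n : int) : cis (x + 2 * pi * n%:~R) = cis x.
Proof. by rewrite /cis cos_periodz sin_periodz. Qed.

Lemma harmonic_cst (c : R) : harmonic_fun (fun _ : C => c).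
Proof.
have E h (a : R) : ddir h (fun _ : C => a) = fun=> 0.
  by apply/funext => z; apply: is_ddirE; exact: is_ddir_cst.
by split; [exact: class_C_cst|move=> z; rewrite !E addr0].
Qed.

Lemma dzbarE f z d1 di : is_ddirC 1 f z d1 -> is_ddirC 'i%C f z di ->
  dzbar f z = 2^-1 * (d1 + 'i%C * di).
Proof. by move=> e1 ei; rewrite /dzbar (is_ddirCE e1) (is_ddirCE ei). Qed.

Lemma dzbar_trig s (k c : C -> C) (a : C) z : dzbar (fun z => a * trig s k c 0 z) z =
  a * \sum_(g <- s) ('i%C * piC * k g * c g) * expw (k g) z.
Proof.
rewrite (dzbarE (is_ddirCZ a (is_ddirC_trig 1 s k c 0 z))
  (is_ddirCZ a (is_ddirC_trig 'i%C s k c 0 z))) /trig !add0r.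
rewrite mulrCA -mulrDr mulrCA; congr (_ * _).
rewrite mulr_sumr -big_split mulr_sumr /=; apply: eq_bigr => g _.
rewrite !dotC_conj conjc1 conjCi.
transitivity (2^-1 * ('i%C * piC) * c g * (((k g)^*%C + k g) + ('i%C * 'i%C) * ((k g)^*%C - k g)) * expw (k g) z).
  by ring.
by rewrite sqri; field.
Qed.

Lemma solA_conj s th P z : {in s, forall g, good g} ->
  \sum_(g <- s) ('i%C * piC * g * (cis (- th) * ('i%C * piC) * (delta + g)^*%C * P g)) * expw g z =
  - (piC * delta^*%C) * (solB beta0 s th P z)^*%C.
Proof.
move=> sg; rewrite /solB /trig add0r sumJ mulr_sumr big_seq [RHS]big_seq.
apply: eq_bigr => g /sg[_ _ _ _ e].
rewrite !conjCM expwJ opprK cisJ !conjcK conjCR.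
have e2 : g * (delta + g)^*%C = delta^*%C * (delta + g).
  by rewrite conjCD mulrDr e; ring.
transitivity (('i%C * 'i%C) * piC ^+ 2 * (g * (delta + g)^*%C) * cis (- th) * P g * expw g z); first by ring.
by rewrite e2 sqri; ring.
Qed.

Lemma solB_conj s th P z : {in s, forall g, good g} ->
  \sum_(g <- s) ('i%C * piC * (- g) * (cis th * piC * (delta + g)^*%C * (P g)^*%C)) * expw (- g) z =
  piC * delta^*%C * (solA beta0 s th P z)^*%C.
Proof.
move=> sg; rewrite /solA /trig add0r sumJ mulr_sumr big_seq [RHS]big_seq.
apply: eq_bigr => g /sg[_ _ _ _ e].
rewrite !conjCM expwJ cisJ opprK !conjcK conjCR conjCi.
have e2 : g * (delta + g)^*%C = delta^*%C * (delta + g).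
  by rewrite conjCD mulrDr e; ring.
transitivity (- 'i%C * piC ^+ 2 * (g * (delta + g)^*%C) * cis th * (P g)^*%C * expw (- g) z); first by ring.
by rewrite e2; ring.
Qed.

(** The equation for u couples the mode g of solA with the mode - g of solB, and
    there it amounts to |g| = |delta|. *)
Theorem solX_HSL s th P T1 T2 : {in s, forall g, good g} ->
  HSL lat (solX beta0 s (cis (2 * th)) P T1 T2) (fun z => 2 * th + 2 * pi * dotC beta0 z).
Proof.
move=> sg; split.
- exact: smoothV_solX.
- exact: solX_periodic.
- by apply: harmonic_sub_dot; exact: harmonic_cst.
- have [[m mE] [n nE]] := dual_beta0; apply/lattice_periodicE; split => z.
    by rewrite dotCDr mE mulrDr addrA cis_periodz.
  by rewrite dotCDr nE mulrDr addrA cis_periodz.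
exists (solA beta0 s th P), (solB beta0 s th P) => u; split.
- exact: smoothC_trig.
- exact: smoothC_trig.
- move=> z h; rewrite (_ : _ / 2 = pi * dotC beta0 z + th); last by field.
  exact: (ddirV_solX h th P T1 T2 z sg).
move=> z; rewrite (@dz_affine _ _ beta0 (2 * th)) //.
have kE : 2^-1 * (piC * beta0^*%C) = piC * delta^*%C.
  by rewrite halfJ; ring.
rewrite kE.
have [c0 c1 c2 c3] := Li_mulE (Defs.conjmx (u z)).
have [u0 u1 u2 u3] := frameE (solA beta0 s th P z) (solB beta0 s th P z).
have DA (a : C) : dzbar (fun z => a * solA beta0 s th P z) z =
    a * (- (piC * delta^*%C) * (solB beta0 s th P z)^*%C).
  by rewrite dzbar_trig solA_conj.
have DB (a : C) : dzbar (fun z => a * solB beta0 s th P z) z =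
    a * (piC * delta^*%C * (solA beta0 s th P z)^*%C).
  by rewrite dzbar_trig solB_conj.
apply: col4P; rewrite mxE [RHS]mxE ?c0 ?c1 ?c2 ?c3 [in RHS]mxE ?u0 ?u1 ?u2 ?u3.
- rewrite (_ : (fun w => u w 0 0) = fun w => 2^-1 * solA beta0 s th P w); last first.
    by apply/funext => w; have [-> _ _ _] := frameE (solA beta0 s th P w) (solB beta0 s th P w); rewrite mulrC.
  by rewrite DA !halfJ; ring.
- rewrite (_ : (fun w => u w 1 0) = fun w => 2^-1 * solB beta0 s th P w); last first.
    by apply/funext => w; have [_ -> _ _] := frameE (solA beta0 s th P w) (solB beta0 s th P w); rewrite mulrC.
  by rewrite DB !halfJ; ring.
- rewrite (_ : (fun w => u w 2 0) = fun w => (- 'i%C / 2) * solA beta0 s th P w); last first.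
    by apply/funext => w; have [_ _ -> _] := frameE (solA beta0 s th P w) (solB beta0 s th P w); rewrite mulrAC.
  by rewrite DA !halfJ conjCM conjCi; ring.
- rewrite (_ : (fun w => u w 3 0) = fun w => ('i%C / 2) * solB beta0 s th P w); last first.
    by apply/funext => w; have [_ _ _ ->] := frameE (solA beta0 s th P w) (solB beta0 s th P w); rewrite mulrAC.
  by rewrite DB !halfJ conjCM conjCN conjCi opprK; ring.
Qed.

End Converse.

(** * The generators and the orbit of their span *)

Section Generators.
Variable R : realType.
Local Notation C := R[i].
Local Notation piC := ((pi : R)%:C%C).
Implicit Types (z w h g T : C) (s : seq C) (P : C -> C) (X Y : C -> 'cV[R]_4).

Variables w1 w2 : C.
Hypothesis area0 : area w1 w2 != 0.
Local Notation dual12 := (dual12 w1 w2).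
Local Notation lat := (lat w1 w2).
Variable beta0 : C.
Hypothesis dual_beta0 : dual12 beta0.
Local Notation delta := (beta0 / 2).
Local Notation good := (good w1 w2 beta0).

Lemma cp_solX s mu P T1 T2 z : cp (solX beta0 s mu P T1 T2 z) = solP beta0 s P T1 z.
Proof. exact: cp_ofpq. Qed.
Lemma cq_solX s mu P T1 T2 z : cq (solX beta0 s mu P T1 T2 z) = solQ beta0 s mu P T2 z.
Proof. exact: cq_ofpq. Qed.

Lemma solX_linear s (c : R) P P' T1 T1' T2 T2' z :
  c *: solX beta0 s 1 P T1 T2 z + solX beta0 s 1 P' T1' T2' z =
  solX beta0 s 1 (fun g => c%:C%C * P g + P' g) (c%:C%C * T1 + T1') (c%:C%C * T2 + T2') z.
Proof.
apply: eq_cpq; rewrite ?cpD ?cqD ?cpZ ?cqZ ?cp_solX ?cq_solX /solP /solQ /trig.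
  rewrite mulrDr addrACA; congr (_ + _).
  by rewrite mulr_sumr -big_split /=; apply: eq_bigr => g _; ring.
rewrite mulrDr addrACA; congr (_ + _).
by rewrite mulr_sumr -big_split /=; apply: eq_bigr => g _; rewrite conjCD conjCM conjCR; ring.
Qed.

Lemma solX_rot s (t : R) P T1 T2 z :
  expLi t *m solX beta0 s 1 P T1 T2 z =
  solX beta0 s (cis (2 * t)) (fun g => cis t * P g) (cis t * T1) (cis t * T2) z.
Proof.
apply: eq_cpq; rewrite ?cp_expLi ?cq_expLi ?cp_solX ?cq_solX /solP /solQ /trig.
  by rewrite mulrDr mulr_sumr; congr (_ + _); apply: eq_bigr => g _; ring.
rewrite mulrDr mulr_sumr; congr (_ + _); apply: eq_bigr => g _.
have u1 : cis t * (cis t)^*%C = 1 by rewrite cisJ cisKV.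
rewrite conjCM cis_double -[LHS]mul1r -[X in X * _]u1; ring.
Qed.

Lemma solX_cat1 g s mu P T1 T2 z :
  solX beta0 (g :: s) mu P T1 T2 z = solX beta0 [:: g] mu P 0 0 z + solX beta0 s mu P T1 T2 z.
Proof.
apply: eq_cpq; rewrite ?cpD ?cqD ?cp_solX ?cq_solX /solP /solQ /trig !big_cons !big_nil;
  by rewrite addr0 add0r addrCA.
Qed.

(** The amplitude for which the frame of solX at frequency g is that of v_g
    (alpha = 1) or w_g (alpha = i). *)
Definition gen_amp (alpha g : C) : C := alpha / ('i%C * piC * (delta + g)^*%C).

Definition gen (alpha g : C) := solX beta0 [:: g] 1 (fun=> gen_amp alpha g) 0 0.

Lemma ipi_neq0 : 'i%C * piC != 0 :> C.
Proof.
apply: mulf_neq0; last by rewrite fmorph_eq0 gt_eqF // pi_gt0.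
by apply/eqP => /(congr1 Im) /= /eqP; rewrite oner_eq0.
Qed.

Lemma gen_frame alpha g z : good g ->
  frame (solA beta0 [:: g] 0 (fun=> gen_amp alpha g) z)
    (solB beta0 [:: g] 0 (fun=> gen_amp alpha g) z) =
  frame (alpha * expw g z) (2 * 'i%C * g^*%C / beta0 * alpha^*%C * expw (- g) z).
Proof.
move=> [_ _ n1 n2 e]; have b0 : beta0 != 0.
  apply: contraNneq n1 => b0; move: e; rewrite b0 !mul0r add0r => /eqP.
  by rewrite mulf_eq0 conjc_eq0 orbb.
have d0 : delta != 0 by rewrite mulf_neq0 // invr_eq0 pnatr_eq0.
have n1' : (delta + g)^*%C != 0 by rewrite conjc_eq0.
rewrite /solA /solB /trig !big_cons !big_nil !addr0 !add0r oppr0 cis0 !mul1r.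
have ip := ipi_neq0; have p0 : piC != 0 by rewrite fmorph_eq0 gt_eqF // pi_gt0.
have i0 : ('i%C : C) != 0 by apply: contraNneq ip => ->; rewrite mul0r.
congr frame.
  by rewrite /gen_amp; congr (_ * _); rewrite mulrCA mulfV ?mulr1 // mulf_neq0.
congr (_ * _); rewrite /gen_amp conjCM conjc_inv !conjCM conjcK conjCi conjCR.
(* |g| = |delta| makes conj(delta + g) / (delta + g) equal to conj(g) / delta *)
have r : (delta + g)^*%C / (delta + g) = g^*%C / delta.
  apply/eqP; rewrite eqr_div // conjCD mulrDl mulrDr [g^*%C * g]mulrC e; apply/eqP; ring.
move: r n1; move: (delta + g) => d1 r n1.
move: p0; move: (piC) => k k0.
transitivity ((d1^*%C / d1) * alpha^*%C * (k / k) * (- 'i%C)^-1).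
  by field; rewrite i0 k0.
rewrite r mulfV // mulr1 invrN.
have -> : 'i%C^-1 = - 'i%C :> C.
  by apply: (mulfI i0); rewrite mulfV // mulrN sqri opprK.
by rewrite opprK; field; exact: b0.
Qed.

Lemma primitive_gen alpha g (u : C -> 'cV[C]_4) z : good g ->
  (forall z, u z = frame (alpha * expw g z) (2 * 'i%C * g^*%C / beta0 * alpha^*%C * expw (- g) z)) ->
  primitive beta0 u z = gen alpha g z - gen alpha g 0.
Proof.
move=> gg uE; have sg : {in [:: g], forall g, good g} by move=> h; rewrite inE => /eqP ->.
have D j y : is_ddir z (fun y => gen alpha g y j 0) y
    (Re (lform (pi * dotC beta0 y) (u y) z j 0)).
  have c1 : cis (2 * 0 : R) = 1 by rewrite mulr0 cis0.
  have := is_ddir_solX z 0 (fun=> gen_amp alpha g) 0 0 y j sg.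
  by rewrite c1 [pi * _ + 0]addr0 (gen_frame alpha y gg) -(uE y).
apply/colP => j; rewrite [LHS]mxE.
pose F (t : R) : R := gen alpha g (0 + t%:C%C * z) j 0.
have dF (t : R) : is_derive t 1 F
    (Re (lform (pi * dotC beta0 (t%:C%C * z)) (u (t%:C%C * z)) z j 0)).
  by have := is_ddir_line 0 t (D j); rewrite add0r.
have cF : continuous (fun t : R =>
    Re (lform (pi * dotC beta0 (t%:C%C * z)) (u (t%:C%C * z)) z j 0)).
  have [Y sY YE] : exists2 Y : C -> 'cV[R]_4, smoothV Y & forall y,
      Re (lform (pi * dotC beta0 y) (u y) z j 0) = Y y j 0.
    eexists; last first.
      move=> y; rewrite -(is_ddirE (D j y)).
      exact: is_ddirE (is_ddir_ofpq (is_ddirC_trig _ _ _ _ _ _) (is_ddirC_trig _ _ _ _ _ _) j).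
    by apply: smoothV_ofpq; exact: smoothC_trig.
  rewrite (_ : (fun t : R => _) = (fun t : R => Y (t%:C%C * z) j 0)); last first.
    by apply/funext => t; rewrite YE.
  have cY : cont2 (fun y => Y y j 0) := sY j 0%N.
  move=> t; apply: (@cont2_comp R (fun y => Y y j 0) _ (fun t : R => t%:C%C * z) _ cY).
    rewrite (_ : (fun t => _) = fun t : R => t * Re z).
      by apply: cvgM; [exact: cvg_id|exact: cvg_cst].
    by apply/funext => x; rewrite ReM /= mul0r subr0.
  rewrite (_ : (fun t => _) = fun t : R => t * Im z).
    by apply: cvgM; [exact: cvg_id|exact: cvg_cst].
  by apply/funext => x; rewrite ImM /= mul0r addr0.
rewrite -[LHS]/(int01 _) (int01_FTC cF (fun t _ => dF t)) /F [RHS]mxE [X in _ = _ + X]mxE.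
by rewrite !add0r rmorph1 mul1r rmorph0 mul0r.
Qed.

Lemma Agam_gen g z : good g -> Agam beta0 g z = gen 1 g z - gen 1 g 0.
Proof.
move=> gg; apply: primitive_gen => // y; rewrite /vgam /expw dotCNl mulrN; congr frame.
  by rewrite mul1r.
by rewrite conjc1 mulr1.
Qed.

Lemma Bgam_gen g z : good g -> Bgam beta0 g z = gen 'i%C g z - gen 'i%C g 0.
Proof.
move=> gg; apply: primitive_gen => // y; rewrite /wgam /expw dotCNl mulrN; congr frame.
congr (_ * _); rewrite conjCi.
transitivity (- ('i%C * 'i%C) * (2 * g^*%C / beta0)); last by ring.
by rewrite sqri; ring.
Qed.

Lemma AB_periodic g : good g ->
  lattice_periodic lat (Agam beta0 g) /\ lattice_periodic lat (Bgam beta0 g).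
Proof.
move=> gg; have sg : {in [:: g], forall g, good g} by move=> h; rewrite inE => /eqP ->.
have pg a := solX_periodic 1 (fun=> gen_amp a g) 0 0 sg.
by split => w z lw; rewrite ?Agam_gen ?Bgam_gen // /gen (pg _ w z lw).
Qed.

Section Span.
Variable V : lmodType R.
Variable S : set V.

Lemma span_gen v : S v -> linear_span S v.
Proof.
move=> Sv; exists 1%N, (fun=> 1), (fun=> v); split => //.
by rewrite big_ord1 scale1r.
Qed.

Lemma spanZ a v : linear_span S v -> linear_span S (a *: v).
Proof.
move=> [n [c [s [sS ->]]]]; exists n, (fun i => a * c i), s; split => //.
by rewrite scaler_sumr; apply: eq_bigr => i _; rewrite scalerA.
Qed.

Lemma spanD v v' : linear_span S v -> linear_span S v' -> linear_span S (v + v').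
Proof.
move=> [n [c [s [sS ->]]]] [n' [c' [s' [sS' ->]]]].
exists (n + n')%N, (fun i => match fintype.split i with inl j => c j | inr j => c' j end),
  (fun i => match fintype.split i with inl j => s j | inr j => s' j end); split.
  by move=> i; case: fintype.split.
rewrite big_split_ord /=; congr (_ + _); apply: eq_bigr => i _.
  by rewrite (fintype.unsplitK (inl i)).
by rewrite (fintype.unsplitK (inr i)).
Qed.

End Span.

Variable s : seq C.
Hypothesis sU : uniq s.
Hypothesis sE : forall g, (g \in s) <-> freqs lat beta0 g.

Let sg : {in s, forall g, good g}.
Proof. by move=> g /sE; rewrite freqsE. Qed.

Local Notation Sgen := (generators lat beta0).

Let span_cst (v : 'cV[R]_4) : linear_span Sgen (cst v).
Proof. by apply: span_gen; right; exists v. Qed.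

Lemma span_solX P T1 T2 : linear_span Sgen (solX beta0 s 1 P T1 T2).
Proof.
have : {subset s <= s} by [].
elim: {1 3}s => [|g r IH] rs.
  rewrite (_ : solX _ _ _ _ _ _ = cst (ofpq T1 T2)); first exact: span_cst.
  by apply/funext => z; rewrite /solX /solP /solQ /trig !big_nil !addr0.
have gs : g \in s by apply: rs; rewrite mem_head.
have gg := sg gs.
rewrite (_ : solX _ _ _ _ _ _ = solX beta0 [:: g] 1 P 0 0 + solX beta0 r 1 P T1 T2); last first.
  by apply/funext => z; rewrite solX_cat1.
apply: spanD; last by apply: IH => h hr; apply: rs; rewrite inE hr orbT.
pose al := P g * ('i%C * piC * (delta + g)^*%C).
have sA : linear_span Sgen (gen 1 g).
  rewrite (_ : gen 1 g = Agam beta0 g + cst (gen 1 g 0)).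
    by apply: spanD => //; apply: span_gen; left; left; exists g => //; apply/sE.
  apply/funext => z; transitivity (Agam beta0 g z + gen 1 g 0); last by [].
  by rewrite (Agam_gen z gg) subrK.
have sB : linear_span Sgen (gen 'i%C g).
  rewrite (_ : gen 'i%C g = Bgam beta0 g + cst (gen 'i%C g 0)).
    by apply: spanD => //; apply: span_gen; left; right; exists g => //; apply/sE.
  apply/funext => z; transitivity (Bgam beta0 g z + gen 'i%C g 0); last by [].
  by rewrite (Bgam_gen z gg) subrK.
rewrite (_ : solX _ _ _ _ _ _ = Re al *: gen 1 g + Im al *: gen 'i%C g).
  by apply: spanD; exact: spanZ.
apply/funext => z; transitivity (Re al *: gen 1 g z + Im al *: gen 'i%C g z); last by [].
have -> : Im al *: gen 'i%C g z = Im al *: gen 'i%C g z + solX beta0 [:: g] 1 (fun=> 0) 0 0 z.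
  rewrite -[LHS]addr0; congr (_ + _); apply: eq_cpq; rewrite ?cp_solX ?cq_solX /solP /solQ /trig !big_cons !big_nil;
  rewrite ?conjc0 ?mulr0 ?mul0r !addr0; by apply: eqC; rewrite /= ?mxE ?subrr ?addr0.
rewrite /gen solX_linear solX_linear /solX /solP /solQ /trig !big_cons !big_nil !mulr0 !addr0.
have n1 : (delta + g)^*%C != 0 by have [_ _ n1 _ _] := gg; rewrite conjc_eq0.
have -> : (Re al)%:C%C * gen_amp 1 g + ((Im al)%:C%C * gen_amp 'i%C g) = P g.
  rewrite /gen_amp mulrA mulrA -mulrDl mulr1 [_ * 'i%C]mulrC -complexE /al mulfK //.
  by rewrite mulf_neq0 // ipi_neq0.
by [].
Qed.

Lemma solX_mono r g P P' T1 T2 z : {in r, P =1 P'} ->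
  solX beta0 r g P T1 T2 z = solX beta0 r g P' T1 T2 z.
Proof.
move=> PP; rewrite /solX /solP /solQ /trig; congr (ofpq (_ + _) (_ + _));
  rewrite big_seq [RHS]big_seq; apply: eq_bigr => h hr; by rewrite PP.
Qed.

Lemma solX_of_gen a g z : g \in s -> gen a g z =
  solX beta0 s 1 (fun h => if h == g then gen_amp a g else 0) 0 0 z.
Proof.
move=> gs; rewrite /gen /solX /solP /solQ /trig !big_cons !big_nil !addr0.
rewrite !(bigD1_seq g) //= eqxx !big1 ?addr0 // => h /negbTE ->; by rewrite ?conjc0 ?mulr0 ?mul0r.
Qed.

Lemma solX_span X : linear_span Sgen X -> exists P T1 T2, X = solX beta0 s 1 P T1 T2.
Proof.
have cstX (v : 'cV[R]_4) : cst v = solX beta0 s 1 (fun=> 0) (cp v) (cq v).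
  apply/funext => z; rewrite /solX /solP /solQ /trig !big1 ?addr0 ?ofpqK // => g _.
    by rewrite conjc0 mulr0 mul0r.
  by rewrite mul0r.
have lin (c : R) Y Y' : (exists P T1 T2, Y = solX beta0 s 1 P T1 T2) ->
    (exists P T1 T2, Y' = solX beta0 s 1 P T1 T2) ->
    exists P T1 T2, c *: Y + Y' = solX beta0 s 1 P T1 T2.
  move=> [P [T1 [T2 ->]]] [P' [T1' [T2' ->]]]; do 3 eexists.
  by apply/funext => z; exact: solX_linear.
have one Y : Sgen Y -> exists P T1 T2, Y = solX beta0 s 1 P T1 T2.
  have shift a g : g \in s -> exists P T1 T2,
      (fun z => gen a g z - gen a g 0) = solX beta0 s 1 P T1 T2.
    move=> gs; rewrite (_ : (fun z => _) = 1 *: gen a g + cst (- gen a g 0)).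
      apply: lin; last by exists (fun=> 0), (cp (- gen a g 0)), (cq (- gen a g 0)).
      by do 3 eexists; apply/funext => z; exact: solX_of_gen.
    by apply/funext => z; rewrite scale1r.
  move=> [[[g /sE gs <-]|[g /sE gs <-]]|[T _ <-]]; last by do 3 eexists; exact: cstX.
    have [P [T1 [T2 e]]] := shift 1 g gs; exists P, T1, T2; rewrite -e.
    by apply/funext => z; exact: Agam_gen (sg gs).
  have [P [T1 [T2 e]]] := shift 'i%C g gs; exists P, T1, T2; rewrite -e.
  by apply/funext => z; exact: Bgam_gen (sg gs).
move=> [n [c [Y [SY ->]]]]; elim: n c Y SY => [|n IH] c Y SY.
  rewrite big_ord0; have [] := one (cst 0); first by right; exists 0.
  by move=> P [T1 [T2 e]]; exists P, T1, T2.
rewrite big_ord_recl; apply: lin; first exact: one.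
by apply: (IH (fun i => c (lift ord0 i)) (fun i => Y (lift ord0 i))) => i; exact: SY.
Qed.

(** e^{t Li} multiplies the amplitudes P by e^{it}; as the coefficients of cq are
    conjugate-linear in P, the phase mu turns by 2 t. *)
Lemma G2_orbit_solX X : G2_orbit (linear_span Sgen) X <->
  exists t P T1 T2, X = solX beta0 s (cis (2 * t)) P T1 T2.
Proof.
split=> [[t [Y [/solX_span[P [T1 [T2 ->]]] ->]]]|[t [P [T1 [T2 ->]]]]].
  by do 4 eexists; apply/funext => z; exact: solX_rot.
exists t, (solX beta0 s 1 (fun g => cis (- t) * P g) (cis (- t) * T1) (cis (- t) * T2)).
split; first exact: span_solX.
apply/funext => z; rewrite solX_rot !mulrA !cisKV !mul1r.
by apply: solX_mono => g _; rewrite mulrA cisKV mul1r.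
Qed.

Theorem solutions_solX X : solutions lat beta0 X <->
  exists t P T1 T2, X = solX beta0 s (cis (2 * t)) P T1 T2.
Proof.
split=> [[beta [hsl b0]]|[t [P [T1 [T2 ->]]]]].
  have [b db bE] := HSL_angle area0 hsl.
  have e : b = beta0 by rewrite -(b0 0) (beta0_affine _ bE).
  rewrite e in db bE.
  have h := HSL_solX area0 hsl db bE sU sE.
  exists (beta 0 / 2); rewrite (_ : 2 * (beta 0 / 2) = beta 0); last by field.
  by do 3 eexists; exact: h.
exists (fun z => 2 * t + 2 * pi * dotC beta0 z); split.
  exact: (solX_HSL dual_beta0 t P T1 T2 sg).
by move=> z; exact: (@beta0_affine R _ beta0 (2 * t)).
Qed.

End Generators.

(** * Lattices and their admissible frequencies *)

Section Lattice.
Variable R : realType.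
Local Notation C := R[i].
Implicit Types (z w g : C).

Lemma lattice_basis (Gamma : set C) : is_lattice Gamma ->
  exists w1 w2 : C, area w1 w2 != 0 /\ Gamma = lat w1 w2.
Proof.
move=> [w1 [w2 [indep ->]]]; exists w1, w2; split => //.
apply/eqP => a0.
have dep (s t : R) : s * Re w1 + t * Re w2 = 0 -> s * Im w1 + t * Im w2 = 0 -> s = 0 /\ t = 0.
  move=> e1 e2; apply: indep; apply: eqC; rewrite !ReImE /= !mul0r.
    by rewrite !subr0.
  by rewrite !addr0.
have [i2 i1] : Im w2 = 0 /\ - Im w1 = 0.
  by apply: dep; [rewrite -[RHS]a0 /area; ring|ring].
have [r2 r1] : Re w2 = 0 /\ - Re w1 = 0.
  by apply: dep; [ring|rewrite -[RHS]oppr0 -[in RHS]a0 /area; ring].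
have e1 : 1 * Re w1 + 0 * Re w2 = 0 by lra.
have e2 : 1 * Im w1 + 0 * Im w2 = 0 by lra.
by have [/eqP] := dep 1 0 e1 e2; rewrite oner_eq0.
Qed.

Lemma finite_ints (B : R) : finite_set [set m : int | `|m%:~R| <= B].
Proof.
pose N := (Num.truncn B).+1.
apply: (@sub_finite_set _ _ ((fun k : nat => k%:Z - N%:Z) @` `I_(2 * N).+1)); last first.
  by apply: finite_image; exact: finite_II.
move=> m /= mB.
have BN : B < N%:R by exact: truncnS_gt.
have mN : `|m%:~R| < N%:R :> R by exact: le_lt_trans BN.
have : `|m| < N%:Z by rewrite -(ltr_int R) intr_norm -pmulrn.
rewrite ltr_norml => /andP[m1 m2].
exists (absz (m + N%:Z)); first by rewrite /=; lia.
by lia.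
Qed.

Variables w1 w2 : C.
Hypothesis area0 : area w1 w2 != 0.

Lemma dual_expand z : z = (dotC z w1)%:C%C * dual1 w1 w2 + (dotC z w2)%:C%C * dual2 w1 w2.
Proof.
have a0 := area0; apply: eqC; rewrite /dotC !ReImE /= !mul0r ?subr0 ?addr0;
  by move: a0; rewrite /area => a0; field.
Qed.

(** The coordinates of delta + g in the dual basis are integers, bounded since |g| = |delta|. *)
Lemma finite_freqs (beta0 : C) : dual12 w1 w2 beta0 -> finite_set (freqs (lat w1 w2) beta0).
Proof.
move=> db; pose d := beta0 / 2; pose D := Re d ^+ 2 + Im d ^+ 2 + 1.
pose B w := (`|Re d| + D) * `|Re w| + (`|Im d| + D) * `|Im w|.
pose F w := [set m : int | `|m%:~R| <= B w].
apply: (@sub_finite_set _ _ ((fun p : int * int => p.1%:~R * dual1 w1 w2 + p.2%:~R * dual2 w1 w2 - d) @`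
    (F w1 `*` F w2))); last first.
  by apply: finite_image; apply: finite_setX; exact: finite_ints.
move=> g /(freqsE db) [[[m mE] [n nE]] _ _ _ gd].
have gD : Re g ^+ 2 + Im g ^+ 2 = Re d ^+ 2 + Im d ^+ 2.
  by have := congr1 Re gd; rewrite !ReImE -/d; lra.
have abs_le (x y : R) : x ^+ 2 + y ^+ 2 = Re d ^+ 2 + Im d ^+ 2 -> `|x| <= D.
  move=> e; have x2 : `|x| ^+ 2 + y ^+ 2 + 1 = D by rewrite real_normK ?num_real // e.
  by have := sqr_ge0 (`|x| - 2^-1); have := sqr_ge0 y; have := normr_ge0 x; rewrite -x2; nra.
have gr : `|Re g| <= D by exact: abs_le gD.
have gi : `|Im g| <= D by apply: (abs_le _ (Re g)); rewrite addrC.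
have bnd w (k : int) : dotC (d + g) w = k%:~R -> F w k.
  move=> kE; rewrite /F /= -kE /dotC ReD ImD.
  have h1 : `|Re d + Re g| <= `|Re d| + D by rewrite (le_trans (ler_normD _ _)) // lerD2l.
  have h2 : `|Im d + Im g| <= `|Im d| + D by rewrite (le_trans (ler_normD _ _)) // lerD2l.
  apply: le_trans (ler_normD _ _) _; rewrite !normrM /B.
  exact: (lerD (ler_wpM2r (normr_ge0 _) h1) (ler_wpM2r (normr_ge0 _) h2)).
exists (m, n); first by split; [exact: bnd mE|exact: bnd nE].
by rewrite /= -!(rmorph_int (real_complex R)) -mE -nE -dual_expand addrC addKr.
Qed.

End Lattice.

(** * Continuity in the topology of uniform convergence *)

Section UniformTopology.
Variable R : realType.
Local Notation C := R[i].
Implicit Types (S : set (C -> 'cV[R]_4)).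

(** Neighbourhoods of the uniform topology, in terms of the matrix entries. *)
Lemma nbhs_maps S (X : maps_space S) (B : set (maps_space S)) : nbhs X B <->
  exists2 e : R, 0 < e & forall Y : maps_space S,
    (forall z j, `|set_val X z j 0 - set_val Y z j 0| < e) -> B Y.
Proof.
split=> [|[e e0 eB]].
  rewrite nbhsE => -[U [[W oW WU] UX] UB].
  have WX : nbhs (set_val X : {uniform C -> 'cV[R]_4}) W.
    by apply: open_nbhs_nbhs; split => //; move: UX; rewrite -WU.
  move/uniform_nbhs : WX => [E [entE EW]].
  have [e e0 eE] : exists2 e : R, 0 < e &
      [set xy | ball xy.1 e xy.2] `<=` (E : set ('cV[R]_4 * 'cV[R]_4)).
    by move: entE; rewrite -entourage_ballE => -[e /= e0 eE]; exists e.
  exists e => // Y XY; apply: UB; rewrite -WU; apply: EW => z _.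
  apply: (eE (set_val X z, set_val Y z)) => /=; split => // i j.
  by rewrite ord1; exact: XY.
have cX : nbhs (set_val X : {uniform C -> 'cV[R]_4})
    [set g | forall z, ball (set_val X z) e (g z)].
  apply/uniform_nbhs; exists [set xy | ball xy.1 e xy.2]; split.
    by rewrite -entourage_ballE; exists e.
  by move=> g /= gX z; exact: gX.
move: cX; rewrite nbhsE => -[W [oW WX] Wsub].
exists (set_val @^-1` W).
  by split => //; exists W.
move=> Y /= /Wsub XY; apply: eB => z j.
have [_ XYz] := XY z; exact: (XYz j 0).
Qed.

Section Functions.
Variable T : topologicalType.
Implicit Types (x : T) (u v : T -> C).

Definition contC x u := {for x, continuous (fun y => Re (u y))} /\
  {for x, continuous (fun y => Im (u y))}.

Lemma contC_cst x (c : C) : contC x (fun=> c).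
Proof. by split; exact: cvg_cst. Qed.

Lemma contCD x u v : contC x u -> contC x v -> contC x (fun y => u y + v y).
Proof.
move=> [ur ui] [vr vi]; split.
  by rewrite (_ : (fun y => _) = fun y => Re (u y) + Re (v y));
    [exact: cvgD|apply/funext => y; rewrite ReD].
by rewrite (_ : (fun y => _) = fun y => Im (u y) + Im (v y));
  [exact: cvgD|apply/funext => y; rewrite ImD].
Qed.

Lemma contCM x u v : contC x u -> contC x v -> contC x (fun y => u y * v y).
Proof.
move=> [ur ui] [vr vi]; split.
  rewrite (_ : (fun y => _) = fun y => Re (u y) * Re (v y) - Im (u y) * Im (v y)).
    by apply: cvgB; exact: cvgM.
  by apply/funext => y; rewrite ReM.
rewrite (_ : (fun y => _) = fun y => Re (u y) * Im (v y) + Im (u y) * Re (v y)).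
  by apply: cvgD; exact: cvgM.
by apply/funext => y; rewrite ImM.
Qed.

Lemma contCJ x u : contC x u -> contC x (fun y => (u y)^*%C).
Proof.
move=> [ur ui]; split.
  by rewrite (_ : (fun y => _) = fun y => Re (u y)); [|apply/funext => y; rewrite ReJ].
rewrite (_ : (fun y => _) = fun y => - Im (u y)); first exact: cvgN.
by apply/funext => y; rewrite ImJ.
Qed.

Lemma contC_real x (r : T -> R) : {for x, continuous r} -> contC x (fun y => (r y)%:C%C).
Proof. by move=> cr; split => //; exact: cvg_cst. Qed.

(** A real-valued norm on C that fits continuity of the real and imaginary parts. *)
Definition norm1 (z : C) : R := `|Re z| + `|Im z|.

Lemma norm1D z w : norm1 (z + w) <= norm1 z + norm1 w.
Proof.
rewrite /norm1 ReD ImD; have := ler_normD (Re z) (Re w); have := ler_normD (Im z) (Im w); lra.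
Qed.

Lemma norm1_expw z g w : norm1 (z * expw g w) <= 2 * norm1 z.
Proof.
rewrite /norm1 ReM ImM ReexpwE ImexpwE.
have w1 (c : R) : `|wave g c w| <= 1 by exact: cos_max.
have m (a c : R) : `|a * wave g c w| <= `|a| by rewrite normrM ler_piMr.
have := ler_normB (Re z * wave g 0 w) (Im z * wave g (- (pi / 2)) w).
have := ler_normD (Re z * wave g (- (pi / 2)) w) (Im z * wave g 0 w).
have := m (Re z) 0; have := m (Im z) 0; have := m (Re z) (- (pi / 2)); have := m (Im z) (- (pi / 2)).
move: (wave g 0 w) (wave g _ w) => a b; lra.
Qed.

Lemma cvg_norm1 x u : contC x u -> norm1 (u y - u x) @[y --> x] --> (0 : R).
Proof.
move=> cu; have [cr ci] := contCD cu (contC_cst x (- u x)).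
rewrite [X in _ --> X](_ : 0 = norm1 (u x - u x)); last by rewrite subrr /norm1 normr0 addr0.
by apply: cvgD; apply: (cvg_norm (V := R^o)).
Qed.

Lemma norm1_sum (I : Type) (s : seq I) (F : I -> C) :
  norm1 (\sum_(i <- s) F i) <= \sum_(i <- s) norm1 (F i).
Proof.
elim: s => [|i s IH]; first by rewrite !big_nil /norm1 normr0 addr0.
by rewrite !big_cons; apply: le_trans (norm1D _ _) _; rewrite lerD2l.
Qed.

Lemma trig_uniform (s : seq C) (k : C -> C) (c : T -> C -> C) (a : T -> C) x :
  (forall g, contC x (c^~ g)) -> contC x a -> forall e : R, 0 < e ->
  \forall y \near x, forall z, norm1 (trig s k (c y) (a y) z - trig s k (c x) (a x) z) < e.
Proof.
move=> cc ca e e0.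
pose D y := norm1 (a y - a x) + \sum_(g <- s) 2 * norm1 (c y g - c x g).
have D0 : D y @[y --> x] --> (0 : R).
  rewrite -(addr0 0); apply: cvgD; first exact: cvg_norm1.
  rewrite [X in _ --> X](_ : 0 = \sum_(g <- s) 2 * 0 :> R); last by rewrite big1 // => g _; rewrite mulr0.
  elim: s {D} => [|g s IH].
    rewrite big_nil (_ : (fun y => _) = fun=> 0); first exact: cvg_cst.
    by apply/funext => y; rewrite big_nil.
  rewrite big_cons (_ : (fun y => _) = fun y => 2 * norm1 (c y g - c x g) +
    \sum_(j <- s) 2 * norm1 (c y j - c x j)); last by apply/funext => y; rewrite big_cons.
  apply: cvgD => //; apply: cvgM; first exact: cvg_cst.
  exact: cvg_norm1.
near=> y => z; have Dy : `|D y| < e by near: y; exact: (cvgr0_norm_lt _ D0).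
apply: le_lt_trans (le_lt_trans (ler_norm _) Dy).
rewrite /trig opprD addrACA; apply: le_trans (norm1D _ _) _; rewrite lerD2l.
rewrite -sumrB; apply: le_trans (norm1_sum _ _) _; apply: ler_sum => g _.
by rewrite -mulrBl; exact: norm1_expw.
Unshelve. all: by end_near. Qed.

Lemma norm1_ofpq (p q p' q' : C) j :
  `|ofpq p q j 0 - ofpq p' q' j 0| <= norm1 (p - p') + norm1 (q - q').
Proof.
have [a0 a1 a2 a3] := ofpqE p q; have [b0 b1 b2 b3] := ofpqE p' q'.
have h (a b c d : R) : `|2^-1 * a + 2^-1 * b| <= `|a| + `|c| + (`|b| + `|d|).
  have := ler_normD (2^-1 * a) (2^-1 * b); rewrite !normrM ger0_norm //.
  have := normr_ge0 a; have := normr_ge0 b; have := normr_ge0 c; have := normr_ge0 d; lra.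
move: j; apply: forall_ord4; rewrite ?a0 ?a1 ?a2 ?a3 ?b0 ?b1 ?b2 ?b3 /norm1 !ReD !ImD !ReN !ImN.
- rewrite [X in `|X| <= _](_ : _ = 2^-1 * (Re p - Re p') + 2^-1 * (Re q - Re q')) ; last ring.
  exact: h.
- rewrite [X in `|X| <= _](_ : _ = 2^-1 * (Im p - Im p') + 2^-1 * (Im q - Im q')) ; last ring.
  by rewrite [X in _ <= X + _]addrC [X in _ <= _ + X]addrC; exact: h.
- rewrite [X in `|X| <= _](_ : _ = 2^-1 * (Im p - Im p') + 2^-1 * (- (Im q - Im q'))) ; last ring.
  rewrite [X in _ <= X + _]addrC [X in _ <= _ + X]addrC -(normrN (Im q - Im q')); exact: h.
- rewrite [X in `|X| <= _](_ : _ = 2^-1 * (- (Re p - Re p')) + 2^-1 * (Re q - Re q')) ; last ring.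
  rewrite -(normrN (Re p - Re p')); exact: h.
Qed.

(** As characters have modulus 1, the distance of two trigonometric sums is bounded
    on the whole plane by the distances of their coefficients. *)
Lemma solX_uniform beta0 (s : seq C) (mu : T -> C) (P : T -> C -> C) (T1 T2 : T -> C) x :
  contC x mu -> (forall g, contC x (P^~ g)) -> contC x T1 -> contC x T2 ->
  forall e : R, 0 < e -> \forall y \near x, forall z j,
  `|solX beta0 s (mu x) (P x) (T1 x) (T2 x) z j 0 -
    solX beta0 s (mu y) (P y) (T1 y) (T2 y) z j 0| < e.
Proof.
move=> cmu cP c1 c2 e e0; have e2 : 0 < e / 2 by rewrite divr_gt0.
have n1 := @trig_uniform s (fun g => beta0 / 2 + g) P T1 x cP c1 _ e2.
pose Q y g := - mu y * ((beta0 / 2 + g) / (beta0 / 2 - g)) * (P y g)^*%C.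
have cQ g : contC x (Q^~ g).
  apply: contCM; last by apply: contCJ; exact: cP.
  apply: contCM; last exact: contC_cst.
  rewrite (_ : (fun y => _) = fun y => -1 * mu y); last by apply/funext => y; rewrite mulN1r.
  exact: (contCM (contC_cst x (-1)) cmu).
have n2 := @trig_uniform s (fun g => beta0 / 2 - g) Q T2 x cQ c2 _ e2.
apply: filterS2 n1 n2 => y h1 h2 z j.
rewrite distrC; apply: le_lt_trans (norm1_ofpq _ _ _ _ _) _.
rewrite [ltRHS]splitr; apply: ltrD; [exact: h1|exact: h2].
Qed.

End Functions.
End UniformTopology.

(** * Charts *)

Section Charts.
Variable R : realType.
Local Notation C := R[i].

(** C^m x R is identified with R^(2 m + 1); a point of C^m is a function on nat, read
    below m only, so that coordinates can be indexed by positions in a list. *)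
Definition rowC m (c : nat -> C) (r : R) : 'rV[R]_(m.*2.+1) :=
  \row_i (if (i < m.*2)%N then (if odd i then Im (c i./2) else Re (c i./2)) else r).
Definition getC m (x : 'rV[R]_(m.*2.+1)) (j : nat) : C :=
  (x 0 (inord j.*2) +i* x 0 (inord j.*2.+1))%C.
Definition getR m (x : 'rV[R]_(m.*2.+1)) : R := x 0 (inord m.*2).

Lemma getC_rowC m c r j : (j < m)%N -> getC (rowC m c r) j = c j.
Proof.
move=> jm; have j1 : (j.*2 < m.*2)%N by rewrite ltn_double.
have j2 : (j.*2.+1 < m.*2)%N by rewrite -doubleS leq_double in jm *; lia.
by apply: eqC; rewrite /= !mxE inordK ?j1 ?j2 /= ?odd_double /= ?doubleK ?uphalf_double //; lia.
Qed.

Lemma getR_rowC m c r : getR (rowC m c r) = r.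
Proof. by rewrite /getR mxE inordK // ltnn. Qed.

Lemma rowC_get m (x : 'rV[R]_(m.*2.+1)) : rowC m (getC x) (getR x) = x.
Proof.
apply/rowP => i; rewrite mxE; have iE := odd_double_half i.
case: ltnP => im.
  case: (boolP (odd i)) iE => oi /= iE; congr (x 0 _); apply: val_inj; rewrite /= inordK; lia.
congr (x 0 _); apply: val_inj; rewrite /= inordK; have := ltn_ord i; lia.
Qed.

Lemma getC_cont m j (x : 'rV[R]_(m.*2.+1)) : contC x (fun x => getC x j).
Proof. by split; exact: coord_continuous. Qed.
Lemma getR_cont m (x : 'rV[R]_(m.*2.+1)) : {for x, continuous (@getR m)}.
Proof. exact: coord_continuous. Qed.

Lemma rowC_cont (T : topologicalType) m (c : nat -> T -> C) (r : T -> R) X :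
  (forall j, (j < m)%N -> contC X (c j)) -> {for X, continuous r} ->
  {for X, continuous (fun X => rowC m (c^~ X) (r X))}.
Proof.
move=> cc cr; apply/cvg_ballP => e e0.
have cE (i : 'I_m.*2.+1) : \forall Y \near X,
    `|rowC m (c^~ X) (r X) 0 i - rowC m (c^~ Y) (r Y) 0 i| < e.
  have cont (F : T -> R) : {for X, continuous F} -> \forall Y \near X, `|F X - F Y| < e.
    by move=> cF; move/cvgrPdist_lt : cF; apply.
  have := cont (fun Y => rowC m (c^~ Y) (r Y) 0 i); apply.
  rewrite (_ : (fun Y => _) = fun Y => if (i < m.*2)%N then
      (if odd i then Im (c i./2 Y) else Re (c i./2 Y)) else r Y); last first.
    by apply/funext => Y; rewrite mxE.
  case: ltnP => im //; have im2 : (i./2 < m)%N by lia.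
  by have [cR cI] := cc _ im2; case: odd.
have cA : \forall Y \near X, forall i,
    `|rowC m (c^~ X) (r X) 0 i - rowC m (c^~ Y) (r Y) 0 i| < e by exact: filter_forall.
by apply: filterS cA => Y h; split => // i j; rewrite ord1; exact: h.
Qed.

Lemma has_dimension_chart (T : topologicalType) m (O : set T) (c : nat -> T -> C) (r : T -> R)
    (G : (nat -> C) -> R -> T) (W : set 'rV[R]_(m.*2.+1)) :
  open O -> dense O -> open W ->
  (forall X, O X -> (forall j, (j < m)%N -> contC X (c j)) /\ {for X, continuous r}) ->
  (forall x, W x -> {for x, continuous (fun x => G (getC x) (getR x))}) ->
  (forall X, O X -> W (rowC m (c^~ X) (r X)) /\ G (getC (rowC m (c^~ X) (r X))) (r X) = X) ->
  (forall x, W x -> O (G (getC x) (getR x)) /\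
    ((forall j, (j < m)%N -> c j (G (getC x) (getR x)) = getC x j) /\
     r (G (getC x) (getR x)) = getR x)) ->
  has_dimension R T m.*2.+1.
Proof.
move=> oO dO oW cO cG FG GF; exists O; split => // X OX.
exists O, W, (fun X => rowC m (c^~ X) (r X)), (fun x => G (getC x) (getR x)); split => //.
split.
- by move=> Y /FG; rewrite getR_rowC.
- move=> x Wx; have [Ox [cx rx]] := GF x Wx; split => //.
  rewrite -[RHS]rowC_get rx; apply/rowP => i; rewrite !mxE; case: ltnP => // im.
  by rewrite cx //; lia.
- rewrite continuous_open_subspace // => Y; rewrite inE => /cO[cY rY].
  exact: rowC_cont.
- by rewrite continuous_open_subspace // => x; rewrite inE => /cG.
Qed.

End Charts.

(** * Fourier coefficients as functions on the space of solutions *)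

Section Coefficients.
Variable R : realType.
Local Notation C := R[i].
Variables w1 w2 : C.
Hypothesis area0 : area w1 w2 != 0.
Local Notation dual12 := (dual12 w1 w2).
Local Notation lat := (lat w1 w2).
Local Notation coef := (coef w1 w2).
Local Notation CPC := (CPC w1 w2).

Lemma contC_norm1 (T : topologicalType) (x : T) (u : T -> C) :
  (forall e : R, 0 < e -> nbhs x [set y | norm1 (u x - u y) < e]) -> contC x u.
Proof.
move=> n; split; apply/cvgrPdist_lt => e /n; apply: filterS => y; apply: le_lt_trans.
  by rewrite /norm1 ReD ReN lerDl.
by rewrite /norm1 ImD ImN lerDr.
Qed.

Lemma norm1_meanC (F : C -> C) : norm1 (meanC w1 w2 F) =
  `|mean w1 w2 (fun z => Re (F z))| + `|mean w1 w2 (fun z => Im (F z))|.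
Proof. by []. Qed.

(** The mean is bounded by the supremum, and characters have modulus 1. *)
Lemma coef_close (f f' : C -> C) (eta : C) (e : R) : CPC f -> CPC f' -> dual12 eta ->
  (forall z, norm1 (f z - f' z) <= e) -> norm1 (coef f eta - coef f' eta) <= 4 * e.
Proof.
move=> cf cf' de ff'.
have cNf' : CPC (fun z => -1 * f' z) by exact: CPCZ.
have -> : coef f eta - coef f' eta = coef (fun z => f z + -1 * f' z) eta.
  by rewrite (coefD area0 cf cNf' de) (coefZ area0 (-1) cf' de) mulN1r.
have [cr ci] := CPC_coef (CPCD cf cNf') de.
have b z : norm1 ((f z + -1 * f' z) * expw (- eta) z) <= 2 * e.
  by apply: le_trans (norm1_expw _ _ _) _; rewrite ler_pM2l // mulN1r.
have h1 : `|mean w1 w2 (fun z => Re ((f z + -1 * f' z) * expw (- eta) z))| <= 2 * e.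
  by apply: (norm_mean_le area0 cr) => z; apply: le_trans (b z); rewrite /norm1 lerDl.
have h2 : `|mean w1 w2 (fun z => Im ((f z + -1 * f' z) * expw (- eta) z))| <= 2 * e.
  by apply: (norm_mean_le area0 ci) => z; apply: le_trans (b z); rewrite /norm1 lerDr.
have le4 (x y : R) : x <= 2 * e -> y <= 2 * e -> x + y <= 4 * e by lra.
rewrite /coef norm1_meanC; exact: (le4 _ _ h1 h2).
Qed.

Definition cfp (X : C -> 'cV[R]_4) (eta : C) := coef (fun z => cp (X z)) eta.
Definition cfq (X : C -> 'cV[R]_4) (eta : C) := coef (fun z => cq (X z)) eta.

Lemma norm1_cpq (x y : 'cV[R]_4) (e : R) : (forall j, `|x j 0 - y j 0| < e) ->
  norm1 (cp x - cp y) <= 4 * e /\ norm1 (cq x - cq y) <= 4 * e.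
Proof.
move=> h; have b (a b c d : R) : `|a - c| < e -> `|b - d| < e ->
    `|a + b - (c + d)| <= 2 * e /\ `|a - b - (c - d)| <= 2 * e.
  rewrite !ltr_norml !ler_norml => /andP[? ?] /andP[? ?].
  by split; apply/andP; split; lra.
have [b1 b2] := b _ _ _ _ (h 0) (h 3); have [b3 b4] := b _ _ _ _ (h 1) (h 2).
by rewrite /norm1 !ReD !ImD !ReN !ImN /=; split; lra.
Qed.

Variable beta0 : C.
Hypothesis dual_beta0 : dual12 beta0.
Local Notation delta := (beta0 / 2).
Variable s : seq C.
Hypothesis sU : uniq s.
Hypothesis sE : forall g, (g \in s) <-> freqs lat beta0 g.
Local Notation S := (solutions lat beta0).

Lemma s_good g : g \in s -> good w1 w2 beta0 g.
Proof. by move=> /sE; rewrite freqsE. Qed.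

Let dP : {in s, forall g, dual12 (delta + g)}. Proof. by move=> g /s_good[]. Qed.
Let dQ : {in s, forall g, dual12 (delta - g)}. Proof. by move=> g /s_good[]. Qed.

Lemma CPC_solution X : S X -> CPC (fun z => cp (X z)) /\ CPC (fun z => cq (X z)).
Proof.
move=> /(solutions_solX area0 dual_beta0 sU sE)[t [P [T1 [T2 ->]]]]; split.
  rewrite (_ : (fun z => _) = solP beta0 s P T1); first exact: CPC_trig.
  by apply/funext => z; exact: cp_solX.
rewrite (_ : (fun z => _) = solQ beta0 s (cis (2 * t)) P T2); first exact: CPC_trig.
by apply/funext => z; exact: cq_solX.
Qed.

Lemma cf_continuous eta (X : maps_space S) : dual12 eta ->
  contC X (fun Y => cfp (set_val Y) eta) /\ contC X (fun Y => cfq (set_val Y) eta).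
Proof.
move=> de.
have main (phi : (C -> 'cV[R]_4) -> C) :
    (forall Y (e : R), S Y -> (forall z j, `|set_val X z j 0 - Y z j 0| < e) ->
      norm1 (phi (set_val X) - phi Y) <= 4 * (4 * e)) ->
    contC X (fun Y : maps_space S => phi (set_val Y)).
  move=> h.
  have n (Y : maps_space S) (e : R) : 0 < e -> (forall z j,
      `|set_val X z j 0 - set_val Y z j 0| < e / 32) -> norm1 (phi (set_val X) - phi (set_val Y)) < e.
    by move=> e0 XY; apply: le_lt_trans (h _ _ (set_valP Y) XY) _; lra.
  apply: contC_norm1 => e e0; apply/nbhs_maps; exists (e / 32); first by rewrite divr_gt0.
  by move=> Y; exact: n.
have [cX1 cX2] := CPC_solution (set_valP X).
split; [apply: (main (cfp^~ eta))|apply: (main (cfq^~ eta))] => Y e SY XY;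
  have [cY1 cY2] := CPC_solution SY.
  by apply: (coef_close cX1 cY1 de) => z; have [] := norm1_cpq (XY z).
by apply: (coef_close cX2 cY2 de) => z; have [] := norm1_cpq (XY z).
Qed.

Section CoefSolX.
Variables (mu : C) (P : C -> C) (T1 T2 : C).
Local Notation X := (solX beta0 s mu P T1 T2).

Let pE : (fun z => cp (X z)) = solP beta0 s P T1.
Proof. by apply/funext => z; exact: cp_solX. Qed.
Let qE : (fun z => cq (X z)) = solQ beta0 s mu P T2.
Proof. by apply/funext => z; exact: cq_solX. Qed.

Lemma cfp_solX g : g \in s -> cfp X (delta + g) = P g.
Proof.
move=> gs; have [_ _ n1 _ _] := s_good gs.
rewrite /cfp pE (coef_trig area0 _ _ dP (dP gs)) (negbTE n1) mulr0 add0r.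
rewrite (bigD1_seq g) //= eqxx mulr1 big1 ?addr0 // => h hg.
by rewrite (can_eq (addKr _)) (negbTE hg) mulr0.
Qed.

Lemma cfp0_solX : cfp X 0 = T1.
Proof.
rewrite /cfp pE (coef_trig area0 _ _ dP (dual120 _ _)) eqxx mulr1 big_seq big1 ?addr0 // => g gs.
by have [_ _ n1 _ _] := s_good gs; rewrite (negbTE n1) mulr0.
Qed.

Lemma cfq_solX g : g \in s ->
  cfq X (delta - g) = - mu * ((delta + g) / (delta - g)) * (P g)^*%C.
Proof.
move=> gs; have [_ _ _ n1 _] := s_good gs.
rewrite /cfq qE (coef_trig area0 _ _ dQ (dQ gs)) (negbTE n1) mulr0 add0r.
rewrite (bigD1_seq g) //= eqxx mulr1 big1 ?addr0 // => h hg.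
by rewrite (can_eq (addKr _)) eqr_opp (negbTE hg) mulr0.
Qed.

Lemma cfq0_solX : cfq X 0 = T2.
Proof.
rewrite /cfq qE (coef_trig area0 _ _ dQ (dual120 _ _)) eqxx mulr1 big_seq big1 ?addr0 // => g gs.
by have [_ _ _ n1 _] := s_good gs; rewrite (negbTE n1) mulr0.
Qed.

End CoefSolX.

Lemma solution_coef X : S X ->
  exists t, X = solX beta0 s (cis (2 * t)) (fun g => cfp X (delta + g)) (cfp X 0) (cfq X 0).
Proof.
move=> /(solutions_solX area0 dual_beta0 sU sE)[t [P [T1 [T2 XE]]]]; exists t.
rewrite [LHS]XE; apply/funext => z.
rewrite {2 3}XE cfp0_solX cfq0_solX; apply: solX_mono => g gs.
by rewrite XE cfp_solX.
Qed.

End Coefficients.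

(** * The dimension of the space of solutions *)

Section DimensionOfSolutions.
Variable R : realType.
Local Notation C := R[i].

(** e^{2it} depends only on tan t, because equal tangents make sin (t - u) vanish. *)
Lemma cis_tan (t u : R) : cos t != 0 -> cos u != 0 -> tan t = tan u -> cis (2 * t) = cis (2 * u).
Proof.
move=> ct cu; rewrite /tan => /eqP; rewrite eqr_div // => /eqP e.
have s0 : sin (t - u) = 0 by rewrite sinB e; ring.
have c1 : cis (2 * (t - u)) = 1.
  rewrite cis_double; apply: eqC; rewrite ?ReM ?ImM /= s0; last by ring.
  have := cos2Dsin2 (t - u); rewrite s0 => <-; ring.
by rewrite (_ : 2 * t = 2 * (t - u) + 2 * u); [rewrite cisD c1 mul1r|ring].
Qed.

Lemma cos_atan_neq0 (x : R) : cos (atan x) != 0.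
Proof. by rewrite gt_eqF // cos_gt0_pihalf // atan_gtNpi2 atan_ltpi2. Qed.

Lemma contC_cis (T : topologicalType) (x : T) (f : T -> R) :
  {for x, continuous f} -> contC x (fun y => cis (f y)).
Proof.
move=> cf; split; apply: continuous_comp => //.
  exact: continuous_cos.
exact: continuous_sin.
Qed.

Lemma open_neq0 (T : topologicalType) (f : T -> R) : continuous f -> open [set x | f x != 0].
Proof.
move=> cf; apply: (@open_comp _ _ f [set y | y != 0]); last exact: open_neq.
by move=> x _; exact: cf.
Qed.

Definition sqn (z : C) : R := Re z ^+ 2 + Im z ^+ 2.

Lemma sqn_eq0 z : (sqn z == 0) = (z == 0).
Proof. by rewrite paddr_eq0 ?sqr_ge0 // !sqrf_eq0 eq_complex. Qed.

Lemma sqnE z : z * z^*%C = (sqn z)%:C%C.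
Proof. by apply: eqC; rewrite /sqn !ReImE /=; ring. Qed.

Lemma cont_sqn (T : topologicalType) (x : T) (u : T -> C) : contC x u ->
  {for x, continuous (fun y => sqn (u y))}.
Proof. by move=> [cr ci]; apply: cvgD; exact: cvgM. Qed.

Variables w1 w2 : C.
Hypothesis area0 : area w1 w2 != 0.
Local Notation dual12 := (dual12 w1 w2).
Local Notation lat := (lat w1 w2).
Local Notation cfp := (cfp w1 w2).
Local Notation cfq := (cfq w1 w2).
Variable beta0 : C.
Hypothesis dual_beta0 : dual12 beta0.
Local Notation delta := (beta0 / 2).
Variable s : seq C.
Hypothesis sU : uniq s.
Hypothesis sE : forall g, (g \in s) <-> freqs lat beta0 g.
Local Notation S := (solutions lat beta0).

Lemma S_solX t P T1 T2 : S (solX beta0 s (cis (2 * t)) P T1 T2).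
Proof. by apply/(solutions_solX area0 dual_beta0 sU sE); exists t, P, T1, T2. Qed.

Definition solS t P T1 T2 : maps_space S :=
  exist (fun X => X \in (S : set {uniform C -> 'cV[R]_4})) _ (mem_set (S_solX t P T1 T2)).

Variable g0 : C.
Hypothesis g0s : g0 \in s.

Let g0_good : good w1 w2 beta0 g0. Proof. refine (s_good dual_beta0 sE g0s). Qed.

(** For X = solX mu P T1 T2 this is mu |P g0|^2, continuous in X; since
    tan (arg mu / 2) = Im mu / (1 + Re mu), the phase can be recovered as the quotient
    of its imaginary part by denom X, where denom X does not vanish. *)
Definition mu_sqn X : C := - ((delta - g0) / (delta + g0)) * cfq X (delta - g0) * cfp X (delta + g0).
Definition denom X : R := sqn (cfp X (delta + g0)) + Re (mu_sqn X).

Lemma mu_sqn_solX mu P T1 T2 : mu_sqn (solX beta0 s mu P T1 T2) = mu * (sqn (P g0))%:C%C.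
Proof.
have [_ _ n1 n2 _] := g0_good; rewrite /mu_sqn cfp_solX // cfq_solX // -sqnE.
move: (delta + g0) (delta - g0) n1 n2 => a b a0 b0.
by field; rewrite a0 b0.
Qed.

Lemma denom_solX t P T1 T2 :
  denom (solX beta0 s (cis (2 * t)) P T1 T2) = 2 * cos t ^+ 2 * sqn (P g0).
Proof.
rewrite /denom mu_sqn_solX cfp_solX // cis_double !ReM /=.
have := cos2Dsin2 t; move: (cos t) (sin t) (sqn _) => a b n ab.
have -> : a * a - b * b = 2 * a ^+ 2 - (a ^+ 2 + b ^+ 2) by ring.
by rewrite ab; ring.
Qed.

Lemma Im_mu_sqn t P T1 T2 :
  Im (mu_sqn (solX beta0 s (cis (2 * t)) P T1 T2)) = 2 * (cos t * sin t) * sqn (P g0).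
Proof. by rewrite mu_sqn_solX cis_double !ImM !ReM /=; ring. Qed.

Lemma mu_sqn_cont (X : maps_space S) : contC X (fun Y => mu_sqn (set_val Y)).
Proof.
have [d1 d2 _ _ _] := g0_good.
have [c1 _] := cf_continuous area0 dual_beta0 sU sE X d1.
have [_ c2] := cf_continuous area0 dual_beta0 sU sE X d2.
exact: (contCM (contCM (contC_cst X _) c2) c1).
Qed.

Lemma denom_cont (X : maps_space S) :
  {for X, continuous (fun Y : maps_space S => denom (set_val Y))}.
Proof.
have [d1 d2 _ _ _] := g0_good.
have [c1 _] := cf_continuous area0 dual_beta0 sU sE X d1.
have cs := cont_sqn c1; have [cr _] := mu_sqn_cont X.
exact: (cvgD cs cr).
Qed.

Lemma solS_cont (T : topologicalType) (x : T) (t : T -> R) (P : T -> C -> C) (T1 T2 : T -> C) :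
  {for x, continuous t} -> (forall g, contC x (P^~ g)) -> contC x T1 -> contC x T2 ->
  {for x, continuous (fun y => solS (t y) (P y) (T1 y) (T2 y))}.
Proof.
move=> ct cP c1 c2 B /nbhs_maps[e e0 eB].
have cmu : contC x (fun y => cis (2 * t y)).
  by apply: contC_cis; apply: cvgM => //; exact: cvg_cst.
by apply: filterS (@solX_uniform R T beta0 s _ P T1 T2 x cmu cP c1 c2 e e0) => y h; exact: eB.
Qed.

(** If cos t or P g0 vanishes at a solution, it is made nonzero by moving t, respectively
    the amplitude of g0, by an arbitrarily small tau. *)
Lemma dense_denom : dense [set X : maps_space S | denom (set_val X) != 0].
Proof.
move=> B [X BX] oB.
have [t [P [T1 [T2 XE]]]] := (solutions_solX area0 dual_beta0 sU sE _).1 (set_valP X).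
pose b : R := (cos t == 0)%:R; pose b' : R := (P g0 == 0)%:R.
pose Y (tau : R) := solS (t + tau * b) (fun g => P g + (tau * b')%:C%C) T1 T2.
have cZ (c : R) : {for 0, continuous (fun tau : R => tau * c)}.
  by apply: cvgM; [exact: cvg_id|exact: cvg_cst].
have cY : {for 0, continuous Y}.
  apply: solS_cont; try exact: contC_cst.
    by apply: cvgD; [exact: cvg_cst|exact: cZ].
  by move=> g; apply: contCD; [exact: contC_cst|apply: contC_real; exact: cZ].
have Y0 : Y 0 = X.
  apply: val_inj; rewrite /= [RHS]XE mul0r addr0; congr solX; apply/funext => g.
  by rewrite mul0r addr0.
have BY : \forall tau \near (0 : R), B (Y tau).
  by apply: cY; rewrite Y0; exact: open_nbhs_nbhs.
have [e /= e0 eB] := BY.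
pose tau := Num.min (e / 2) 1.
have tau0 : 0 < tau by rewrite lt_min ltr01 divr_gt0.
exists (Y tau); split.
  apply: eB => /=; rewrite sub0r normrN gtr0_norm //.
  have : tau <= e / 2 by rewrite ge_min lexx.
  lra.
have h2 : sqn (P g0 + (tau * b')%:C%C) != 0.
  rewrite sqn_eq0 /b'; have [->|P0] := eqVneq (P g0) 0; last by rewrite mulr0 addr0.
  by rewrite add0r mulr1 fmorph_eq0 gt_eqF.
suff h1 : cos (t + tau * b) != 0 by rewrite /= denom_solX !mulf_neq0 // sqrf_eq0.
rewrite /b; have [ct|ct] := eqVneq (cos t) 0; last by rewrite mulr0 addr0.
  rewrite mulr1 cosD ct mul0r sub0r oppr_eq0 mulf_neq0 //.
    apply/eqP => st; have := cos2Dsin2 t; rewrite ct st; lra.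
  rewrite gt_eqF // sin_gt0_pi // tau0 /=.
  have : tau <= 1 by rewrite ge_min lexx orbT.
  have := pi_ge2 R; lra.
Qed.

(** The coordinates are the amplitudes P g, the translations T1, T2 and the slope
    tan (arg mu / 2) of the phase: size s + 2 complex numbers and a real one. *)
Theorem has_dimension_solutions : has_dimension R (maps_space S) (size s + 2).*2.+1.
Proof.
pose N := size s.
pose P_of (c : nat -> C) g := c (index g s).
pose i0 := index g0 s; have i0N : (i0 < N)%N by rewrite index_mem.
pose c j (Y : maps_space S) := if (j < N)%N then cfp (set_val Y) (delta + nth 0 s j)
  else if j == N then cfp (set_val Y) 0 else cfq (set_val Y) 0.
pose r (Y : maps_space S) := Im (mu_sqn (set_val Y)) / denom (set_val Y).
pose G (a : nat -> C) (u : R) := solS (atan u) (P_of a) (a N) (a N.+1).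
have cE j t P T1 T2 : c j (solS t P T1 T2) =
    if (j < N)%N then P (nth 0 s j) else if j == N then T1 else T2.
  rewrite /c /=; case: ltnP => jN; first by rewrite cfp_solX // mem_nth.
  by case: eqP => _; rewrite ?cfp0_solX ?cfq0_solX.
have rE t P T1 T2 : cos t != 0 -> P g0 != 0 -> r (solS t P T1 T2) = tan t.
  move=> ct P0; rewrite /r denom_solX Im_mu_sqn /tan; move: P0; rewrite -sqn_eq0 => P0.
  by field; rewrite ct P0.
apply: (@has_dimension_chart R (maps_space S) (N + 2) [set X | denom (set_val X) != 0] c r G
  [set x : 'rV[R]_(N + 2).*2.+1 | sqn (getC x i0) != 0]).
- exact: open_neq0 denom_cont.
- exact: dense_denom.
- by apply: open_neq0 => x; exact: cont_sqn (getC_cont i0 x).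
- move=> X /= dX; split.
    move=> j _; rewrite /c; case: (ltnP j N) => jN.
      have [d1 _ _ _ _] := s_good dual_beta0 sE (mem_nth 0 jN).
      exact: (cf_continuous area0 dual_beta0 sU sE X d1).1.
    have [c1 c2] := cf_continuous area0 dual_beta0 sU sE X (dual120 w1 w2).
    by case: eqP => _; [exact: c1|exact: c2].
  have [_ cI] := mu_sqn_cont X; have cd := @denom_cont X.
  exact: (cvgM cI (cvgV dX cd)).
- move=> x _; apply: solS_cont; try by [move=> *; exact: getC_cont].
  by apply: continuous_comp; [exact: getR_cont|exact: continuous_atan].
- move=> X /= dX.
  have [t [P [T1 [T2 XE]]]] := (solutions_solX area0 dual_beta0 sU sE _).1 (set_valP X).
  have {}XE : X = solS t P T1 T2 by exact: val_inj.
  move: dX; rewrite XE /= denom_solX => dX.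
  have ct : cos t != 0 by apply: contra_neq dX => ->; ring.
  have P0 : P g0 != 0 by apply: contra_neq dX => ->; rewrite /sqn /=; ring.
  rewrite rE // !getC_rowC; last by lia.
  rewrite cE i0N nth_index // sqn_eq0; split => //.
  apply: val_inj; rewrite /= !getC_rowC ?cE; try lia.
  rewrite ltnn ltnNge leqnSn eqxx /= (gtn_eqF (ltnSn N)).
  rewrite (cis_tan (cos_atan_neq0 _) ct (atanK _)); apply/funext => z; apply: solX_mono => g gs.
  rewrite /P_of getC_rowC ?cE ?index_mem ?gs ?nth_index //.
  by rewrite (leq_trans _ (leq_addr _ _)) // index_mem.
- move=> x /=; rewrite sqn_eq0 => x0.
  split; first by rewrite /= denom_solX !mulf_neq0 ?sqrf_eq0 ?cos_atan_neq0 ?sqn_eq0.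
  split; last by rewrite rE ?cos_atan_neq0 // atanK.
  move=> j jN; rewrite cE; case: ltnP => jN'; first by rewrite /P_of index_uniq.
  by case: eqP => [->//|jn]; congr getC; lia.
Qed.

End DimensionOfSolutions.

(** * The linear parts of the ambient symmetries are the unitary maps of C^2 *)

Section Unitary.
Variable R : realType.
Local Notation C := R[i].
Implicit Types (x y : 'cV[R]_4) (p q : C) (A : 'M[R]_4).

Lemma dot_cpq x y : \sum_(i < 4) x i 0 * y i 0 =
  2^-1 * Re (cp x * (cp y)^*%C + cq x * (cq y)^*%C).
Proof. by rewrite sum4 !ReImE /=; field. Qed.

Lemma sum_sqr_cpq x : \sum_(i < 4) x i 0 ^+ 2 = 2^-1 * (sqn (cp x) + sqn (cq x)).
Proof.
rewrite sum4 /sqn /cp /cq /=; by field.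
Qed.

Lemma ofpq_lin p q : ofpq p q = Re p *: ofpq 1 0 + Im p *: (Li R *m ofpq 1 0) +
  (Re q *: ofpq 0 1 + Im q *: (Li R *m ofpq 0 1)).
Proof.
by apply: eq_cpq; rewrite !(cpD, cqD, cpZ, cqZ, cp_Li, cq_Li, cp_ofpq, cq_ofpq); apply: eqC;
  rewrite !ReImE /=; ring.
Qed.

(** Commuting with Li means being complex linear in (cp, cq), where 2 |x|^2 = |cp x|^2 + |cq x|^2. *)
Lemma linG_unitary A : linG A -> exists a b c d : C,
  [/\ forall x, cp (A *m x) = a * cp x + b * cq x,
      forall x, cq (A *m x) = c * cp x + d * cq x,
      a * a^*%C + c * c^*%C = 1, b * b^*%C + d * d^*%C = 1 & a * b^*%C + c * d^*%C = 0].
Proof.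
move=> [AA _ AL].
have Ax p q : A *m ofpq p q = Re p *: (A *m ofpq 1 0) + Im p *: (Li R *m (A *m ofpq 1 0)) +
    (Re q *: (A *m ofpq 0 1) + Im q *: (Li R *m (A *m ofpq 0 1))).
  by rewrite (ofpq_lin p q) !mulmxDr -!scalemxAr !mulmxA AL.
pose a := cp (A *m ofpq 1 0); pose b := cp (A *m ofpq 0 1).
pose c := cq (A *m ofpq 1 0); pose d := cq (A *m ofpq 0 1).
have pE x : cp (A *m x) = a * cp x + b * cq x.
  rewrite -{1}(ofpqK x) Ax !(cpD, cpZ, cp_Li) -/a -/b.
  by apply: eqC; rewrite !ReImE /=; ring.
have qE x : cq (A *m x) = c * cp x + d * cq x.
  rewrite -{1}(ofpqK x) Ax !(cqD, cqZ, cq_Li) -/c -/d.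
  by apply: eqC; rewrite !ReImE /=; ring.
have nE x : \sum_(i < 4) (A *m x) i 0 ^+ 2 = \sum_(i < 4) x i 0 ^+ 2.
  have E y : \sum_(i < 4) y i 0 ^+ 2 = (y^T *m y) 0 0.
    by rewrite mxE; apply: eq_bigr => i _; rewrite mxE expr2.
  by rewrite !E trmx_mul -mulmxA (mulmxA A^T) AA mul1mx.
have n p q : sqn (a * p + b * q) + sqn (c * p + d * q) = sqn p + sqn q.
  have := nE (ofpq p q); rewrite !sum_sqr_cpq pE qE cp_ofpq cq_ofpq => e; lra.
exists a, b, c, d; split => //.
- by rewrite !sqnE; have := n 1 0; rewrite !mulr0 !addr0 !mulr1 => e; apply: eqC; move: e; rewrite /sqn /= => e; lra.
- by rewrite !sqnE; have := n 0 1; rewrite !mulr0 !add0r !mulr1 => e; apply: eqC; move: e; rewrite /sqn /= => e; lra.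
- have := n 1 1; have := n 1 'i%C; have := n 1 0; have := n 0 1.
  rewrite !mulr0 !mulr1 !add0r !addr0 /sqn !ReImE /= => n1 n2 n3 n4.
  by apply: eqC; rewrite !ReImE /=; nra.
Qed.

(** The real determinant of a complex 2 x 2 matrix is the square of the modulus of its
    complex determinant. *)
Lemma det_complex (a b c d e f g h : R) :
  0 <= \det (\matrix_(i, j) nth 0 (nth [::] [:: [:: a; - b; c; - d]; [:: b; a; d; c];
    [:: e; - f; g; - h]; [:: f; e; h; g]] i) j : 'M[R]_4).
Proof.
rewrite (expand_det_row _ ord0) !big_ord_recl big_ord0 /cofactor.
rewrite !(expand_det_row _ ord0) !big_ord_recl !big_ord0 /cofactor.
rewrite !(expand_det_row _ ord0) !big_ord_recl !big_ord0 /cofactor !det_mx11 !mxE /=.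
rewrite (_ : _ + _ = (a * g - b * h - (c * e - d * f)) ^+ 2 +
  (a * h + b * g - (c * f + d * e)) ^+ 2); last by rewrite /bump /=; ring.
by rewrite addr_ge0 // sqr_ge0.
Qed.

Lemma eq_mulcV A B : (forall x, A *m x = B *m x) -> A = B.
Proof.
move=> e; apply/matrixP => i j; have := e (delta_mx j 0); rewrite -!colE => /colP/(_ i).
by rewrite [LHS]mxE [RHS]mxE.
Qed.

Lemma det_Li_comm A : A *m Li R = Li R *m A -> 0 <= \det A.
Proof.
move=> AL.
have d1 : delta_mx 1 0 = Li R *m delta_mx 0 0 :> 'cV_4.
  by have [e0 e1 e2 e3] := Li_mulE (delta_mx 0 0 : 'cV[R]_4);
    apply: col4P; rewrite ?e0 ?e1 ?e2 ?e3 !mxE /= ?oppr0.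
have d3 : delta_mx 3 0 = Li R *m delta_mx 2 0 :> 'cV_4.
  by have [e0 e1 e2 e3] := Li_mulE (delta_mx 2 0 : 'cV[R]_4);
    apply: col4P; rewrite ?e0 ?e1 ?e2 ?e3 !mxE /= ?oppr0.
have c1 : col 1 A = Li R *m col 0 A by rewrite !colE d1 !mulmxA AL.
have c3 : col 3 A = Li R *m col 2 A by rewrite !colE d3 !mulmxA AL.
have [a0 a1 a2 a3] := Li_mulE (col 0 A); have [b0 b1 b2 b3] := Li_mulE (col 2 A).
move: a0 a1 a2 a3 b0 b1 b2 b3; rewrite -c1 -c3 ![col _ _ _ _]mxE => a0 a1 a2 a3 b0 b1 b2 b3.
have := det_complex (A 0 0) (A 1 0) (A 0 2) (A 1 2) (A 2 0) (A 3 0) (A 2 2) (A 3 2).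
rewrite (_ : \matrix_(i, j) _ = A) //; apply/matrixP => i j; rewrite mxE.
by move: i j; apply: forall_ord4; apply: forall_ord4; rewrite /= ?a0 ?a1 ?a2 ?a3 ?b0 ?b1 ?b2 ?b3.
Qed.

Definition unitary_map (mu v1 v2 : C) x : 'cV[R]_4 :=
  ofpq (v1^*%C * cp x + v2^*%C * cq x) (mu^*%C * (v1 * cq x - v2 * cp x)).

(** In the coordinates (cp, cq) the map has orthonormal rows (conj v1, conj v2) and
    conj mu (- v2, v1); its first row sends (v1, v2) to 1 and its second row to 0. *)
Lemma unitary_linG mu v1 v2 : mu * mu^*%C = 1 -> v1 * v1^*%C + v2 * v2^*%C = 1 ->
  exists2 A, linG A & forall x, A *m x = unitary_map mu v1 v2 x.
Proof.
move=> mu1 v12; set f := unitary_map mu v1 v2.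
have fD x y : f (x + y) = f x + f y.
  by apply: eq_cpq; rewrite ?cpD ?cqD !(cp_ofpq, cq_ofpq) cpD cqD; ring.
have fZ (c : R) x : f (c *: x) = c *: f x.
  by apply: eq_cpq; rewrite ?cpZ ?cqZ !(cp_ofpq, cq_ofpq) cpZ cqZ; ring.
pose A := \matrix_(i, j) f (delta_mx j 0) i 0.
have AE x : A *m x = f x.
  apply/colP => i; rewrite mxE {2}(matrix_sum_delta x).
  rewrite (big_morph f fD (id1 := 0)); last by have := fZ 0 0; rewrite !scale0r.
  rewrite summxE; apply: eq_bigr => j _.
  by rewrite big_ord1 fZ [RHS]mxE mulrC; congr (_ * _); rewrite mxE.
have A1 : A *m Li R = Li R *m A.
  apply: eq_mulcV => x; rewrite -!mulmxA !AE.
  by apply: eq_cpq; rewrite ?cp_Li ?cq_Li !(cp_ofpq, cq_ofpq) cp_Li cq_Li; ring.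
have A2 : A^T *m A = 1%:M.
  apply/matrixP => i j; rewrite mxE (eq_bigr (fun k =>
    (A *m delta_mx i 0 : 'cV_4) k 0 * (A *m delta_mx j 0 : 'cV_4) k 0)) => [|k _]; last first.
    by rewrite -!colE ![col _ _ _ _]mxE [A^T _ _]mxE.
  rewrite dot_cpq !AE !(cp_ofpq, cq_ofpq).
  rewrite (_ : _ * _^*%C + _ = cp (delta_mx i 0) * (cp (delta_mx j 0))^*%C +
    cq (delta_mx i 0) * (cq (delta_mx j 0))^*%C); last first.
    move: (cp (delta_mx i 0)) (cq (delta_mx i 0)) (cp (delta_mx j 0)) (cq (delta_mx j 0)) => p q p' q'.
    rewrite !conjCM !conjCD !conjCN !conjCM !conjcK.
    transitivity ((mu * mu^*%C) * (v1 * q - v2 * p) * (v1^*%C * q'^*%C - v2^*%C * p'^*%C) +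
      (v1^*%C * p + v2^*%C * q) * (v1 * p'^*%C + v2 * q'^*%C)); first by ring.
    rewrite mu1 mul1r; transitivity ((v1 * v1^*%C + v2 * v2^*%C) * (p * p'^*%C + q * q'^*%C));
      first by ring.
    by rewrite v12 mul1r.
  rewrite -dot_cpq sum4; move: i j; apply: forall_ord4; apply: forall_ord4; rewrite !mxE /=; ring.
exists A => //; split => //.
have dA : \det A ^+ 2 = 1 by rewrite expr2 -{1}det_tr -det_mulmx A2 det1.
by have := det_Li_comm A1; move/eqP: dA; rewrite sqrf_eq1 => /orP[/eqP//|/eqP ->]; rewrite lerNr oppr0 ler10.
Qed.

End Unitary.

(** * The dimension of the space of orbits *)

Section QuotientChart.
Local Open Scope quotient_scope.
Variable R : realType.
Local Notation C := R[i].

(** Coordinates on T that are constant on the classes descend to the quotient, where G is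
    an inverse as soon as it returns to the same class. *)
Lemma has_dimension_quotient (T : topologicalType) (Q0 : quotType T) m (c : nat -> T -> C) (r : T -> R)
    (G : (nat -> C) -> R -> T) :
  let Q := quotient_topology Q0 in
  (forall j, (j < m)%N -> forall X, contC X (c j)) -> continuous r -> (forall X, 0 <= r X) ->
  dense [set X | r X != 0] ->
  (forall X Y, \pi_Q X = \pi_Q Y :> Q ->
    (forall j, (j < m)%N -> c j X = c j Y) /\ r X = r Y) ->
  (forall x : 'rV[R]_(m.*2.+1), 0 < getR x ->
    {for x, continuous (fun x => G (getC x) (getR x))}) ->
  (forall X, r X != 0 ->
    \pi_Q (G (getC (rowC m (c^~ X) (r X))) (r X)) = \pi_Q X :> Q) ->
  (forall x : 'rV[R]_(m.*2.+1), 0 < getR x ->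
    (forall j, (j < m)%N -> c j (G (getC x) (getR x)) = getC x j) /\
     r (G (getC x) (getR x)) = getR x) ->
  has_dimension R Q m.*2.+1.
Proof.
move=> Q cc cr r0 dr inv cG FG GF.
have rE (X : T) : (forall j, (j < m)%N -> c j (repr (\pi_Q X : Q)) = c j X) /\
    r (repr (\pi_Q X : Q)) = r X.
  by apply: inv; rewrite reprK.
have ccQ j (q : Q) : (j < m)%N -> contC q (fun q : Q => c j (repr q)).
  move=> jm; split.
    apply: (@repr_comp_continuous T Q0 R (fun X => Re (c j X))).
      by move=> X; have [] := cc j jm X.
    by move=> X Y /eqP /inv[-> //].
  apply: (@repr_comp_continuous T Q0 R (fun X => Im (c j X))).
    by move=> X; have [] := cc j jm X.
  by move=> X Y /eqP /inv[-> //].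
have crQ : continuous (fun q : Q => r (repr q)).
  apply: (@repr_comp_continuous T Q0 R r) => //.
  by move=> X Y /eqP /inv[_ ->].
apply: (@has_dimension_chart R Q m [set q : Q | r (repr q) != 0] (fun j q => c j (repr q)) (fun q => r (repr q))
  (fun a u => \pi_Q (G a u)) [set x : 'rV[R]_(m.*2.+1) | 0 < getR x]).
- exact: open_neq0.
- move=> B [q Bq] oB; have [X [BX rX]] : (\pi_Q @^-1` B) `&` [set X | r X != 0] !=set0.
    by apply: dr => //; exists (repr q); rewrite /= reprK.
  by exists (\pi_Q X : Q); split => //=; rewrite (rE X).2.
- rewrite (_ : [set x | _] = (@getR R m) @^-1` [set u | 0 < u]) //.
  by apply: open_comp; [move=> x _; exact: getR_cont|exact: open_gt].
- by move=> q _; split => [j jm|]; [exact: ccQ|exact: crQ].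
- move=> x Wx; apply: continuous_comp; first exact: cG.
  exact: pi_continuous.
- move=> q /= rq; split; first by rewrite getR_rowC lt_neqAle eq_sym rq r0.
  by rewrite (FG (repr q) rq) reprK.
- move=> x /= Wx; have [cx rx] := GF x Wx; have [e1 e2] := rE (G (getC x) (getR x)).
  rewrite e2 rx gt_eqF //; split => //; split => // j jm.
  by rewrite e1 // cx.
Qed.

End QuotientChart.

Section DimensionOfOrbits.
Variable R : realType.
Local Open Scope quotient_scope.
Local Notation C := R[i].
Variables w1 w2 : C.
Hypothesis area0 : area w1 w2 != 0.
Local Notation dual12 := (dual12 w1 w2).
Local Notation lat := (lat w1 w2).
Local Notation coef := (coef w1 w2).
Local Notation cfp := (cfp w1 w2).
Local Notation cfq := (cfq w1 w2).
Variable beta0 : C.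
Hypothesis dual_beta0 : dual12 beta0.
Local Notation delta := (beta0 / 2).
Variable s : seq C.
Hypothesis sU : uniq s.
Hypothesis sE : forall g, (g \in s) <-> freqs lat beta0 g.
Local Notation S := (solutions lat beta0).
Local Notation solS := (solS area0 dual_beta0 sU sE).

Let sg g : g \in s -> good w1 w2 beta0 g.
Proof. by move=> gs; refine (s_good dual_beta0 sE gs). Qed.

Lemma s_opp g : (- g \in s) = (g \in s).
Proof.
have h g' : g' \in s -> - g' \in s.
  by move=> /sg /goodN gg; apply/sE; rewrite freqsE.
by apply/idP/idP => /h //; rewrite opprK.
Qed.

Lemma sum_opp (F : C -> C) : \sum_(g <- s) F g = \sum_(g <- s) F (- g).
Proof.
rewrite -(big_map -%R xpredT F); apply: perm_big; apply: uniq_perm => //.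
  by rewrite map_inj_uniq //; exact: oppr_inj.
by move=> g; rewrite -(s_opp g) -[g in RHS]opprK (mem_map (@oppr_inj C)).
Qed.

Lemma cfq_solX_opp mu P T1 T2 g : g \in s ->
  cfq (solX beta0 s mu P T1 T2) (delta + g) = - mu * ((delta - g) / (delta + g)) * (P (- g))^*%C.
Proof.
move=> gs; have gs' : - g \in s by rewrite s_opp.
by have := cfq_solX area0 dual_beta0 sU sE mu P T1 T2 gs'; rewrite opprK.
Qed.

(** The ratio of the orthogonal vectors delta + g and delta - g is purely imaginary. *)
Lemma ratio_conj g : g \in s ->
  (delta + g) / (delta - g) * ((delta - g) / (delta + g))^*%C = -1.
Proof.
move=> /sg gg; have [_ _ n1 n2 _] := gg; have := good_orth gg.
have j1 : (delta + g)^*%C != 0 by rewrite conjc_eq0.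
rewrite conjCM (_ : ((delta + g)^-1)^*%C = ((delta + g)^*%C)^-1); last exact: (fmorphV (@conjc R)).
move: (delta + g) (delta - g) n1 n2 j1 => a b a0 b0; move: a^*%C b^*%C => a' b' a1 e.
transitivity (a * b' / (a' * b)); first by field; rewrite ?a0 ?b0 ?a1.
by rewrite e mulNr divff // mulf_neq0.
Qed.

(** Because s is stable under g |-> - g, the sums solP and solQ run over the same
    frequencies, so that a unitary change of (cp, cq) gives a sum of the same form; its
    phase is normalised to 1. *)
Lemma unitary_solX mu v1 v2 P T1 T2 z : mu * mu^*%C = 1 ->
  unitary_map mu v1 v2 (solX beta0 s mu P T1 T2 z) =
  solX beta0 s 1 (fun g => v1^*%C * P g +
      v2^*%C * (- mu * ((delta - g) / (delta + g)) * (P (- g))^*%C))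
    (v1^*%C * T1 + v2^*%C * T2) (mu^*%C * (v1 * T2 - v2 * T1)) z.
Proof.
move=> mu1; rewrite /unitary_map !cp_solX !cq_solX; apply: eq_cpq.
  rewrite [LHS]cp_ofpq [RHS]cp_solX /solP /solQ /trig [X in _ + _ * (_ + X)]sum_opp !mulrDr addrACA; congr (_ + _).
  rewrite !mulr_sumr -big_split; apply: eq_bigr => g _ /=; rewrite opprK; ring.
rewrite [LHS]cq_ofpq [RHS]cq_solX /solP /solQ /trig [X in _ - _ * (_ + X)]sum_opp.
rewrite /= [LHS](_ : _ = mu^*%C * (v1 * T2 - v2 * T1) +
  mu^*%C * (v1 * (\sum_(g <- s) - mu * ((delta + g) / (delta - g)) * (P g)^*%C * expw (delta - g) z)
    - v2 * \sum_(g <- s) P (- g) * expw (delta - g) z)); last by ring.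
congr (_ + _); rewrite !mulr_sumr -sumrB mulr_sumr big_seq [RHS]big_seq.
apply: eq_bigr => g gs; rewrite [in RHS]conjCD !conjCM !conjcK conjCN.
have e := ratio_conj gs; move: (delta + g) (delta - g) e => a b e.
transitivity (- (mu * mu^*%C) * (a / b) * v1 * (P g)^*%C * expw b z +
  -1 * mu^*%C * v2 * P (- g) * expw b z); first by ring.
rewrite mu1; rewrite conjCM in e.
transitivity (- (a / b * v1 * (P g)^*%C * expw b z) +
  a / b * (b^*%C * (a^-1)^*%C) * mu^*%C * v2 * P (- g) * expw b z); last by ring.
by rewrite e; ring.
Qed.

Variable g0 : C.
Hypothesis g0s : g0 \in s.

(** A symmetry of R^4 acts on the vectors (cfp X (delta + g), cfq X (delta + g)) of C^2
    by one unitary matrix; their Hermitian products with the vector of g0 are the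
    invariants that serve as coordinates. *)
Definition herm X g : C := cfp X (delta + g) * (cfp X (delta + g0))^*%C +
  cfq X (delta + g) * (cfq X (delta + g0))^*%C.
Lemma hermE X g p : cfp X (delta + g0) = p -> cfq X (delta + g0) = 0 ->
  herm X g = cfp X (delta + g) * p^*%C.
Proof.
rewrite /herm => -> ->; move: (cfp X _) (cfq X _) => x y.
by rewrite conjc0 mulr0 addr0.
Qed.

Definition modul X : R := Num.sqrt (Re (herm X g0)).

Lemma hermg0 X : herm X g0 = (sqn (cfp X (delta + g0)) + sqn (cfq X (delta + g0)))%:C%C.
Proof.
rewrite /herm; move: (cfp X (delta + g0)) (cfq X (delta + g0)) => p q.
by apply: eqC; rewrite /sqn !ReImE /=; ring.
Qed.

Lemma sqn_ge0 (z : C) : 0 <= sqn z. Proof. by rewrite addr_ge0 // sqr_ge0. Qed.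

Lemma modul_sqr X : (modul X ^+ 2)%:C%C = herm X g0.
Proof. by rewrite /modul hermg0 sqr_sqrtr // addr_ge0 // sqn_ge0. Qed.

Lemma coef_lin (p q : C -> C) (a b k eta : C) : CPC w1 w2 p -> CPC w1 w2 q -> dual12 eta ->
  eta != 0 -> coef (fun z => a * p z + b * q z + k) eta = a * coef p eta + b * coef q eta.
Proof.
move=> cp cq de e0; have ap := CPCZ a cp; have bq := CPCZ b cq.
rewrite (coefD area0 (CPCD ap bq) (CPC_cst w1 w2 k) de) (coefD area0 ap bq de).
by rewrite (coefZ area0 a cp de) (coefZ area0 b cq de) (coef_cst area0 k de) (negbTE e0) mulr0 addr0.
Qed.

Lemma herm_sameG X Y g : S X -> sameG X Y -> g \in s -> herm Y g = herm X g.
Proof.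
move=> SX [A [T [AG ->]]] gs.
have [a [b [c [d [pE qE h1 h2 h3]]]]] := linG_unitary AG.
have [cX dX] := CPC_solution area0 dual_beta0 sU sE SX.
have E h : h \in s -> cfp (fun z => A *m X z + T) (delta + h) =
      a * cfp X (delta + h) + b * cfq X (delta + h) /\
    cfq (fun z => A *m X z + T) (delta + h) = c * cfp X (delta + h) + d * cfq X (delta + h).
  move=> /sg[dh _ nh _ _].
  have eP : (fun z => cp (A *m X z + T)) = (fun z => a * cp (X z) + b * cq (X z) + cp T).
    by apply/funext => z; rewrite cpD pE.
  have eQ : (fun z => cq (A *m X z + T)) = (fun z => c * cp (X z) + d * cq (X z) + cq T).
    by apply/funext => z; rewrite cqD qE.
  rewrite /cfp /cfq eP eQ; split.
    exact: (coef_lin a b (cp T) cX dX dh nh).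
  exact: (coef_lin c d (cq T) cX dX dh nh).
have [e1 e2] := E g gs; have [e3 e4] := E g0 g0s; rewrite /herm e1 e2 e3 e4.
move: (cfp X (delta + g0)) (cfp X (delta + g)) => p0 p.
move: (cfq X (delta + g0)) (cfq X (delta + g)) => q0 q; rewrite !conjCD !conjCM.
have h4 : b * a^*%C + d * c^*%C = 0.
  by have := congr1 (@conjc R) h3; rewrite conjCD !conjCM !conjcK conjc0 mulrC [d * _]mulrC.
rewrite [LHS](_ : _ = (a * a^*%C + c * c^*%C) * (p * p0^*%C) + (b * b^*%C + d * d^*%C) * (q * q0^*%C)
  + (a * b^*%C + c * d^*%C) * (p * q0^*%C) + (b * a^*%C + d * c^*%C) * (q * p0^*%C)); last by ring.
by rewrite h1 h2 h3 h4; ring.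
Qed.

Lemma g0_opp : - g0 != g0.
Proof.
have [_ _ n _ e] := sg g0s; apply/eqP => e0.
have g00 : g0 = 0.
  have : 2 * g0 = 0 by rewrite -{1}(addrN g0) e0; ring.
  by move/eqP; rewrite mulf_eq0 pnatr_eq0 /= => /eqP.
move: n; rewrite g00 addr0; move/eqP: e; rewrite g00 mul0r eq_sym sqnE fmorph_eq0 sqn_eq0.
by move=> ->.
Qed.

(** The relation between the coefficients of cp and cq makes the vectors of g0 and - g0
    orthogonal. *)
Lemma herm_opp mu P T1 T2 : mu * mu^*%C = 1 -> herm (solX beta0 s mu P T1 T2) (- g0) = 0.
Proof.
move=> mu1; rewrite /herm cfp_solX ?s_opp // cfp_solX //.
rewrite cfq_solX // (cfq_solX_opp mu P T1 T2 g0s).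
rewrite [LHS](_ : _ = P (- g0) * (P g0)^*%C * (1 + (mu * mu^*%C) *
  ((delta + g0) / (delta - g0) * ((delta - g0) / (delta + g0))^*%C))); last first.
  by rewrite !conjCM conjCN !conjcK; ring.
by rewrite mu1 ratio_conj // mul1r subrr mulr0.
Qed.

Lemma solX_shift mu P T1 T2 z :
  solX beta0 s mu P T1 T2 z = solX beta0 s mu P 0 0 z + ofpq T1 T2.
Proof.
by apply: eq_cpq; rewrite ?cpD ?cqD ?cp_solX ?cq_solX ?cp_ofpq ?cq_ofpq /solP /solQ /trig add0r addrC.
Qed.

Lemma herm_div (p q p0 q0 : C) (u : R) :
  (p0 / u%:C%C)^*%C * p + (q0 / u%:C%C)^*%C * q = (p * p0^*%C + q * q0^*%C) / u%:C%C.
Proof.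
rewrite !conjCM (_ : ((u%:C%C)^-1)^*%C = (u%:C%C)^-1); last by rewrite -fmorphV conjCR.
by ring.
Qed.

Lemma herm_div2 (p q : C) (u : R) : (p * p^*%C + q * q^*%C) / (u%:C%C * u%:C%C) =
  p / u%:C%C * (p / u%:C%C)^*%C + q / u%:C%C * (q / u%:C%C)^*%C.
Proof. by rewrite [RHS](_ : _ = (p * p^*%C + q * q^*%C) / u%:C%C / u%:C%C); [rewrite invfM mulrA|rewrite -herm_div; ring]. Qed.

(** The unitary map that sends the vector of g0 to (modul X, 0) brings X to a normal form,
    in which the amplitude of g is determined by the invariants. *)
Lemma sameG_normal X Y t P : X = solX beta0 s (cis (2 * t)) P (cfp X 0) (cfq X 0) ->
  modul X != 0 -> Y = solX beta0 s 1 (fun g => herm X g / (modul X)%:C%C) 0 0 -> sameG Y X.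
Proof.
move=> XE u0 YE; apply: sameG_sym; set u := modul X in u0 YE.
have uC : u%:C%C != 0 :> C by rewrite fmorph_eq0.
have mu1 : cis (2 * t) * (cis (2 * t))^*%C = 1 by rewrite cisJ cisKV.
pose v1 := cfp X (delta + g0) / u%:C%C; pose v2 := cfq X (delta + g0) / u%:C%C.
have v12 : v1 * v1^*%C + v2 * v2^*%C = 1.
  rewrite -herm_div2 // -/(herm X g0) -modul_sqr -/u expr2 rmorphM divff //.
  by rewrite mulf_neq0.
have [A AG AE] := unitary_linG mu1 v12.
exists A, (- ofpq (v1^*%C * cfp X 0 + v2^*%C * cfq X 0)
  ((cis (2 * t))^*%C * (v1 * cfq X 0 - v2 * cfp X 0))); split => //.
rewrite YE; apply/funext => z; rewrite AE {2}XE unitary_solX // [X in _ = X + _]solX_shift addrK.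
apply: solX_mono => g gs.
have pE : cfp X (delta + g) = P g by rewrite XE cfp_solX.
have qE : cfq X (delta + g) = - cis (2 * t) * ((delta - g) / (delta + g)) * (P (- g))^*%C.
  by rewrite XE (cfq_solX_opp _ _ _ _ gs).
rewrite -pE -qE; exact: (esym (herm_div _ _ (cfp X (delta + g0)) (cfq X (delta + g0)) u)).
Qed.

Let orbitP (X Y : maps_space S) :
  \pi_(orbit_space S) X = \pi_(orbit_space S) Y <-> sameG (set_val X) (set_val Y).
Proof.
have e := @eqquotP _ _ {eq_quot (same_orbit_equiv S)}%qT X Y.
by split => [/e/asboolP|XY] //; apply/e/asboolP.
Qed.

(** In the normal form the amplitude of g0 is a positive number, that of - g0 is 0 and the
    remaining size s - 2 ones are free. *)
Theorem has_dimension_orbits : has_dimension R (orbit_space S) (size s - 2).*2.+1.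
Proof.
have opg0 : - g0 \in s by rewrite s_opp.
pose s' := rem (- g0) (rem g0 s).
have s'E g : (g \in s') = [&& g != - g0, g != g0 & g \in s].
  by rewrite /s' !mem_rem_uniq ?rem_uniq // !inE mem_rem_uniq // !inE.
have s'U : uniq s' by rewrite !rem_uniq.
have s'N : size s' = (size s - 2)%N.
  have h : - g0 \in rem g0 s by rewrite mem_rem_uniq // !inE g0_opp.
  by rewrite /s' (size_rem h) size_rem // -!subn1 -subnDA.
rewrite -s'N; set m := size s'.
have s's j : (j < m)%N -> nth 0 s' j \in s by move=> /(mem_nth 0); rewrite s'E => /and3P[].
pose c j (X : maps_space S) := herm (set_val X) (nth 0 s' j).
pose r (X : maps_space S) := modul (set_val X).
pose P_of (a : nat -> C) (u : R) g := if g == g0 then u%:C%C else if g == - g0 then 0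
  else a (index g s') * (u^-1)%:C%C.
pose G (a : nat -> C) (u : R) := solS 0 (P_of a u) 0 0.
have ch g : g \in s -> forall X : maps_space S, contC X (fun Y => herm (set_val Y) g).
  move=> /sg[d1 _ _ _ _] X; have [d2 _ _ _ _] := sg g0s.
  have [p1 q1] := cf_continuous area0 dual_beta0 sU sE X d1.
  have [p2 q2] := cf_continuous area0 dual_beta0 sU sE X d2.
  exact: (contCD (contCM p1 (contCJ p2)) (contCM q1 (contCJ q2))).
have wq0 a u : cfq (set_val (G a u)) (delta + g0) = 0.
  by rewrite (cfq_solX_opp _ _ _ _ g0s) /P_of (negbTE g0_opp) eqxx conjc0 mulr0.
have wp0 a u : cfp (set_val (G a u)) (delta + g0) = u%:C%C.
  by rewrite cfp_solX // /P_of eqxx.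
have rG a u : 0 <= u -> r (G a u) = u.
  move=> u0; rewrite /r /modul hermg0 wq0 wp0 /= /sqn /= expr0n /= !addr0 sqrtr_sqr.
  exact: ger0_norm.
apply: (@has_dimension_quotient R (maps_space S) _ m c r G).
- by move=> j /s's js X; exact: ch.
- move=> X; have [c1 _] := ch g0 g0s X.
  exact: (continuous_comp c1 (@sqrt_continuous R _)).
- by move=> X; exact: sqrtr_ge0.
- move=> B B0 oB; have [X [BX dX]] := dense_denom area0 dual_beta0 sU sE g0s B0 oB.
  exists X; split => //=; apply: contra_neq dX; rewrite /r /modul => /eqP.
  rewrite sqrtr_eq0 hermg0 /= => h.
  have p0 : cfp (set_val X) (delta + g0) = 0.
    apply/eqP; rewrite -sqn_eq0 eq_le sqn_ge0 andbT.
    by apply: le_trans h; rewrite lerDl sqn_ge0.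
  by rewrite /denom /mu_sqn p0 mulr0 /sqn /=; ring.
- move=> X Y /orbitP XY.
  have hE g := @herm_sameG _ _ g (set_valP X) XY.
  split; first by move=> j /s's js; rewrite /c hE.
  by rewrite /r /modul hE.
- move=> x x0.
  have c0 : {for x, continuous (fun _ : 'rV[R]_(m.*2.+1) => (0 : R))} by exact: cst_continuous.
  apply: solS_cont; last 2 first; [exact: contC_cst|exact: contC_cst|exact: c0|].
  move=> g; rewrite /P_of; case: eqP => _; first by apply: contC_real; exact: getR_cont.
  case: eqP => _; first exact: contC_cst.
  apply: contCM; first exact: getC_cont.
  by apply: contC_real; exact: (cvgV (lt0r_neq0 x0) (@getR_cont R m x)).
- move=> X rX; apply/orbitP.
  have [t XE] := solution_coef area0 dual_beta0 sU sE (set_valP X).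
  apply: (sameG_normal XE rX).
  set a := getC _; have -> : set_val (G a (r X)) = solX beta0 s (cis (2 * 0)) (P_of a (r X)) 0 0.
    by [].
  rewrite mulr0 cis0.
  apply/funext => z; apply: solX_mono => g gs; rewrite /P_of.
  case: eqP => [->|/eqP g1].
    by rewrite -modul_sqr expr2 rmorphM mulfK // fmorph_eq0.
  case: eqP => [->|/eqP g2].
    by rewrite {1}XE herm_opp ?mul0r // cisJ cisKV.
  have gs' : g \in s' by rewrite s'E g1 g2.
  by rewrite /a getC_rowC ?index_mem // /c nth_index // fmorphV.
- move=> x x0; split; last by rewrite rG // ltW.
  move=> j jm; rewrite /c (hermE _ (wp0 _ _) (wq0 _ _)) conjCR.
  rewrite cfp_solX ?s's // /P_of; have := mem_nth 0 jm; rewrite s'E => /and3P[/negbTE -> /negbTE -> _].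
  by rewrite index_uniq // -mulrA -rmorphM mulVf ?gt_eqF // mulr1.
Qed.

End DimensionOfOrbits.

Theorem theorem4 (R : realType) (Gamma : set R[i]) (hGamma : is_lattice Gamma) :
  (forall (X : R[i] -> 'cV[R]_4) (beta : R[i] -> R), HSL Gamma X beta ->
     exists2 beta0 : R[i], dual_lattice Gamma beta0 &
       forall z : R[i], beta0_at beta z = beta0) /\
  (forall beta0 : R[i], dual_lattice Gamma beta0 ->
     [/\ finite_set (freqs Gamma beta0),
         (forall g : R[i], freqs Gamma beta0 g ->
            lattice_periodic Gamma (Agam beta0 g) /\ lattice_periodic Gamma (Bgam beta0 g)),
         solutions Gamma beta0 =
           G2_orbit (linear_span (generators Gamma beta0)) &
         freqs Gamma beta0 !=set0 ->
           has_dimension R (maps_space (solutions Gamma beta0))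
             (2 * #|` fset_set (freqs Gamma beta0)| + 5)%N /\
           has_dimension R (orbit_space (solutions Gamma beta0))
             (2 * #|` fset_set (freqs Gamma beta0)| - 3)%N]).
Proof.
have [w1 [w2 [area0 ->]]] := lattice_basis hGamma.
split=> [X beta hsl|beta0 /dual_latticeE db].
  have [b db bE] := HSL_angle area0 hsl.
  by exists b; [apply/dual_latticeE|move=> z; exact: beta0_affine bE].
have fin := finite_freqs area0 db.
pose s : seq R[i] := fset_set (freqs (lat w1 w2) beta0).
have sU : uniq s := fset_uniq _.
have sE g : (g \in s) <-> freqs (lat w1 w2) beta0 g.
  by rewrite /s in_fset_set // in_setE.
split; first exact: fin.
- by move=> g /(freqsE db); exact: AB_periodic.
- apply/seteqP; split => X.
    by move=> /(solutions_solX area0 db sU sE) /(G2_orbit_solX db sU sE).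
  by move=> /(G2_orbit_solX db sU sE) /(solutions_solX area0 db sU sE).
- move=> [g0 /sE g0s]; have -> : #|` fset_set (freqs (lat w1 w2) beta0)| = size s by [].
  have s2 : (1 < size s)%N.
    have : {subset [:: g0; - g0] <= s}.
      by apply/allP; rewrite /= (s_opp db sE) g0s.
    by move/uniq_leq_size; apply; rewrite /= inE eq_sym (g0_opp db sE g0s).
  have e1 (n : nat) : (2 * n + 5)%N = (n + 2).*2.+1 by lia.
  have e2 (n : nat) : (1 < n)%N -> (2 * n - 3)%N = (n - 2).*2.+1 by lia.
  rewrite e1 e2 //; split.
    exact: (has_dimension_solutions area0 db sU sE g0s).
  exact: (has_dimension_orbits area0 db sU sE g0s).
Qed.
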